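(* For every positive integer $k$ and $\tau$ in the upper half-plane, with $q=e^{2\pi i\tau}$, \[ \mathrm{d}G_{-2k}(\tau)=\frac{(-1)^k(2k)!}{(2\pi)^{2k}}\Big\{2\sum_{n\ge1}\frac{n^{-2k-1}}{1-q^n}-\zeta(2k+1)\Big\}=\frac{(-1)^k(2k)!}{(2\pi)^{2k}}\Big\{\zeta(2k+1)+2\sum_{n\ge1}\sigma_{-2k-1}(n)q^n\Big\}. \] In particular $\mathrm{d}G_{-2k}(i\infty)=\frac{(-1)^k(2k)!}{(2\pi)^{2k}}\zeta(2k+1)\neq0$.
   Context: Complex powers use the branch $-\pi\le\arg z<\pi$. For $\Re s>2$, $G(s,\tau)=\sum'_{m,n\in\mathbb Z}(m\tau+n)^{-s}$ (term $(0,0)$ omitted), analytically continued to all $s\in\mathbb C$; $\mathrm{d}G_m(\tau)=\frac{\partial}{\partial s}G(s,\tau)|_{s=m}$. $\sigma_a(n)=\sum_{d\mid n}d^a$. *)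

(* Defs.v *)
From Stdlib Require Export Reals ZArith List ClassicalEpsilon.
From Coquelicot Require Export Coquelicot.

Open Scope R_scope.

Definition Cexp (z : C) : C :=
  (exp (Re z) * cos (Im z), exp (Re z) * sin (Im z)).

(* The argument in [-PI, PI): on the negative real axis the second branch
   gives - acos (-1) = - PI. The value at z = 0 is irrelevant. *)
Definition Carg (z : C) : R :=
  if Rlt_dec 0 (Im z) then acos (Re z / Cmod z) else - acos (Re z / Cmod z).

Definition Clog (z : C) : C := (ln (Cmod z), Carg z).

(* z ^ w for z <> 0 *)
Definition Cpower (z w : C) : C := Cexp (w * Clog z)%C.

(* Unordered summation: convergence along the net of finite subsets of I. *)
Definition is_usum {I : Type} (a : I -> C) (l : C) : Prop :=
  forall eps : R, 0 < eps ->
  exists L0 : list I, forall L : list I, NoDup L -> incl L0 L ->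
    Cmod (fold_right (fun i acc => a i + acc)%C (RtoC 0) L - l)%C < eps.

Definition eis_term (s tau : C) (p : Z * Z) : C :=
  let (m, n) := p in
  if (Z.eqb m 0 && Z.eqb n 0)%bool then RtoC 0
  else Cpower (RtoC (IZR m) * tau + RtoC (IZR n))%C (- s)%C.

Definition entire (g : C -> C) : Prop :=
  forall s : C, @ex_derive C_AbsRing C_NormedModule g s.

Definition is_eis_continuation (tau : C) (g : C -> C) : Prop :=
  entire g /\ forall s : C, 2 < Re s -> is_usum (eis_term s tau) (g s).

(* The analytic continuation is selected by epsilon. By the identity theorem
   at most one function satisfies is_eis_continuation tau, so for Im tau > 0
   the choice is forced once a continuation is shown to exist. *)
Definition G (s tau : C) : C :=
  epsilon (inhabits (fun _ : C => RtoC 0)) (is_eis_continuation tau) s.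

Definition dG (m : Z) (tau : C) : C :=
  C_derive (fun s : C => G s tau) (RtoC (IZR m)).

Definition zeta (s : R) : R := Series (fun n : nat => Rpower (INR (S n)) (- s)).

Definition sigma (a : Z) (n : nat) : R :=
  fold_right Rplus 0
    (map (fun d : nat => powerRZ (INR d) a)
         (filter (fun d : nat => Nat.eqb (Nat.modulo n d) 0) (seq 1 n))).

Definition nome (tau : C) : C := Cexp (2 * PI * Ci * tau)%C.

Definition dG_coef (k : nat) : R :=
  (-1) ^ k * INR (fact (2 * k)) / (2 * PI) ^ (2 * k).

Definition at_i_infty (P : C -> Prop) : Prop :=
  exists M : R, forall tau : C, M < Im tau -> P tau.

(* Main.v *)
Require Import Defs.
From Stdlib Require Import Lra Lia Psatz Permutation.

(** Write [m tau + n] with [m < 0] (or [m = 0], [n < 0]) as minus a point of the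
    closed upper half-plane: the series becomes
    [(1 + e^(i pi s)) (zeta s + sum_(m >= 1) sum_n (m tau + n)^(-s))].
    Integrating [w^(-s) / (e^(2 pi i (w - z)) - 1)] over large boxes and expanding
    the kernel along a path around the negative imaginary axis gives Lipschitz'
    formula [sum_n (z + n)^(-s) = c(s) sum_(r >= 1) r^(s-1) e^(2 pi i r z)], where
    [c(s) = (-2 pi i)^s / Gamma(s)] appears as Hankel's integral. Letting [z] tend
    to [0] in the same integral gives Riemann's functional equation
    [(1 + e^(-i pi s)) zeta(s) = c(s) zeta(1 - s)]. Both integrals are entire in
    [s], hence so is the continuation. Near [-2k] everything is a multiple of
    [c], which has a simple zero there; its derivative follows from
    [s c(s+1) = -2 pi i c(s)] and [c(1) = -2 pi i].

    The continuation is unique by the identity theorem, obtained from Goursat's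
    theorem on rectangles. *)

(** * Limits, derivatives and integrals of complex functions *)

(** The sign flip comes from the branch: for nonzero [w] in the closed upper half-plane, -w has
    argument arg w - pi in [-pi, pi), so (-w)^(-s) = e^(i pi s) w^(-s). This covers all of the row m
    = 0, whose two halves the flip exchanges. Powers of [w] therefore live off the negative
    imaginary axis, and the legs of the path run at Re w = -1/2 and Re w = 1/2, where e^(2 pi i w)
    is a negative real and the kernel is bounded.

    Gamma is present only through the recurrence of [c] and one value. The functional equation is
    not stated for a continued zeta: one integral is evaluated for Re s > 1, where it gives the row
    m = 0, and for Re s < 0, where it is [c] times the sum of r^(s-1). The second form holds near
    -2k and produces zeta(2k+1). At -2k the factor e^(i pi s) is 1 while 1 + e^(i pi s) is 2: hence
    the coefficients 1 of zeta and 2 of the Lambert series.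

    Unordered summability for Re s > 2 rests on a product majorant in which each index carries the
    exponent -Re s / 2. *)

Notation Cder := (@is_derive C_AbsRing C_NormedModule).
Notation Cexd := (@ex_derive C_AbsRing C_NormedModule).
Notation CInt := (@RInt C_R_CompleteNormedModule).
Notation ex_CInt := (@ex_RInt C_R_NormedModule).

Definition Ccont (f : C -> C) (z : C) : Prop :=
  forall eps : R, 0 < eps -> exists delta : R, 0 < delta /\
    forall w : C, Cmod (w - z) < delta -> Cmod (f w - f z) < eps.

Definition Climit (u : nat -> C) (l : C) : Prop :=
  forall eps : R, 0 < eps -> exists N : nat, forall n : nat, (N <= n)%nat ->
    Cmod (u n - l) < eps.

Lemma pair_sub (a b c d : R) : ((a, b) - (c, d))%C = (a - c, b - d).
Proof. reflexivity. Qed.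

Lemma Cmod_sub_sym (a b : C) : Cmod (a - b) = Cmod (b - a).
Proof. rewrite <- Cmod_opp. f_equal. ring. Qed.

Lemma Cmod_sub_le (a b : C) : Cmod (a - b) <= Cmod a + Cmod b.
Proof. rewrite <- (Cmod_opp b). apply Cmod_triangle. Qed.

Lemma Cmod_tri3 (a b c : C) : Cmod (a - c) <= Cmod (a - b) + Cmod (b - c).
Proof. replace (a - c)%C with ((a - b) + (b - c))%C by ring. apply Cmod_triangle. Qed.

Lemma Cmod_rev_tri (a b : C) : Cmod a - Cmod b <= Cmod (a - b).
Proof.
  assert (Cmod a <= Cmod (a - b) + Cmod b).
  { replace a with ((a - b) + b)%C at 1 by ring. apply Cmod_triangle. }
  lra.
Qed.

Lemma im_le_Cmod (c : C) : Rabs (Im c) <= Cmod c.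
Proof. eapply Rle_trans; [|apply Rmax_Cmod]. apply Rmax_r. Qed.

Lemma Cmod_le_abs (x y : R) : Cmod (x, y) <= Rabs x + Rabs y.
Proof.
  replace (x, y) with (RtoC x + Ci * RtoC y)%C
    by (unfold RtoC, Ci, Cmult, Cplus; simpl; f_equal; ring).
  eapply Rle_trans; [apply Cmod_triangle|].
  rewrite Cmod_mult, Cmod_Ci, !Cmod_R. lra.
Qed.

Lemma Cmod_le_imp_zero (z : C) : (forall eps, 0 < eps -> Cmod z <= eps) -> z = 0%C.
Proof.
  intros H. apply Cmod_eq_0. apply Rle_antisym; [|apply Cmod_ge_0].
  apply Rnot_lt_le. intros K. specialize (H (Cmod z / 2)). lra.
Qed.

Lemma Cmod_lt_imp_eq (a b : C) : (forall eps, 0 < eps -> Cmod (a - b) < eps) -> a = b.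
Proof.
  intros H. apply Ceq_minus, Cmod_le_imp_zero. intros e He. apply Rlt_le, H, He.
Qed.

Lemma Climit_unique u l1 l2 : Climit u l1 -> Climit u l2 -> l1 = l2.
Proof.
  intros H1 H2. apply Cmod_lt_imp_eq. intros e He.
  destruct (H1 (e/2)) as [N1 K1]; [lra|]. destruct (H2 (e/2)) as [N2 K2]; [lra|].
  specialize (K1 (max N1 N2) ltac:(lia)). specialize (K2 (max N1 N2) ltac:(lia)).
  rewrite Cmod_sub_sym in K1. pose proof (Cmod_tri3 l1 (u (max N1 N2)) l2). lra.
Qed.

Lemma Climit_ext u v l : (forall n, u n = v n) -> Climit u l -> Climit v l.
Proof.
  intros E H e He. destruct (H e He) as [N K]. exists N. intros n Hn.
  rewrite <- E. auto.
Qed.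

Lemma Climit_const c : Climit (fun _ => c) c.
Proof.
  intros e He. exists O. intros. replace (c - c)%C with (RtoC 0) by ring.
  rewrite Cmod_0. exact He.
Qed.

Lemma Climit_plus u v a b :
  Climit u a -> Climit v b -> Climit (fun n => u n + v n)%C (a + b)%C.
Proof.
  intros H1 H2 e He.
  destruct (H1 (e/2)) as [N1 K1]; [lra|]. destruct (H2 (e/2)) as [N2 K2]; [lra|].
  exists (max N1 N2). intros n Hn.
  specialize (K1 n ltac:(lia)). specialize (K2 n ltac:(lia)).
  replace (u n + v n - (a + b))%C with ((u n - a) + (v n - b))%C by ring.
  pose proof (Cmod_triangle (u n - a) (v n - b)). lra.
Qed.

Lemma Climit_scal c u a : Climit u a -> Climit (fun n => c * u n)%C (c * a)%C.
Proof.
  intros H e He. pose proof (Cmod_ge_0 c) as Hc.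
  destruct (H (e / (Cmod c + 1))) as [N K]. { apply Rdiv_lt_0_compat; lra. }
  exists N. intros n Hn. specialize (K n Hn).
  replace (c * u n - c * a)%C with (c * (u n - a))%C by ring.
  rewrite Cmod_mult. pose proof (Cmod_ge_0 (u n - a)).
  apply Rle_lt_trans with ((Cmod c + 1) * Cmod (u n - a)); [nra|].
  apply Rmult_lt_compat_l with (r := Cmod c + 1) in K; [|lra].
  replace ((Cmod c + 1) * (e / (Cmod c + 1))) with e in K by (field; lra). exact K.
Qed.

Lemma Climit_minus u v a b :
  Climit u a -> Climit v b -> Climit (fun n => u n - v n)%C (a - b)%C.
Proof.
  intros H1 H2. pose proof (Climit_plus _ _ _ _ H1 (Climit_scal (-(1))%C _ _ H2)) as H.
  replace (a - b)%C with (a + -(1) * b)%C by ring.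
  eapply Climit_ext; [|exact H]. intros n; simpl. ring.
Qed.

Lemma Climit_subseq u l (hankel_cofactor : nat -> nat) :
  (forall n, (n <= hankel_cofactor n)%nat) -> Climit u l -> Climit (fun n => u (hankel_cofactor n)) l.
Proof.
  intros Hp H e He. destruct (H e He) as [N K]. exists N. intros n Hn.
  apply K. specialize (Hp n). lia.
Qed.

Lemma Climit_shift (u : nat -> C) l (k : nat) : Climit (fun n => u (n + k)%nat) l -> Climit u l.
Proof.
  intros H e He. destruct (H e He) as [N HN]. exists (N + k)%nat. intros n Hn.
  replace n with (n - k + k)%nat by lia. apply HN. lia.
Qed.

Lemma Climit_le u l M : (forall n, Cmod (u n) <= M) -> Climit u l -> Cmod l <= M.
Proof.
  intros B H. apply Rnot_lt_le. intros K.
  destruct (H (Cmod l - M)) as [N HN]; [lra|]. specialize (HN N ltac:(lia)).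
  rewrite Cmod_sub_sym in HN. pose proof (Cmod_rev_tri l (u N)). specialize (B N). lra.
Qed.

Lemma Climit_squeeze (u v : nat -> C) l (b : nat -> R) :
  (forall n, Cmod (u n - v n) <= b n) -> is_lim_seq b 0 -> Climit v l -> Climit u l.
Proof.
  intros B Hb H e He. apply is_lim_seq_spec in Hb. destruct (Hb (mkposreal (e/2) ltac:(lra))) as [N1 K1].
  destruct (H (e/2)) as [N2 K2]; [lra|]. exists (max N1 N2). intros n Hn.
  specialize (K1 n ltac:(lia)). specialize (K2 n ltac:(lia)). simpl in K1.
  rewrite Rminus_0_r in K1. pose proof (Rle_abs (b n)).
  pose proof (Cmod_tri3 (u n) (v n) l). specialize (B n). lra.
Qed.

Lemma Climit_zero (u : nat -> C) (b : nat -> R) :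
  (forall n, Cmod (u n) <= b n) -> is_lim_seq b 0 -> Climit u 0%C.
Proof.
  intros B Hb. apply (Climit_squeeze u (fun _ => RtoC 0) 0%C b); auto using Climit_const.
  intros n. replace (u n - 0)%C with (u n) by ring. apply B.
Qed.

Lemma is_lim_seq_scal_0 (c : R) (u : nat -> R) :
  is_lim_seq u 0 -> is_lim_seq (fun n => c * u n) 0.
Proof.
  intros H. replace (Finite 0) with (Rbar_mult c 0) by (simpl; f_equal; ring).
  apply is_lim_seq_scal_l, H.
Qed.

Lemma Climit_cauchy (u : nat -> C) :
  (forall eps, 0 < eps -> exists N, forall n m, (N <= n)%nat -> (N <= m)%nat ->
     Cmod (u n - u m) < eps) -> exists l, Climit u l.
Proof.
  intros H.
  assert (A : exists a, is_lim_seq (fun n => Re (u n)) (Finite a)).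
  { apply ex_lim_seq_cauchy_corr. intros e. destruct (H e (cond_pos e)) as [N K].
    exists N. intros n m Hn Hm. eapply Rle_lt_trans; [|apply (K n m Hn Hm)].
    replace (Re (u n) - Re (u m)) with (Re (u n - u m)%C) by reflexivity. apply re_le_Cmod. }
  assert (B : exists a, is_lim_seq (fun n => Im (u n)) (Finite a)).
  { apply ex_lim_seq_cauchy_corr. intros e. destruct (H e (cond_pos e)) as [N K].
    exists N. intros n m Hn Hm. eapply Rle_lt_trans; [|apply (K n m Hn Hm)].
    replace (Im (u n) - Im (u m)) with (Im (u n - u m)%C) by reflexivity. apply im_le_Cmod. }
  destruct A as [a Ha]. destruct B as [b Hb]. exists (a, b). intros e He.
  apply is_lim_seq_spec in Ha. apply is_lim_seq_spec in Hb.
  destruct (Ha (mkposreal (e/2) ltac:(lra))) as [N1 K1].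
  destruct (Hb (mkposreal (e/2) ltac:(lra))) as [N2 K2].
  exists (max N1 N2). intros n Hn. specialize (K1 n ltac:(lia)). specialize (K2 n ltac:(lia)).
  simpl in K1, K2. destruct (u n) as [x y]. simpl in *.
  rewrite pair_sub. eapply Rle_lt_trans; [apply Cmod_le_abs|]. lra.
Qed.

Lemma Cder_eps (f : C -> C) (z d : C) :
  Cder f z d <->
  (forall eps, 0 < eps -> exists delta, 0 < delta /\ forall w, Cmod (w - z) < delta ->
     Cmod (f w - f z - d * (w - z)) <= eps * Cmod (w - z)).
Proof.
  split.
  - intros [_ H] e He. specialize (H z (fun P K => K) (mkposreal e He)).
    destruct H as [de K]. exists de. split; [apply cond_pos|]. intros w Hw.
    specialize (K w Hw).
    replace (f w - f z - d * (w - z))%C with (f w - f z - (w - z) * d)%C by ring. exact K.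
  - intros H. split. apply is_linear_scal_l.
    intros y Hy.
    apply (is_filter_lim_locally_unique (K := C_AbsRing) (V := AbsRing_NormedModule C_AbsRing)) in Hy.
    subst y. intros e. destruct (H e (cond_pos e)) as [de [Hd K]].
    exists (mkposreal de Hd). intros w Hw. specialize (K w Hw).
    replace (f w - f z - d * (w - z))%C with (f w - f z - (w - z) * d)%C in K by ring. exact K.
Qed.

Lemma Cexd_cont (f : C -> C) (z : C) : Cexd f z -> Ccont f z.
Proof.
  intros [d H] e He. apply Cder_eps with (eps := 1) in H; [|lra].
  destruct H as [de [Hd K]]. pose proof (Cmod_ge_0 d) as P.
  assert (Q : 0 < e / (Cmod d + 1)) by (apply Rdiv_lt_0_compat; lra).
  exists (Rmin de (e / (Cmod d + 1))). split; [apply Rmin_pos; auto|].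
  intros w Hw. pose proof (Rmin_l de (e / (Cmod d + 1))). pose proof (Rmin_r de (e / (Cmod d + 1))).
  specialize (K w ltac:(lra)).
  replace (f w - f z)%C with ((f w - f z - d * (w - z)) + d * (w - z))%C by ring.
  eapply Rle_lt_trans; [apply Cmod_triangle|]. rewrite Cmod_mult.
  assert (L : Cmod (w - z) < e / (Cmod d + 1)) by lra.
  apply Rmult_lt_compat_l with (r := Cmod d + 1) in L; [|lra].
  replace ((Cmod d + 1) * (e / (Cmod d + 1))) with e in L by (field; lra). lra.
Qed.

Lemma Cexd_ext_loc (f g : C -> C) (z : C) (r : R) : 0 < r ->
  (forall w, Cmod (w - z) < r -> f w = g w) -> Cexd f z -> Cexd g z.
Proof.
  intros Hr E [d H]. exists d. apply Cder_eps. intros e He.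
  apply Cder_eps with (eps := e) in H; auto. destruct H as [de [Hd K]].
  exists (Rmin de r). split; [apply Rmin_pos; auto|]. intros w Hw.
  pose proof (Rmin_l de r). pose proof (Rmin_r de r).
  rewrite <- !E; try lra. apply K; lra.
  replace (z - z)%C with (RtoC 0) by ring. rewrite Cmod_0. lra.
Qed.

(* [C_NormedModule] and [AbsRing_NormedModule C_AbsRing] have the same norm but
   different uniform structures, so Coquelicot's product and chain rules, stated
   for the latter, do not apply to the former directly. *)
Lemma Cder_AbsRing (f : C -> C) (z d : C) :
  Cder f z d <-> @is_derive C_AbsRing (AbsRing_NormedModule C_AbsRing) f z d.
Proof.
  split; intros [_ H]; (split; [apply is_linear_scal_l|exact H]).
Qed.

Lemma Cder_const (c z : C) : Cder (fun _ => c) z (RtoC 0).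
Proof. apply (is_derive_const (K := C_AbsRing) (V := C_NormedModule)). Qed.

Lemma Cder_id (z : C) : Cder (fun w => w) z (RtoC 1).
Proof. apply Cder_AbsRing, (is_derive_id (K := C_AbsRing)). Qed.

Lemma Cder_plus (f g : C -> C) (z a b : C) : Cder f z a -> Cder g z b -> Cder (fun w => f w + g w)%C z (a + b)%C.
Proof. apply (is_derive_plus (K := C_AbsRing) (V := C_NormedModule)). Qed.

Lemma Cder_opp (f : C -> C) (z a : C) : Cder f z a -> Cder (fun w => - f w)%C z (- a)%C.
Proof. apply (is_derive_opp (K := C_AbsRing) (V := C_NormedModule)). Qed.

Lemma Cder_minus (f g : C -> C) (z a b : C) : Cder f z a -> Cder g z b -> Cder (fun w => f w - g w)%C z (a - b)%C.
Proof. apply (is_derive_minus (K := C_AbsRing) (V := C_NormedModule)). Qed.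

Lemma Cder_mult (f g : C -> C) (z a b : C) : Cder f z a -> Cder g z b ->
  Cder (fun w => f w * g w)%C z (a * g z + f z * b)%C.
Proof.
  intros Hf Hg. apply Cder_AbsRing in Hf, Hg.
  apply Cder_AbsRing, (is_derive_mult (K := C_AbsRing) f g z a b Hf Hg Cmult_comm).
Qed.

Lemma Cder_comp (f g : C -> C) (z a b : C) : Cder f (g z) a -> Cder g z b -> Cder (fun w => f (g w)) z (b * a)%C.
Proof.
  intros Hf Hg. apply Cder_AbsRing in Hg.
  apply (is_derive_comp (K := C_AbsRing) (V := C_NormedModule) f g z a b Hf Hg).
Qed.

(** The remainder is exactly (w - z)^2 / (w z^2), and staying within |z| / 2 of [z] keeps |w| above
    |z| / 2. *)
Lemma Cder_inv (z : C) : z <> 0%C -> Cder (fun w => / w)%C z (- / (z * z))%C.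
Proof.
  intros Hz. apply Cder_eps. intros e He. pose proof (proj1 (Cmod_gt_0 z) Hz) as P.
  set (m := Cmod z) in *.
  assert (Q : 0 < e * (m * m * m) / 2) by (assert (0 < m * m * m) by (repeat apply Rmult_lt_0_compat; lra); nra).
  exists (Rmin (m / 2) (e * (m * m * m) / 2)). split; [apply Rmin_pos; lra|].
  intros w Hw. pose proof (Rmin_l (m / 2) (e * (m * m * m) / 2)).
  pose proof (Rmin_r (m / 2) (e * (m * m * m) / 2)).
  assert (Hm : m / 2 < Cmod w).
  { pose proof (Cmod_rev_tri z w). rewrite Cmod_sub_sym in Hw. fold m in H1. lra. }
  assert (Hw0 : w <> 0%C) by (apply Cmod_gt_0; lra).
  replace (/ w - / z - - / (z * z) * (w - z))%C with ((w - z) * (w - z) / (w * (z * z)))%C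
    by (field; auto).
  rewrite Cmod_div by (repeat apply Cmult_neq_0; auto).
  rewrite !Cmod_mult. fold m. set (t := Cmod (w - z)) in *.
  assert (0 <= t) by apply Cmod_ge_0.
  apply Rmult_le_reg_r with (Cmod w * (m * m)). { apply Rmult_lt_0_compat; nra. }
  replace (t * t / (Cmod w * (m * m)) * (Cmod w * (m * m))) with (t * t) by (field; split; lra).
  assert (e * (m * m * m) / 2 <= e * (Cmod w * (m * m))).
  { assert (m * (m * m) / 2 <= Cmod w * (m * m)) by (assert (0 < m * m) by nra; nra). nra. }
  nra.
Qed.

Lemma Cexd_const (c z : C) : Cexd (fun _ => c) z.
Proof. eexists; apply Cder_const. Qed.

Lemma Cexd_id (z : C) : Cexd (fun w => w) z.
Proof. eexists; apply Cder_id. Qed.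

Lemma Cexd_plus (f g : C -> C) (z : C) : Cexd f z -> Cexd g z -> Cexd (fun w => f w + g w)%C z.
Proof. intros [a A] [b B]; eexists; apply Cder_plus; eauto. Qed.

Lemma Cexd_opp (f : C -> C) (z : C) : Cexd f z -> Cexd (fun w => - f w)%C z.
Proof. intros [a A]; eexists; apply Cder_opp; eauto. Qed.

Lemma Cexd_minus (f g : C -> C) (z : C) : Cexd f z -> Cexd g z -> Cexd (fun w => f w - g w)%C z.
Proof. intros [a A] [b B]; eexists; apply Cder_minus; eauto. Qed.

Lemma Cexd_mult (f g : C -> C) (z : C) : Cexd f z -> Cexd g z -> Cexd (fun w => f w * g w)%C z.
Proof. intros [a A] [b B]; eexists; apply Cder_mult; eauto. Qed.

Lemma Cexd_comp (f g : C -> C) (z : C) : Cexd f (g z) -> Cexd g z -> Cexd (fun w => f (g w)) z.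
Proof. intros [a A] [b B]; eexists; eapply Cder_comp; eauto. Qed.

Lemma Cexd_inv (f : C -> C) (z : C) : f z <> 0%C -> Cexd f z -> Cexd (fun w => / f w)%C z.
Proof. intros Hz Hf. apply (Cexd_comp Cinv f); auto. eexists; apply Cder_inv; auto. Qed.

Lemma Cexd_div (f g : C -> C) (z : C) : g z <> 0%C -> Cexd f z -> Cexd g z -> Cexd (fun w => f w / g w)%C z.
Proof. intros Hz Hf Hg. apply Cexd_mult; auto. apply Cexd_inv; auto. Qed.

Lemma Cexd_pow (f : C -> C) (n : nat) (z : C) : Cexd f z -> Cexd (fun w => Cpow (f w) n) z.
Proof.
  intros H. induction n; simpl. apply Cexd_const. apply Cexd_mult; auto.
Qed.

(** Integral estimates over the real module [C_R_NormedModule] speak of its product norm; this turns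
    them into estimates of [Cmod]. *)
Lemma norm_C_R (z : C) : @norm R_AbsRing C_R_NormedModule z = Cmod z.
Proof.
  destruct z as [x y]. unfold norm; simpl. unfold prod_norm, norm; simpl. unfold abs; simpl.
  unfold Cmod; simpl. f_equal. rewrite !Rmult_1_r, <- !Rabs_mult.
  rewrite !Rabs_pos_eq; nra.
Qed.

(** [Ccont] is measured by [Cmod], integrability asks for the product uniform structure; a Lipschitz
    parametrisation carries one to the other. *)
Lemma path_continuous (f : C -> C) (p : R -> C) (t : R) (k : R) :
  (forall u, Cmod (p u - p t) <= k * Rabs (u - t)) -> Ccont f (p t) ->
  @continuous R_UniformSpace C_R_NormedModule (fun u => f (p u)) t.
Proof.
  intros Hp Hf. apply filterlim_locally. intros e.
  destruct (Hf e (cond_pos e)) as [de [Hd K]].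
  assert (P : 0 < de / (Rabs k + 1)) by (apply Rdiv_lt_0_compat; pose proof (Rabs_pos k); lra).
  exists (mkposreal _ P). intros u Hu. simpl in Hu.
  assert (L : Cmod (f (p u) - f (p t)) < e).
  { apply K. eapply Rle_lt_trans; [apply Hp|].
    unfold ball in Hu; simpl in Hu. unfold AbsRing_ball, abs, minus, plus, opp in Hu; simpl in Hu.
    fold (Rminus u t) in Hu. pose proof (Rle_abs k). pose proof (Rabs_pos k). pose proof (Rabs_pos (u - t)).
    apply Rmult_lt_compat_l with (r := Rabs k + 1) in Hu; [|lra].
    replace ((Rabs k + 1) * (de / (Rabs k + 1))) with de in Hu by (field; lra). nra. }
  pose proof (Rmax_Cmod (f (p u) - f (p t))%C) as M.
  split; simpl.
  - unfold ball; simpl; unfold AbsRing_ball, abs, minus, plus, opp; simpl.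
    eapply Rle_lt_trans; [|exact L]. eapply Rle_trans; [|exact M]. apply Rmax_l.
  - unfold ball; simpl; unfold AbsRing_ball, abs, minus, plus, opp; simpl.
    eapply Rle_lt_trans; [|exact L]. eapply Rle_trans; [|exact M]. apply Rmax_r.
Qed.

Lemma Cmod_Re_only x : Cmod (x, 0) = Rabs x.
Proof. apply (Cmod_R x). Qed.

Lemma Cmod_Im_only y : Cmod (0, y) = Rabs y.
Proof.
  replace (0, y) with (Ci * RtoC y)%C by (unfold Ci, RtoC, Cmult; simpl; f_equal; ring).
  rewrite Cmod_mult, Cmod_Ci, Cmod_R. ring.
Qed.

Lemma horiz_continuous f x y : Ccont f (x, y) ->
  @continuous R_UniformSpace C_R_NormedModule (fun t => f (t, y)) x.
Proof.
  intros H. apply (path_continuous f (fun t => (t, y)) x 1); auto.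
  intros u. rewrite pair_sub, Rminus_diag, Cmod_Re_only. lra.
Qed.

Lemma vert_continuous f x y : Ccont f (x, y) ->
  @continuous R_UniformSpace C_R_NormedModule (fun t => f (x, t)) y.
Proof.
  intros H. apply (path_continuous f (fun t => (x, t)) y 1); auto.
  intros u. rewrite pair_sub, Rminus_diag, Cmod_Im_only. lra.
Qed.

Lemma is_CInt_scal (f : R -> C) (a b : R) (c l : C) :
  @is_RInt C_R_NormedModule f a b l ->
  @is_RInt C_R_NormedModule (fun t => c * f t)%C a b (c * l)%C.
Proof.
  intros H. destruct c as [p q]. destruct l as [u v].
  pose proof (is_RInt_fct_extend_fst (U:=R_NormedModule) (V:=R_NormedModule) _ _ _ _ H) as H1.
  pose proof (is_RInt_fct_extend_snd (U:=R_NormedModule) (V:=R_NormedModule) _ _ _ _ H) as H2.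
  simpl in H1, H2.
  apply (is_RInt_fct_extend_pair (U:=R_NormedModule) (V:=R_NormedModule)); simpl.
  - apply (is_RInt_minus (V:=R_NormedModule)); apply (is_RInt_scal (V:=R_NormedModule)); assumption.
  - apply (is_RInt_plus (V:=R_NormedModule)); apply (is_RInt_scal (V:=R_NormedModule)); assumption.
Qed.

Lemma CInt_correct (f : R -> C) (a b : R) : ex_CInt f a b -> @is_RInt C_R_NormedModule f a b (CInt f a b).
Proof. apply (@RInt_correct C_R_CompleteNormedModule). Qed.

Lemma CInt_unique (f : R -> C) (a b : R) (l : C) : @is_RInt C_R_NormedModule f a b l -> CInt f a b = l.
Proof. apply (@is_RInt_unique C_R_CompleteNormedModule). Qed.

Lemma CInt_scal (c : C) (f : R -> C) (a b : R) : ex_CInt f a b -> CInt (fun t => c * f t)%C a b = (c * CInt f a b)%C.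
Proof. intros H. apply CInt_unique, is_CInt_scal, CInt_correct, H. Qed.

Lemma CInt_minus (f g : R -> C) (a b : R) : ex_CInt f a b -> ex_CInt g a b ->
  CInt (fun t => f t - g t)%C a b = (CInt f a b - CInt g a b)%C.
Proof.
  intros H1 H2. apply CInt_unique.
  apply (is_RInt_minus (V := C_R_NormedModule)); apply CInt_correct; assumption.
Qed.

Lemma CInt_const (c : C) (a b : R) : CInt (fun _ => c) a b = (RtoC (b - a) * c)%C.
Proof.
  apply CInt_unique. rewrite <- scal_R_Cmult. apply (is_RInt_const (V := C_R_NormedModule)).
Qed.

Lemma CInt_Chasles (f : R -> C) (a b c : R) : ex_CInt f a b -> ex_CInt f b c ->
  (CInt f a b + CInt f b c)%C = CInt f a c.
Proof. apply (@RInt_Chasles C_R_CompleteNormedModule). Qed.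

Lemma CInt_ext (f g : R -> C) (a b : R) : a <= b -> (forall t, a <= t <= b -> f t = g t) -> CInt f a b = CInt g a b.
Proof.
  intros Hab H. apply (@RInt_ext C_R_CompleteNormedModule). intros t.
  rewrite Rmin_left, Rmax_right by lra. intros; apply H; lra.
Qed.

Lemma CInt_bound (f : R -> C) (a b M : R) : a <= b -> ex_CInt f a b ->
  (forall t, a <= t <= b -> Cmod (f t) <= M) -> Cmod (CInt f a b) <= (b - a) * M.
Proof.
  intros Hab Hf H. rewrite <- norm_C_R.
  apply (norm_RInt_le_const (V := C_R_NormedModule) f); auto using CInt_correct.
  intros t Ht. rewrite norm_C_R. auto.
Qed.

(** The majorant e^t is integrated exactly, so the bound stays uniform as [a] tends to minus
    infinity, as the infinite legs of the path require. *)
Lemma CInt_bound_exp (f : R -> C) (a b M : R) : a <= b -> ex_CInt f a b ->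
  (forall t, a <= t <= b -> Cmod (f t) <= M * exp t) ->
  Cmod (CInt f a b) <= M * (exp b - exp a).
Proof.
  intros Hab Hf H. rewrite <- norm_C_R.
  apply (norm_RInt_le (V := C_R_NormedModule) f (fun t => M * exp t) a b); auto using CInt_correct.
  - intros t Ht. rewrite norm_C_R. auto.
  - replace (M * (exp b - exp a)) with (minus (M * exp b) (M * exp a))
      by (unfold minus, plus, opp; simpl; ring).
    apply (is_RInt_derive (V := R_CompleteNormedModule) (fun t => M * exp t)).
    + intros x _. auto_derive; auto. ring.
    + intros x _. apply (ex_derive_continuous (V := R_NormedModule)). auto_derive; auto.
Qed.

(** * Exponential, logarithm and powers *)

Lemma exp_le (x y : R) : x <= y -> exp x <= exp y.
Proof.
  intros [L|L]. apply Rlt_le, exp_increasing, L. rewrite L; lra.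
Qed.

Lemma Cexp_plus (a b : C) : Cexp (a + b) = (Cexp a * Cexp b)%C.
Proof.
  destruct a as [x y], b as [u v]. unfold Cexp, Cplus, Cmult; simpl.
  rewrite exp_plus, cos_plus, sin_plus. f_equal; ring.
Qed.

Lemma Cexp_0 : Cexp 0 = 1%C.
Proof. unfold Cexp; simpl. rewrite exp_0, cos_0, sin_0. unfold RtoC; f_equal; ring. Qed.

Lemma Cmod_Cexp (z : C) : Cmod (Cexp z) = exp (Re z).
Proof.
  unfold Cexp, Cmod; simpl. pose proof (sin2_cos2 (Im z)) as H. unfold Rsqr in H.
  replace (_ + _) with (exp (Re z) * exp (Re z)).
  - rewrite sqrt_square; auto. apply Rlt_le, exp_pos.
  - transitivity (exp (Re z) * exp (Re z) * (sin (Im z) * sin (Im z) + cos (Im z) * cos (Im z))).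
    + rewrite H; ring.
    + ring.
Qed.

Lemma Cexp_nz (z : C) : Cexp z <> 0%C.
Proof. apply Cmod_gt_0. rewrite Cmod_Cexp. apply exp_pos. Qed.

Lemma Cexp_opp (z : C) : Cexp (- z) = (/ Cexp z)%C.
Proof.
  assert (H : (Cexp (- z) * Cexp z)%C = 1%C).
  { rewrite <- Cexp_plus. replace (- z + z)%C with (RtoC 0) by ring. apply Cexp_0. }
  replace (/ Cexp z)%C with (Cexp (- z) * Cexp z * / Cexp z)%C by (rewrite H; ring).
  field. apply Cexp_nz.
Qed.

Lemma Cexp_pow (z : C) (n : nat) : Cpow (Cexp z) n = Cexp (RtoC (INR n) * z).
Proof.
  induction n.
  - simpl. replace (0 * z)%C with (RtoC 0) by ring. rewrite Cexp_0. reflexivity.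
  - rewrite Cpow_S, IHn, S_INR, RtoC_plus, <- Cexp_plus. f_equal. ring.
Qed.

(** The source of the first and second order bounds on e^z - 1: estimating this integral replaces
    the power series. *)
Lemma Cexp_line_int (z : C) :
  @is_RInt C_R_NormedModule (fun t => z * Cexp (RtoC t * z))%C 0 1 (Cexp z - 1)%C.
Proof.
  destruct z as [x y].
  replace (Cexp (x, y) - 1)%C with
    (minus (exp (1*x) * cos (1*y)) (exp (0*x) * cos (0*y)),
     minus (exp (1*x) * sin (1*y)) (exp (0*x) * sin (0*y))).
  2:{ unfold Cexp, Cminus, Cplus, Copp, RtoC, minus, plus, opp; simpl.
      rewrite !Rmult_0_l, !Rmult_1_l, exp_0, cos_0, sin_0. f_equal; ring. }
  apply (is_RInt_fct_extend_pair (U:=R_NormedModule) (V:=R_NormedModule)).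
  - apply is_RInt_ext with (fun t => x * (exp (t*x) * cos (t*y)) - y * (exp (t*x) * sin (t*y))).
    { intros t _. unfold Cexp, Cmult, RtoC; simpl. rewrite !Rmult_0_l, Rminus_0_r, Rplus_0_r. reflexivity. }
    apply (is_RInt_derive (V := R_CompleteNormedModule) (fun t => exp (t*x) * cos (t*y))).
    + intros t _. auto_derive; auto. ring.
    + intros t _. apply (ex_derive_continuous (V := R_NormedModule)). auto_derive; auto.
  - apply is_RInt_ext with (fun t => x * (exp (t*x) * sin (t*y)) + y * (exp (t*x) * cos (t*y))).
    { intros t _. unfold Cexp, Cmult, RtoC; simpl. rewrite !Rmult_0_l, Rminus_0_r, Rplus_0_r. reflexivity. }
    apply (is_RInt_derive (V := R_CompleteNormedModule) (fun t => exp (t*x) * sin (t*y))).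
    + intros t _. auto_derive; auto. ring.
    + intros t _. apply (ex_derive_continuous (V := R_NormedModule)). auto_derive; auto.
Qed.

Lemma Cexp_sub1_bound (z : C) : Cmod (Cexp z - 1) <= Cmod z * exp (Cmod z).
Proof.
  pose proof (Cexp_line_int z) as H. rewrite <- (norm_C_R (Cexp z - 1)).
  replace (Cmod z * exp (Cmod z)) with ((1 - 0) * (Cmod z * exp (Cmod z))) by ring.
  eapply (norm_RInt_le_const (V := C_R_NormedModule)); [lra| |exact H].
  intros t Ht. rewrite norm_C_R, Cmod_mult, Cmod_Cexp, re_scal_l.
  apply Rmult_le_compat_l; [apply Cmod_ge_0|]. apply exp_le.
  pose proof (re_le_Cmod z). pose proof (Rle_abs (Re z)). pose proof (Cmod_ge_0 z).
  apply Rle_trans with (t * Cmod z); nra.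
Qed.

Lemma Cexp_sub2_bound (z : C) : Cmod (Cexp z - 1 - z) <= Cmod z * Cmod z * exp (Cmod z).
Proof.
  pose proof (Cexp_line_int z) as H.
  assert (H2 : @is_RInt C_R_NormedModule (fun t => z * Cexp (RtoC t * z) - z)%C 0 1
                 (Cexp z - 1 - z)%C).
  { replace (Cexp z - 1 - z)%C with (Cexp z - 1 - RtoC (1 - 0) * z)%C
      by (rewrite Rminus_0_r; ring).
    rewrite <- scal_R_Cmult.
    exact (is_RInt_minus (V := C_R_NormedModule) _ _ 0 1 _ _ H
             (is_RInt_const (V := C_R_NormedModule) 0 1 z)). }
  rewrite <- (norm_C_R (Cexp z - 1 - z)).
  replace (Cmod z * Cmod z * exp (Cmod z)) with ((1 - 0) * (Cmod z * Cmod z * exp (Cmod z))) by ring.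
  eapply (norm_RInt_le_const (V := C_R_NormedModule)); [lra| |exact H2].
  intros t Ht. rewrite norm_C_R.
  replace (z * Cexp (t * z) - z)%C with (z * (Cexp (t * z) - 1))%C by ring.
  rewrite Cmod_mult, Rmult_assoc. apply Rmult_le_compat_l; [apply Cmod_ge_0|].
  eapply Rle_trans; [apply Cexp_sub1_bound|]. rewrite Cmod_mult, Cmod_R, Rabs_pos_eq by lra.
  pose proof (Cmod_ge_0 z).
  apply Rmult_le_compat; try nra. apply Rlt_le, exp_pos. apply exp_le; nra.
Qed.

(** For |v| <= 1/6 the second order remainder is at most e |v|^2 <= 3 |v|^2 <= |v| / 2, so half of
    |v| survives. *)
Lemma Cexp_sub1_lower (v : C) : Cmod v <= 1/6 -> Cmod v / 2 <= Cmod (Cexp v - 1).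
Proof.
  intros H. pose proof (Cexp_sub2_bound v) as B. pose proof (Cmod_ge_0 v) as T.
  pose proof (Cmod_rev_tri v (- (Cexp v - 1 - v))) as Y.
  replace (v - - (Cexp v - 1 - v))%C with (Cexp v - 1)%C in Y by ring. rewrite Cmod_opp in Y.
  assert (X : exp (Cmod v) <= 3). { apply Rle_trans with (exp 1). apply exp_le; lra. apply exp_le_3. }
  set (t := Cmod v) in *. nra.
Qed.

Lemma Cder_Cexp (z : C) : Cder Cexp z (Cexp z).
Proof.
  apply Cder_eps. intros e He. pose proof (exp_pos (Re z)) as P. pose proof (exp_pos 1) as P1.
  assert (Q : 0 < e / (exp (Re z) * exp 1)) by (apply Rdiv_lt_0_compat; nra).
  exists (Rmin 1 (e / (exp (Re z) * exp 1))). split; [apply Rmin_pos; lra|]. intros w Hw.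
  pose proof (Rmin_l 1 (e / (exp (Re z) * exp 1))) as L1.
  pose proof (Rmin_r 1 (e / (exp (Re z) * exp 1))) as L2.
  replace (Cexp w) with (Cexp z * Cexp (w - z))%C by (rewrite <- Cexp_plus; f_equal; ring).
  replace (Cexp z * Cexp (w - z) - Cexp z - Cexp z * (w - z))%C with
    (Cexp z * (Cexp (w - z) - 1 - (w - z)))%C by ring.
  rewrite Cmod_mult, Cmod_Cexp. pose proof (Cexp_sub2_bound (w - z)) as B.
  set (t := Cmod (w - z)) in *. assert (0 <= t) by apply Cmod_ge_0.
  assert (exp t <= exp 1) by (apply exp_le; lra).
  assert (t * (exp (Re z) * exp 1) <= e).
  { apply Rle_trans with (e / (exp (Re z) * exp 1) * (exp (Re z) * exp 1)).
    apply Rmult_le_compat_r; nra. right; field; split; lra. }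
  apply Rle_trans with (exp (Re z) * (t * t * exp 1)).
  - apply Rmult_le_compat_l; [lra|]. eapply Rle_trans; [exact B|]. apply Rmult_le_compat_l; nra.
  - replace (exp (Re z) * (t * t * exp 1)) with (t * (exp (Re z) * exp 1) * t) by ring.
    apply Rmult_le_compat_r; auto.
Qed.

Lemma Cexd_Cexp (f : C -> C) (z : C) : Cexd f z -> Cexd (fun w => Cexp (f w)) z.
Proof. intros H. apply (Cexd_comp Cexp f); auto. eexists; apply Cder_Cexp. Qed.

Lemma horiz_derive (f : C -> C) (x y : R) (d : C) : Cder f (x, y) d ->
  @is_derive R_AbsRing C_R_NormedModule (fun t => f (t, y)) x d.
Proof.
  intros H. split. apply (is_linear_scal_l (K := R_AbsRing) (V := C_R_NormedModule)).
  intros u Hu. apply (is_filter_lim_locally_unique (K := R_AbsRing) (V := R_NormedModule)) in Hu.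
  subst u. intros e. apply Cder_eps with (eps := e) in H; [|apply cond_pos].
  destruct H as [de [Hd K]]. exists (mkposreal de Hd). intros t Ht.
  rewrite norm_C_R. specialize (K (t, y)).
  replace ((t, y) - (x, y))%C with (RtoC (t - x)) in K
    by (rewrite pair_sub, Rminus_diag; reflexivity).
  rewrite Cmod_R in K. specialize (K Ht).
  rewrite scal_R_Cmult. change (minus t x) with (t - x).
  rewrite Cmult_comm in K. exact K.
Qed.

Lemma vert_derive (f : C -> C) (x y : R) (d : C) : Cder f (x, y) d ->
  @is_derive R_AbsRing C_R_NormedModule (fun t => f (x, t)) y (Ci * d)%C.
Proof.
  intros H. split. apply (is_linear_scal_l (K := R_AbsRing) (V := C_R_NormedModule)).
  intros u Hu. apply (is_filter_lim_locally_unique (K := R_AbsRing) (V := R_NormedModule)) in Hu.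
  subst u. intros e. apply Cder_eps with (eps := e) in H; [|apply cond_pos].
  destruct H as [de [Hd K]]. exists (mkposreal de Hd). intros t Ht.
  rewrite norm_C_R. specialize (K (x, t)).
  replace ((x, t) - (x, y))%C with (Ci * RtoC (t - y))%C in K
    by (rewrite pair_sub; unfold Ci, RtoC, Cmult; simpl; f_equal; ring).
  rewrite Cmod_mult, Cmod_Ci, Rmult_1_l, Cmod_R in K. specialize (K Ht).
  rewrite scal_R_Cmult. change (minus t y) with (t - y).
  replace (d * (Ci * (t - y)%R))%C with ((t - y)%R * (Ci * d))%C in K by ring. exact K.
Qed.

(** The plane without the closed negative imaginary half-axis: |w| + Im w vanishes exactly there. *)
Definition slit (w : C) : Prop := 0 < Cmod w + Im w.

(** The half-angle formula arg u = 2 atan (Im u / (|u| + Re u)) applied to u = w / i, then shifted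
    by pi / 2; one formula serves the whole slit plane. *)
Definition larg (w : C) : R := PI / 2 + 2 * atan (- Re w / (Cmod w + Im w)).

Definition lg (w : C) : C := (ln (Cmod w), larg w).

Lemma slit_nz w : slit w -> 0 < Cmod w.
Proof.
  unfold slit. intros H. pose proof (im_le_Cmod w). pose proof (Rle_abs (Im w)). lra.
Qed.

Lemma slit_intro w : Re w <> 0 \/ 0 < Im w -> slit w.
Proof.
  unfold slit. intros H. pose proof (Cmod2_alt w) as E. pose proof (Cmod_ge_0 w).
  destruct H as [H|H].
  - assert (0 < Re w ^ 2) by (apply pow2_gt_0; auto).
    apply Rnot_le_lt. intros L.
    assert (0 <= (- Im w - Cmod w) * (- Im w + Cmod w)) by (apply Rmult_le_pos; lra). nra.
  - lra.
Qed.

(** With [t] the tangent of the half angle, the cosine is -2t / (1 + t^2) and the sine (1 - t^2) /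
    (1 + t^2); the norm of [w] gives 1 + t^2 = 2 |w| / (|w| + Im w). *)
Lemma Cexp_lg w : slit w -> Cexp (lg w) = w.
Proof.
  intros H. pose proof (slit_nz w H) as P. pose proof (Cmod2_alt w) as E.
  unfold Cexp, lg, larg; simpl Re; simpl Im. rewrite exp_ln by auto.
  set (t := - Re w / (Cmod w + Im w)). unfold slit in H.
  rewrite cos_plus, sin_plus, cos_PI2, sin_PI2, cos_2a, sin_2a, cos_atan, sin_atan.
  set (r := sqrt (1 + t²)).
  assert (R2 : r * r = 1 + t * t). { unfold r. rewrite sqrt_sqrt. reflexivity. unfold Rsqr; nra. }
  assert (Rp : 0 < r) by (apply sqrt_lt_R0; unfold Rsqr; nra).
  assert (T : 1 + t * t = 2 * Cmod w / (Cmod w + Im w)).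
  { assert (D : t * (Cmod w + Im w) = - Re w) by (unfold t; field; lra).
    apply (Rmult_eq_reg_r ((Cmod w + Im w) * (Cmod w + Im w))); [|nra].
    transitivity ((Cmod w + Im w) * (Cmod w + Im w)
      + (t * (Cmod w + Im w)) * (t * (Cmod w + Im w))); [ring|]. rewrite D.
    transitivity (2 * Cmod w * (Cmod w + Im w)); [simpl in E; nra|field; lra]. }
  assert (Q : 0 < 2 * Cmod w / (Cmod w + Im w)) by (apply Rdiv_lt_0_compat; lra).
  transitivity (Re w, Im w); [|destruct w; reflexivity].
  f_equal.
  - transitivity (Cmod w * (- (2 * t) / (r * r))). field; lra.
    rewrite R2, T. unfold t. field; lra.
  - transitivity (Cmod w * ((1 - t * t) / (r * r))). field; lra.
    rewrite R2. replace (1 - t * t) with (2 - (1 + t * t)) by ring. rewrite T. field; lra.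
Qed.

Lemma Cexp_lg_mul w s : slit w -> Cexp (- (s + 1) * lg w) = (Cexp (- s * lg w) / w)%C.
Proof.
  intros H. replace (- (s + 1) * lg w)%C with (- s * lg w + - lg w)%C by ring.
  rewrite Cexp_plus, Cexp_opp, Cexp_lg by auto. reflexivity.
Qed.

Lemma Ccont_pair (u v : C -> R) (z : C) :
  @continuous C_UniformSpace R_UniformSpace u z ->
  @continuous C_UniformSpace R_UniformSpace v z -> Ccont (fun w => (u w, v w)) z.
Proof.
  intros Hu Hv e He. unfold continuous in Hu, Hv.
  rewrite filterlim_locally in Hu. rewrite filterlim_locally in Hv.
  destruct (Hu (mkposreal (e/2) ltac:(lra))) as [d1 K1].
  destruct (Hv (mkposreal (e/2) ltac:(lra))) as [d2 K2].
  exists (Rmin d1 d2). split. apply Rmin_pos; apply cond_pos.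
  intros w Hw. pose proof (Rmin_l d1 d2). pose proof (Rmin_r d1 d2).
  pose proof (Rmax_Cmod (w - z)%C) as M.
  assert (B : Rabs (Re w - Re z) < Rmin d1 d2 /\ Rabs (Im w - Im z) < Rmin d1 d2).
  { split; (eapply Rle_lt_trans; [|exact Hw]); (eapply Rle_trans; [|exact M]).
    apply Rmax_l. apply Rmax_r. }
  assert (B1 : @ball C_UniformSpace z d1 w).
  { split; unfold ball; simpl; unfold AbsRing_ball, abs, minus, plus, opp; simpl;
    unfold Re, Im, Rminus in B; lra. }
  assert (B2 : @ball C_UniformSpace z d2 w).
  { split; unfold ball; simpl; unfold AbsRing_ball, abs, minus, plus, opp; simpl;
    unfold Re, Im, Rminus in B; lra. }
  specialize (K1 w B1). specialize (K2 w B2). simpl in K1, K2.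
  unfold ball in K1, K2; simpl in K1, K2. unfold AbsRing_ball, abs, minus, plus, opp in K1, K2; simpl in K1, K2.
  rewrite pair_sub. eapply Rle_lt_trans; [apply Cmod_le_abs|]. unfold Rminus; lra.
Qed.

Lemma Cmod_continuous (z : C) : @continuous C_UniformSpace R_UniformSpace Cmod z.
Proof.
  unfold Cmod. apply (continuous_comp (U := C_UniformSpace) (fun w : C => fst w ^ 2 + snd w ^ 2) sqrt).
  - assert (F : @continuous C_UniformSpace R_UniformSpace fst z)
      by (destruct z; apply (continuous_fst (U := R_UniformSpace) (V := R_UniformSpace))).
    assert (S : @continuous C_UniformSpace R_UniformSpace snd z)
      by (destruct z; apply (continuous_snd (U := R_UniformSpace) (V := R_UniformSpace))).
    simpl. apply (continuous_plus (U := C_UniformSpace) (V := R_NormedModule));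
    repeat (assumption || apply continuous_const
            || apply (continuous_mult (U := C_UniformSpace) (K := R_AbsRing))).
  - apply continuous_sqrt.
Qed.

Lemma lg_cont w : slit w -> Ccont lg w.
Proof.
  intros H. pose proof (slit_nz w H) as P. unfold slit in H.
  apply Ccont_pair.
  - apply (continuous_comp (U := C_UniformSpace) Cmod ln). apply Cmod_continuous.
    apply (ex_derive_continuous (V := R_NormedModule)). eexists. apply is_derive_ln; auto.
  - unfold larg.
    apply (continuous_plus (U := C_UniformSpace) (V := R_NormedModule)); [apply continuous_const|].
    apply (continuous_mult (U := C_UniformSpace) (K := R_AbsRing)); [apply continuous_const|].
    apply (continuous_comp (U := C_UniformSpace) (fun w : C => - Re w / (Cmod w + Im w)) atan).
    2:{ apply (ex_derive_continuous (V := R_NormedModule)). eexists. apply is_derive_atan. }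
    apply (continuous_mult (U := C_UniformSpace) (K := R_AbsRing)).
    + apply (continuous_opp (U := C_UniformSpace) (V := R_NormedModule)).
      apply (continuous_fst (U := R_UniformSpace) (V := R_UniformSpace)).
    + apply (continuous_comp (U := C_UniformSpace) (fun w : C => Cmod w + Im w) Rinv).
      * apply (continuous_plus (U := C_UniformSpace) (V := R_NormedModule)).
        apply Cmod_continuous. apply (continuous_snd (U := R_UniformSpace) (V := R_UniformSpace)).
      * apply continuous_Rinv. lra.
Qed.

Lemma slit_open w : slit w -> exists r, 0 < r /\ forall u, Cmod (u - w) < r -> slit u.
Proof.
  unfold slit. intros H. exists ((Cmod w + Im w) / 2). split; [lra|]. intros u Hu.
  pose proof (Cmod_rev_tri w u) as A. rewrite Cmod_sub_sym in A.
  pose proof (im_le_Cmod (u - w)) as B.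
  pose proof (Rle_abs (- Im (u - w)%C)) as D. rewrite Rabs_Ropp in D.
  replace (Im (u - w)%C) with (Im u - Im w) in * by reflexivity. lra.
Qed.

(** An inverse function argument: [lg] is continuous and inverted by [Cexp], so with u = lg z - lg w
    one has z - w = w (e^u - 1), and the claim is a second order bound in [u]. *)
Lemma Cder_lg w : slit w -> Cder lg w (/ w)%C.
Proof.
  intros H. apply Cder_eps. intros e He. destruct (slit_open w H) as [r [Hr Ho]].
  pose proof (slit_nz w H) as P. assert (Hw0 : w <> 0%C) by (apply Cmod_gt_0; auto).
  (* 1/6 validates the lower bound |u| / 2 on |e^u - 1|; e |w| / 6 makes the remainder 3 |u|^2 at
     most e |w| |u| / 2. *)
  set (k := Rmin (1/6) (e * Cmod w / 6)).
  assert (Hk : 0 < k) by (apply Rmin_pos; nra).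
  pose proof (Rmin_l (1/6) (e * Cmod w / 6)) as k1. pose proof (Rmin_r (1/6) (e * Cmod w / 6)) as k2.
  fold k in k1, k2.
  destruct (lg_cont w H k Hk) as [de [Hd K]].
  exists (Rmin r de). split; [apply Rmin_pos; auto|]. intros z Hz.
  pose proof (Rmin_l r de). pose proof (Rmin_r r de).
  specialize (K z ltac:(lra)). set (u := (lg z - lg w)%C) in *.
  assert (Ez : z = (w * Cexp u)%C).
  { unfold u. rewrite <- (Cexp_lg w H) at 1. rewrite <- Cexp_plus, <- (Cexp_lg z) at 1 by (apply Ho; lra).
    f_equal; ring. }
  replace (z - w)%C with (w * (Cexp u - 1))%C by (rewrite Ez at 1; ring).
  replace (u - / w * (w * (Cexp u - 1)))%C with (- (Cexp u - 1 - u))%C by (field; auto).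
  rewrite Cmod_opp, Cmod_mult. pose proof (Cexp_sub2_bound u) as B.
  set (t := Cmod u) in *. assert (T : 0 <= t) by apply Cmod_ge_0.
  assert (X : exp t <= 3). { apply Rle_trans with (exp 1). apply exp_le; lra. apply exp_le_3. }
  assert (B2 : Cmod (Cexp u - 1 - u) <= 3 * (t * t)) by nra.
  assert (B3 : t / 2 <= Cmod (Cexp u - 1)) by (apply Cexp_sub1_lower; fold t; lra).
  apply Rle_trans with (e * (Cmod w * (t / 2))).
  - apply Rle_trans with (3 * (t * t)); auto. nra.
  - apply Rmult_le_compat_l; [lra|]. apply Rmult_le_compat_l; lra.
Qed.

(* [pw w s] is the power [w ^ (-s)] for the branch [-PI/2 < arg w < 3 PI/2]. *)
Definition pw (w s : C) : C := Cexp (- s * lg w)%C.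

Lemma pw_succ w s : slit w -> pw w (s + 1)%C = (pw w s / w)%C.
Proof. apply Cexp_lg_mul. Qed.

Lemma Cder_pw w s : slit w -> Cder (fun u => pw u s) w (- s * pw w (s + 1))%C.
Proof.
  intros H. pose proof (slit_nz w H) as P. rewrite pw_succ by auto.
  replace (- s * (pw w s / w))%C with ((0 * lg w + - s * / w) * Cexp (- s * lg w))%C
    by (unfold pw; field; apply Cmod_gt_0; auto).
  apply (Cder_comp Cexp (fun u => (- s * lg u)%C)). apply Cder_Cexp.
  apply (Cder_mult (fun _ => (- s)%C) lg). apply Cder_const. apply Cder_lg; auto.
Qed.

Lemma Cexd_pw w s : slit w -> Cexd (fun u => pw u s) w.
Proof. intros H. eexists. apply Cder_pw; auto. Qed.

Lemma larg_bound w : Rabs (larg w) <= 2 * PI.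
Proof.
  unfold larg. pose proof (atan_bound (- Re w / (Cmod w + Im w))). pose proof PI_RGT_0.
  apply Rabs_le. lra.
Qed.

Lemma Cmod_pw w s : Cmod (pw w s) <= exp (- Re s * ln (Cmod w) + 2 * PI * Rabs (Im s)).
Proof.
  unfold pw. rewrite Cmod_Cexp. apply exp_le.
  replace (Re (- s * lg w)%C) with (- Re s * ln (Cmod w) + Im s * larg w).
  2:{ rewrite re_mult, re_opp, im_opp. unfold lg; simpl. ring. }
  pose proof (larg_bound w). pose proof (Rle_abs (Im s * larg w)) as A. rewrite Rabs_mult in A.
  pose proof (Rabs_pos (Im s)). nra.
Qed.

(** * Cauchy's theorem on rectangles *)

Definition hint (f : C -> C) (y a b : R) : C := CInt (fun x => f (x, y)) a b.
(** The parameter is the real [y]; the factor [Ci] of dw = i dy is supplied where contours are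
    assembled. *)
Definition vint (f : C -> C) (x a b : R) : C := CInt (fun y => f (x, y)) a b.

(* Counterclockwise integral along the boundary of [x1, x2] x [y1, y2]. *)
Definition rint (f : C -> C) (x1 x2 y1 y2 : R) : C :=
  (hint f y1 x1 x2 - hint f y2 x1 x2 + Ci * (vint f x2 y1 y2 - vint f x1 y1 y2))%C.

Definition onH (f : C -> C) (y a b : R) : Prop := forall x, a <= x <= b -> Ccont f (x, y).
Definition onV (f : C -> C) (x a b : R) : Prop := forall y, a <= y <= b -> Ccont f (x, y).

Lemma ex_hint f y a b : a <= b -> onH f y a b -> ex_CInt (fun x => f (x, y)) a b.
Proof.
  intros Hab H. apply (ex_RInt_continuous (V := C_R_CompleteNormedModule)).
  rewrite Rmin_left, Rmax_right by auto. intros x Hx. apply horiz_continuous, H, Hx.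
Qed.

Lemma ex_vint f x a b : a <= b -> onV f x a b -> ex_CInt (fun y => f (x, y)) a b.
Proof.
  intros Hab H. apply (ex_RInt_continuous (V := C_R_CompleteNormedModule)).
  rewrite Rmin_left, Rmax_right by auto. intros y Hy. apply vert_continuous, H, Hy.
Qed.

Lemma hint_Chasles f y a b c : a <= b <= c -> onH f y a c ->
  (hint f y a b + hint f y b c)%C = hint f y a c.
Proof.
  intros Hab H. apply CInt_Chasles; apply ex_hint; try lra; intros x Hx; apply H; lra.
Qed.

Lemma vint_Chasles f x a b c : a <= b <= c -> onV f x a c ->
  (vint f x a b + vint f x b c)%C = vint f x a c.
Proof.
  intros Hab H. apply CInt_Chasles; apply ex_vint; try lra; intros y Hy; apply H; lra.
Qed.

Lemma rint_split_x f x1 x2 x3 y1 y2 : x1 <= x2 <= x3 -> onH f y1 x1 x3 -> onH f y2 x1 x3 ->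
  rint f x1 x3 y1 y2 = (rint f x1 x2 y1 y2 + rint f x2 x3 y1 y2)%C.
Proof.
  intros Hx H1 H2. unfold rint.
  rewrite <- (hint_Chasles f y1 x1 x2 x3), <- (hint_Chasles f y2 x1 x2 x3) by auto. ring.
Qed.

Lemma rint_split_y f x1 x2 y1 y2 y3 : y1 <= y2 <= y3 -> onV f x1 y1 y3 -> onV f x2 y1 y3 ->
  rint f x1 x2 y1 y3 = (rint f x1 x2 y1 y2 + rint f x1 x2 y2 y3)%C.
Proof.
  intros Hx H1 H2. unfold rint.
  rewrite <- (vint_Chasles f x1 y1 y2 y3), <- (vint_Chasles f x2 y1 y2 y3) by auto. ring.
Qed.

Lemma hint_bound f y a b M : a <= b -> onH f y a b ->
  (forall x, a <= x <= b -> Cmod (f (x, y)) <= M) -> Cmod (hint f y a b) <= (b - a) * M.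
Proof. intros Hab Hc H. apply CInt_bound; auto using ex_hint. Qed.

Lemma vint_bound f x a b M : a <= b -> onV f x a b ->
  (forall y, a <= y <= b -> Cmod (f (x, y)) <= M) -> Cmod (vint f x a b) <= (b - a) * M.
Proof. intros Hab Hc H. apply CInt_bound; auto using ex_vint. Qed.

Lemma rint_bound f x1 x2 y1 y2 M : x1 <= x2 -> y1 <= y2 ->
  onH f y1 x1 x2 -> onH f y2 x1 x2 -> onV f x1 y1 y2 -> onV f x2 y1 y2 ->
  (forall x y, x1 <= x <= x2 -> y1 <= y <= y2 -> (x = x1 \/ x = x2 \/ y = y1 \/ y = y2) ->
     Cmod (f (x, y)) <= M) ->
  Cmod (rint f x1 x2 y1 y2) <= 2 * ((x2 - x1) + (y2 - y1)) * M.
Proof.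
  intros Hx Hy A B D E H. unfold rint.
  pose proof (hint_bound f y1 x1 x2 M Hx A ltac:(intros; apply H; auto; lra)).
  pose proof (hint_bound f y2 x1 x2 M Hx B ltac:(intros; apply H; auto; lra)).
  pose proof (vint_bound f x1 y1 y2 M Hy D ltac:(intros; apply H; auto; lra)).
  pose proof (vint_bound f x2 y1 y2 M Hy E ltac:(intros; apply H; auto; lra)).
  eapply Rle_trans; [apply Cmod_triangle|]. rewrite Cmod_mult, Cmod_Ci, Rmult_1_l.
  pose proof (Cmod_sub_le (hint f y1 x1 x2) (hint f y2 x1 x2)).
  pose proof (Cmod_sub_le (vint f x2 y1 y2) (vint f x1 y1 y2)). lra.
Qed.

Lemma Ccont_minus f g z : Ccont f z -> Ccont g z -> Ccont (fun w => f w - g w)%C z.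
Proof.
  intros Hf Hg e He. destruct (Hf (e/2)) as [d1 [P1 K1]]; [lra|].
  destruct (Hg (e/2)) as [d2 [P2 K2]]; [lra|].
  exists (Rmin d1 d2). split; [apply Rmin_pos; auto|]. intros w Hw.
  pose proof (Rmin_l d1 d2). pose proof (Rmin_r d1 d2).
  specialize (K1 w ltac:(lra)). specialize (K2 w ltac:(lra)).
  replace (f w - g w - (f z - g z))%C with ((f w - f z) - (g w - g z))%C by ring.
  pose proof (Cmod_sub_le (f w - f z) (g w - g z)). lra.
Qed.

Lemma Ccont_scal c f z : Ccont f z -> Ccont (fun w => c * f w)%C z.
Proof.
  intros Hf e He. pose proof (Cmod_ge_0 c).
  destruct (Hf (e / (Cmod c + 1))) as [d [P K]]. { apply Rdiv_lt_0_compat; lra. }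
  exists d. split; auto. intros w Hw. specialize (K w Hw).
  replace (c * f w - c * f z)%C with (c * (f w - f z))%C by ring. rewrite Cmod_mult.
  pose proof (Cmod_ge_0 (f w - f z)).
  apply Rmult_lt_compat_l with (r := Cmod c + 1) in K; [|lra].
  replace ((Cmod c + 1) * (e / (Cmod c + 1))) with e in K by (field; lra). nra.
Qed.

Lemma hint_minus f g y a b : a <= b -> onH f y a b -> onH g y a b ->
  hint (fun w => f w - g w)%C y a b = (hint f y a b - hint g y a b)%C.
Proof.
  intros. apply (CInt_minus (fun x => f (x, y)) (fun x => g (x, y))); apply ex_hint; assumption.
Qed.

Lemma vint_minus f g x a b : a <= b -> onV f x a b -> onV g x a b ->
  vint (fun w => f w - g w)%C x a b = (vint f x a b - vint g x a b)%C.
Proof.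
  intros. apply (CInt_minus (fun y => f (x, y)) (fun y => g (x, y))); apply ex_vint; assumption.
Qed.

Lemma hint_scal c f y a b : a <= b -> onH f y a b ->
  hint (fun w => c * f w)%C y a b = (c * hint f y a b)%C.
Proof. intros. apply (CInt_scal c (fun x => f (x, y))). apply ex_hint; assumption. Qed.

Lemma vint_scal c f x a b : a <= b -> onV f x a b ->
  vint (fun w => c * f w)%C x a b = (c * vint f x a b)%C.
Proof. intros. apply (CInt_scal c (fun y => f (x, y))). apply ex_vint; assumption. Qed.

Lemma rint_minus f g x1 x2 y1 y2 : x1 <= x2 -> y1 <= y2 ->
  onH f y1 x1 x2 -> onH f y2 x1 x2 -> onV f x1 y1 y2 -> onV f x2 y1 y2 ->
  onH g y1 x1 x2 -> onH g y2 x1 x2 -> onV g x1 y1 y2 -> onV g x2 y1 y2 ->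
  rint (fun w => f w - g w)%C x1 x2 y1 y2 = (rint f x1 x2 y1 y2 - rint g x1 x2 y1 y2)%C.
Proof.
  intros. unfold rint. rewrite !hint_minus, !vint_minus by assumption. ring.
Qed.

Lemma rint_scal c f x1 x2 y1 y2 : x1 <= x2 -> y1 <= y2 ->
  onH f y1 x1 x2 -> onH f y2 x1 x2 -> onV f x1 y1 y2 -> onV f x2 y1 y2 ->
  rint (fun w => c * f w)%C x1 x2 y1 y2 = (c * rint f x1 x2 y1 y2)%C.
Proof.
  intros. unfold rint. rewrite !hint_scal, !vint_scal by assumption. ring.
Qed.

Lemma hint_primitive (F f : C -> C) y a b : a <= b -> onH f y a b ->
  (forall x, a <= x <= b -> Cder F (x, y) (f (x, y))) -> hint f y a b = (F (b, y) - F (a, y))%C.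
Proof.
  intros Hab Hc H. apply CInt_unique.
  apply (is_RInt_derive (V := C_R_CompleteNormedModule) (fun x => F (x, y)));
    rewrite Rmin_left, Rmax_right by auto; intros x Hx.
  - apply horiz_derive, H, Hx.
  - apply horiz_continuous, Hc, Hx.
Qed.

Lemma vint_primitive (F f : C -> C) x a b : a <= b -> onV f x a b ->
  (forall y, a <= y <= b -> Cder F (x, y) (f (x, y))) ->
  (Ci * vint f x a b)%C = (F (x, b) - F (x, a))%C.
Proof.
  intros Hab Hc H. unfold vint. rewrite <- CInt_scal by (apply ex_vint; auto).
  apply CInt_unique.
  apply (is_RInt_derive (V := C_R_CompleteNormedModule) (fun y => F (x, y)));
    rewrite Rmin_left, Rmax_right by auto; intros y Hy.
  - apply vert_derive, H, Hy.
  - apply (vert_continuous (fun w => Ci * f w)%C). apply Ccont_scal, Hc, Hy.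
Qed.

Lemma rint_primitive (F f : C -> C) x1 x2 y1 y2 : x1 <= x2 -> y1 <= y2 ->
  (forall w, Ccont f w) -> (forall w, Cder F w (f w)) -> rint f x1 x2 y1 y2 = 0%C.
Proof.
  intros Hx Hy Hc H. unfold rint, Cminus. rewrite Cmult_plus_distr_l.
  replace (Ci * - vint f x1 y1 y2)%C with (- (Ci * vint f x1 y1 y2))%C by ring.
  rewrite !(hint_primitive F f), !(vint_primitive F f); auto; try (intros ? ?; auto).
  ring.
Qed.

Lemma rint_affine (p q : C) x1 x2 y1 y2 : x1 <= x2 -> y1 <= y2 ->
  rint (fun w => p + q * w)%C x1 x2 y1 y2 = 0%C.
Proof.
  intros Hx Hy. apply (rint_primitive (fun w => p * w + q / 2 * (w * w))%C); auto.
  - intros w. apply Cexd_cont, Cexd_plus; [apply Cexd_const|].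
    apply Cexd_mult; [apply Cexd_const|apply Cexd_id].
  - intros w.
    replace (p + q * w)%C with ((0 * w + p * 1) + (0 * (w * w) + q / 2 * (1 * w + w * 1)))%C.
    + apply Cder_plus.
      * apply (Cder_mult (fun _ => p) (fun w => w)); auto using Cder_const, Cder_id.
      * apply (Cder_mult (fun _ => (q / 2)%C) (fun w => w * w)%C); auto using Cder_const.
        apply (Cder_mult (fun w => w) (fun w => w)); apply Cder_id.
    + field.
Qed.

Lemma nested_intervals (u v : nat -> R) :
  (forall n, u n <= u (S n)) -> (forall n, v (S n) <= v n) -> (forall n, u n <= v n) ->
  exists l, forall n, u n <= l <= v n.
Proof.
  intros Hu Hv Huv.
  assert (Mu : forall n k, u n <= u (n + k)%nat).
  { intros n k; induction k. rewrite Nat.add_0_r; lra.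
    rewrite Nat.add_succ_r. specialize (Hu (n + k)%nat). lra. }
  assert (Mv : forall n k, v (n + k)%nat <= v n).
  { intros n k; induction k. rewrite Nat.add_0_r; lra.
    rewrite Nat.add_succ_r. specialize (Hv (n + k)%nat). lra. }
  assert (A : forall n m, u n <= v m).
  { intros n m. pose proof (Mu n m). pose proof (Mv m n). rewrite (Nat.add_comm m n) in H0.
    specialize (Huv (n + m)%nat). lra. }
  destruct (completeness (fun x => exists n, x = u n)) as [l [L1 L2]].
  - exists (v O). intros x [n ->]. apply A.
  - exists (u O). exists O. reflexivity.
  - exists l. intros n. split. apply L1. exists n; reflexivity.
    apply L2. intros x [m ->]. apply A.
Qed.

Lemma half_pow_lt (L d : R) : 0 <= L -> 0 < d -> exists n, L * (/ 2) ^ n < d.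
Proof.
  intros HL Hd. destruct (pow_lt_1_zero (/ 2)) with (y := d / (L + 1)) as [N HN].
  - rewrite Rabs_pos_eq; lra.
  - apply Rdiv_lt_0_compat; lra.
  - exists N. specialize (HN N (le_n N)). rewrite Rabs_pos_eq in HN by (apply pow_le; lra).
    assert (0 < (/2) ^ N) by (apply pow_lt; lra).
    apply Rmult_lt_compat_l with (r := L + 1) in HN; [|lra].
    replace ((L + 1) * (d / (L + 1))) with d in HN by (field; lra). nra.
Qed.

Section Goursat.
Variables (f : C -> C) (x1 x2 y1 y2 eta : R).
Hypothesis Hx : x1 <= x2.
Hypothesis Hy : y1 <= y2.
Hypothesis Hf : forall x y, x1 <= x <= x2 -> y1 <= y <= y2 -> Cexd f (x, y).

(** The last quarter is taken untested: if the whole integral is at least 4e and the other three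
    fall below [e], the triangle inequality forces it to reach [e]. *)
Definition bisect_step (a b e : R) (p : R * R) : R * R :=
  if Rle_dec e (Cmod (rint f (fst p) (fst p + a) (snd p) (snd p + b))) then p
  else if Rle_dec e (Cmod (rint f (fst p + a) (fst p + 2 * a) (snd p) (snd p + b)))
  then (fst p + a, snd p)
  else if Rle_dec e (Cmod (rint f (fst p) (fst p + a) (snd p + b) (snd p + 2 * b)))
  then (fst p, snd p + b)
  else (fst p + a, snd p + b).

Fixpoint bisect (n : nat) : R * R :=
  match n with
  | O => (x1, y1)
  | S m => bisect_step ((x2 - x1) * (/ 2) ^ n) ((y2 - y1) * (/ 2) ^ n) (eta * (/ 4) ^ n) (bisect m)
  end.

Lemma bisect_step_spec (a b e p q : R) : 0 <= a -> 0 <= b ->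
  x1 <= p -> p + 2 * a <= x2 -> y1 <= q -> q + 2 * b <= y2 ->
  4 * e <= Cmod (rint f p (p + 2 * a) q (q + 2 * b)) ->
  let (p', q') := bisect_step a b e (p, q) in
  p <= p' <= p + a /\ q <= q' <= q + b /\ e <= Cmod (rint f p' (p' + a) q' (q' + b)).
Proof.
  intros Ha Hb A B D E H.
  rewrite (rint_split_x f p (p + a) (p + 2 * a)) in H;
    try lra; try (intros ? ?; apply Cexd_cont, Hf; lra).
  rewrite (rint_split_y f p (p + a) q (q + b) (q + 2 * b)) in H;
    try lra; try (intros ? ?; apply Cexd_cont, Hf; lra).
  rewrite (rint_split_y f (p + a) (p + 2 * a) q (q + b) (q + 2 * b)) in H;
    try lra; try (intros ? ?; apply Cexd_cont, Hf; lra).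
  set (r1 := rint f p (p + a) q (q + b)) in *.
  set (r2 := rint f p (p + a) (q + b) (q + 2 * b)) in *.
  set (r3 := rint f (p + a) (p + 2 * a) q (q + b)) in *.
  set (r4 := rint f (p + a) (p + 2 * a) (q + b) (q + 2 * b)) in *.
  pose proof (Cmod_triangle (r1 + r2) (r3 + r4)). pose proof (Cmod_triangle r1 r2).
  pose proof (Cmod_triangle r3 r4).
  unfold bisect_step; simpl fst; simpl snd. fold r1 r2 r3.
  destruct (Rle_dec e (Cmod r1)); [repeat split; try lra; auto|].
  destruct (Rle_dec e (Cmod r3)).
  { repeat split; try lra. replace (p + a + a) with (p + 2 * a) by ring. auto. }
  destruct (Rle_dec e (Cmod r2)).
  { repeat split; try lra. replace (q + b + b) with (q + 2 * b) by ring. auto. }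
  repeat split; try lra. replace (p + a + a) with (p + 2 * a) by ring.
  replace (q + b + b) with (q + 2 * b) by ring. fold r4. lra.
Qed.

Lemma bisect_spec : eta <= Cmod (rint f x1 x2 y1 y2) -> forall n,
  x1 <= fst (bisect n) /\ fst (bisect n) + (x2 - x1) * (/ 2) ^ n <= x2 /\
  y1 <= snd (bisect n) /\ snd (bisect n) + (y2 - y1) * (/ 2) ^ n <= y2 /\
  eta * (/ 4) ^ n <= Cmod (rint f (fst (bisect n)) (fst (bisect n) + (x2 - x1) * (/ 2) ^ n)
                             (snd (bisect n)) (snd (bisect n) + (y2 - y1) * (/ 2) ^ n)) /\
  fst (bisect n) <= fst (bisect (S n)) <= fst (bisect n) + (x2 - x1) * (/ 2) ^ (S n) /\
  snd (bisect n) <= snd (bisect (S n)) <= snd (bisect n) + (y2 - y1) * (/ 2) ^ (S n).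
Proof.
  intros H0 n.
  assert (Step : forall n, x1 <= fst (bisect n) -> fst (bisect n) + (x2 - x1) * (/ 2) ^ n <= x2 ->
    y1 <= snd (bisect n) -> snd (bisect n) + (y2 - y1) * (/ 2) ^ n <= y2 ->
    eta * (/ 4) ^ n <= Cmod (rint f (fst (bisect n)) (fst (bisect n) + (x2 - x1) * (/ 2) ^ n)
                             (snd (bisect n)) (snd (bisect n) + (y2 - y1) * (/ 2) ^ n)) ->
    fst (bisect n) <= fst (bisect (S n)) <= fst (bisect n) + (x2 - x1) * (/ 2) ^ (S n) /\
    snd (bisect n) <= snd (bisect (S n)) <= snd (bisect n) + (y2 - y1) * (/ 2) ^ (S n) /\
    eta * (/ 4) ^ (S n) <= Cmod (rint f (fst (bisect (S n))) (fst (bisect (S n)) + (x2 - x1) * (/ 2) ^ (S n))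
                             (snd (bisect (S n))) (snd (bisect (S n)) + (y2 - y1) * (/ 2) ^ (S n)))).
  { clear n. intros n A B D E F. destruct (bisect n) as [p q] eqn:Eb. cbn [fst snd] in *.
    assert (P : 0 < (/2)^n) by (apply pow_lt; lra).
    pose proof (bisect_step_spec ((x2 - x1) * (/ 2) ^ S n) ((y2 - y1) * (/ 2) ^ S n)
      (eta * (/ 4) ^ S n) p q) as S.
    replace (2 * ((x2 - x1) * (/ 2) ^ Datatypes.S n)) with ((x2 - x1) * (/ 2) ^ n) in S by (simpl; field).
    replace (2 * ((y2 - y1) * (/ 2) ^ Datatypes.S n)) with ((y2 - y1) * (/ 2) ^ n) in S by (simpl; field).
    replace (4 * (eta * (/ 4) ^ Datatypes.S n)) with (eta * (/ 4) ^ n) in S by (simpl; field).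
    assert (E2 : bisect (Datatypes.S n) = bisect_step ((x2 - x1) * (/ 2) ^ Datatypes.S n)
        ((y2 - y1) * (/ 2) ^ Datatypes.S n) (eta * (/ 4) ^ Datatypes.S n) (p, q)).
    { rewrite <- Eb. reflexivity. }
    rewrite <- E2 in S. destruct (bisect (Datatypes.S n)) as [p' q'].
    apply S; auto; apply Rmult_le_pos; try lra; apply pow_le; lra. }
  assert (I : x1 <= fst (bisect n) /\ fst (bisect n) + (x2 - x1) * (/ 2) ^ n <= x2 /\
    y1 <= snd (bisect n) /\ snd (bisect n) + (y2 - y1) * (/ 2) ^ n <= y2 /\
    eta * (/ 4) ^ n <= Cmod (rint f (fst (bisect n)) (fst (bisect n) + (x2 - x1) * (/ 2) ^ n)
                             (snd (bisect n)) (snd (bisect n) + (y2 - y1) * (/ 2) ^ n))).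
  { induction n.
    - simpl. repeat split; try lra. replace (x1 + (x2 - x1) * 1) with x2 by ring.
      replace (y1 + (y2 - y1) * 1) with y2 by ring. lra.
    - destruct IHn as (A & B & D & E & F).
      destruct (Step n A B D E F) as (G1 & G2 & G3).
      assert (Q : forall c, c * (/2) ^ S n = c * (/2)^n / 2) by (intros; simpl; field).
      rewrite !Q in *. repeat split; try lra. }
  destruct I as (A & B & D & E & F). destruct (Step n A B D E F) as (G1 & G2 & G3).
  repeat split; try tauto; try lra.
Qed.
End Goursat.

(** Affine functions integrate to 0 over rectangles, so near the limit point of the bisection only
    the deviation of [f] from its tangent counts, and that is too small for the quarter integrals
    kept by [bisect]. *)
Lemma goursat f x1 x2 y1 y2 : x1 <= x2 -> y1 <= y2 ->
  (forall x y, x1 <= x <= x2 -> y1 <= y <= y2 -> Cexd f (x, y)) -> rint f x1 x2 y1 y2 = 0%C.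
Proof.
  intros Hx Hy Hf. apply Cmod_eq_0. apply Rle_antisym; [|apply Cmod_ge_0]. apply Rnot_lt_le.
  intros Heta. set (eta := Cmod (rint f x1 x2 y1 y2)) in *.
  pose proof (bisect_spec f x1 x2 y1 y2 eta Hx Hy Hf (Rle_refl _)) as S.
  set (b := bisect f x1 x2 y1 y2 eta) in *.
  assert (P : forall n, 0 < (/2)^n) by (intros; apply pow_lt; lra).
  assert (Q : forall c n, c * (/2) ^ (Datatypes.S n) = c * (/2)^n / 2) by (intros; simpl; field).
  destruct (nested_intervals (fun n => fst (b n)) (fun n => fst (b n) + (x2 - x1) * (/2)^n)) as [X HX].
  { intros n. apply S. }
  { intros n. destruct (S n) as (_ & _ & _ & _ & _ & G & _). rewrite !Q in *. lra. }
  { intros n. specialize (P n). nra. }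
  destruct (nested_intervals (fun n => snd (b n)) (fun n => snd (b n) + (y2 - y1) * (/2)^n)) as [Y HY].
  { intros n. apply S. }
  { intros n. destruct (S n) as (_ & _ & _ & _ & _ & _ & G). rewrite !Q in *. lra. }
  { intros n. specialize (P n). nra. }
  set (L := (x2 - x1) + (y2 - y1)).
  assert (HL : 0 <= L) by (unfold L; lra).
  assert (Hd : Cexd f (X, Y)).
  { apply Hf. destruct (S O) as (A & B & _). specialize (HX O). simpl in *; lra.
    destruct (S O) as (_ & _ & A & B & _). specialize (HY O). simpl in *; lra. }
  destruct Hd as [d Hd].
  (* On the n-th rectangle the perimeter is 2 L h and the deviation at most eps L h with h = 2^(-n);
     this eps makes the product strictly less than eta h^2 = eta 4^(-n). *)
  assert (He : 0 < eta / (2 * L * L + 1)) by (apply Rdiv_lt_0_compat; nra).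
  apply Cder_eps with (eps := eta / (2 * L * L + 1)) in Hd; auto.
  destruct Hd as [de [Hde K]]. destruct (half_pow_lt L de HL Hde) as [n Hn].
  destruct (S n) as (A & B & D & E & F & _). specialize (HX n). specialize (HY n). simpl in HX, HY.
  set (p := fst (b n)) in *. set (q := snd (b n)) in *. specialize (P n).
  set (h := (/2)^n) in *.
  assert (Hp : p <= p + (x2 - x1) * h) by nra. assert (Hq : q <= q + (y2 - y1) * h) by nra.
  set (p' := p + (x2 - x1) * h) in *. set (q' := q + (y2 - y1) * h) in *.
  set (g := fun w => ((f (X, Y) - d * (X, Y)) + d * w)%C).
  assert (Cg : forall w, Ccont g w).
  { intros w. apply Cexd_cont, Cexd_plus; [apply Cexd_const|].
    apply Cexd_mult; [apply Cexd_const|apply Cexd_id]. }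
  assert (Cf : forall x y, p <= x <= p' -> q <= y <= q' -> Ccont f (x, y)).
  { intros. apply Cexd_cont, Hf; lra. }
  assert (Eg : rint f p p' q q' = rint (fun w => f w - g w)%C p p' q q').
  { rewrite rint_minus; auto; try (intros ? ?; apply Cf; lra); try (intros ? ?; apply Cg).
    unfold g. rewrite rint_affine by auto. ring. }
  assert (Bd : Cmod (rint f p p' q q') <= 2 * ((p' - p) + (q' - q)) * (eta / (2 * L * L + 1) * (L * h))).
  { rewrite Eg. apply rint_bound; auto;
      try (intros ? ?; apply Ccont_minus; [apply Cf; lra|apply Cg]).
    intros x y Hxx Hyy _. unfold g.
    replace (f (x, y) - (f (X, Y) - d * (X, Y) + d * (x, y)))%C with
      (f (x, y) - f (X, Y) - d * ((x, y) - (X, Y)))%C by ring.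
    assert (W : Cmod ((x, y) - (X, Y)) <= L * h).
    { rewrite pair_sub. eapply Rle_trans; [apply Cmod_le_abs|].
      assert (Rabs (x - X) <= p' - p) by (apply Rabs_le; lra).
      assert (Rabs (y - Y) <= q' - q) by (apply Rabs_le; lra).
      unfold L, p', q' in *; lra. }
    eapply Rle_trans; [apply K; lra|]. apply Rmult_le_compat_l; lra. }
  assert (H4 : (/4)^n = h * h).
  { unfold h. rewrite <- Rpow_mult_distr. f_equal. field. }
  rewrite H4 in F.
  replace (2 * (p' - p + (q' - q)) * (eta / (2 * L * L + 1) * (L * h))) with
    (eta * (h * h) * (2 * L * L / (2 * L * L + 1))) in Bd
    by (unfold p', q', L in *; field; fold L; nra).
  assert (Z : 2 * L * L / (2 * L * L + 1) < 1).
  { apply Rmult_lt_reg_r with (2 * L * L + 1); [nra|].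
    unfold Rdiv. rewrite Rmult_assoc, Rinv_l by nra. lra. }
  assert (0 < eta * (h * h)) by (repeat apply Rmult_lt_0_compat; auto).
  nra.
Qed.

(** * The identity theorem for entire functions *)

(* Automorphism of the disc of radius [r] about [c] sending [0] to [c + r * al]. *)
Definition moebius (c : C) (r : R) (al u : C) : C :=
  (c + RtoC r * ((u + al) / (1 + Cconj al * u)))%C.

(** Both factors on the right are nonnegative in the closed disc and the second vanishes on the
    circle, so one identity shows that disc and circle are preserved. *)
Lemma moebius_defect (al u : C) :
  Cmod (1 + Cconj al * u) ^ 2 - Cmod (u + al) ^ 2 = (1 - Cmod al ^ 2) * (1 - Cmod u ^ 2).
Proof.
  rewrite !Cmod2_alt. destruct al as [a b], u as [x y]. unfold Cconj; simpl. ring.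
Qed.

Lemma moebius_den (al u : C) : Cmod al < 1 -> Cmod u <= 1 -> (1 + Cconj al * u)%C <> 0%C.
Proof.
  intros Ha Hu. apply Cmod_gt_0.
  pose proof (Cmod_rev_tri 1 (- (Cconj al * u))) as H. rewrite Cmod_1, Cmod_opp, Cmod_mult, Cmod_conj in H.
  replace (1 - - (Cconj al * u))%C with (1 + Cconj al * u)%C in H by ring.
  pose proof (Cmod_ge_0 al). pose proof (Cmod_ge_0 u). nra.
Qed.

Lemma moebius_mod (c : C) (r : R) (al u : C) : 0 < r -> Cmod al < 1 -> Cmod u <= 1 ->
  Cmod (moebius c r al u - c) <= r /\ (Cmod u = 1 -> Cmod (moebius c r al u - c) = r).
Proof.
  intros Hr Ha Hu. pose proof (moebius_den al u Ha Hu) as D. unfold moebius.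
  replace (c + r * ((u + al) / (1 + Cconj al * u)) - c)%C with
    (r * ((u + al) / (1 + Cconj al * u)))%C by ring.
  rewrite Cmod_mult, Cmod_R, Rabs_pos_eq, Cmod_div by (auto; lra).
  pose proof (moebius_defect al u) as E. apply Cmod_gt_0 in D.
  pose proof (Cmod_ge_0 (u + al)). pose proof (Cmod_ge_0 al). pose proof (Cmod_ge_0 u).
  set (m := Cmod (u + al)) in *. set (n := Cmod (1 + Cconj al * u)) in *.
  split.
  - assert (0 <= (1 - Cmod al ^ 2) * (1 - Cmod u ^ 2)) by (apply Rmult_le_pos; nra).
    assert (m <= n) by nra.
    assert (m / n <= 1). { apply Rmult_le_reg_r with n; auto. unfold Rdiv. rewrite Rmult_assoc, Rinv_l; lra. }
    nra.
  - intros Hu1. rewrite Hu1 in E. assert (m = n) by nra. subst m. rewrite H2. field. lra.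
Qed.

Lemma Cexd_moebius c r al u : Cmod al < 1 -> Cmod u <= 1 -> Cexd (moebius c r al) u.
Proof.
  intros Ha Hu. unfold moebius. apply Cexd_plus; [apply Cexd_const|].
  apply Cexd_mult; [apply Cexd_const|]. apply Cexd_div.
  - apply moebius_den; auto.
  - apply Cexd_plus; [apply Cexd_id|apply Cexd_const].
  - apply Cexd_plus; [apply Cexd_const|]. apply Cexd_mult; [apply Cexd_const|apply Cexd_id].
Qed.

(* Along [w -> moebius (Cexp w)] concentric circles become vertical segments, and
   Cauchy's theorem on a period rectangle moves the segment at [Re w = 0] to [Re w = -oo]. *)
Lemma moebius_mean_bound (f : C -> C) (c al : C) (r M : R) : 0 < r -> Cmod al < 1 ->
  (forall z, Cmod (z - c) <= r -> Cexd f z) ->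
  (forall y, 0 <= y <= 2 * PI -> Cmod (f (moebius c r al (Cexp (0, y)))) <= M) ->
  Cmod (f (c + RtoC r * al)%C) <= M.
Proof.
  intros Hr Ha Hf HM. set (h := fun w => f (moebius c r al (Cexp w))).
  assert (He : forall x y, x <= 0 -> Cmod (Cexp (x, y)) <= 1).
  { intros x y Hx. rewrite Cmod_Cexp. simpl. rewrite <- exp_0. apply exp_le; lra. }
  assert (Hd : forall x y, x <= 0 -> Cexd h (x, y)).
  { intros x y Hx. unfold h. apply (Cexd_comp f (fun w => moebius c r al (Cexp w))).
    - apply Hf. apply moebius_mod; auto.
    - apply (Cexd_comp (moebius c r al) Cexp). apply Cexd_moebius; auto.
      eexists; apply Cder_Cexp. }
  pose proof PI_RGT_0 as HPI.
  assert (Hc : forall x y, x <= 0 -> Ccont h (x, y)) by (intros; apply Cexd_cont; auto).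
  assert (Hv : forall X, X <= 0 -> vint h X 0 (2 * PI) = vint h 0 0 (2 * PI)).
  { intros X HX. pose proof (goursat h X 0 0 (2 * PI) HX ltac:(lra)) as G.
    unfold rint in G.
    (* [h] has period 2 pi i, so the two horizontal sides cancel. *)
    assert (E : hint h (2 * PI) X 0 = hint h 0 X 0).
    { apply CInt_ext; auto. intros t Ht. unfold h. do 2 f_equal. unfold Cexp; simpl.
      rewrite cos_2PI, sin_2PI, cos_0, sin_0. reflexivity. }
    rewrite E in G. specialize (G ltac:(intros; apply Hd; lra)).
    assert (G2 : (Ci * (vint h 0 0 (2 * PI) - vint h X 0 (2 * PI)))%C = 0%C) by (rewrite <- G; ring).
    symmetry. apply Ceq_minus.
    replace (vint h 0 0 (2 * PI) - vint h X 0 (2 * PI))%C with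
      (/ Ci * (Ci * (vint h 0 0 (2 * PI) - vint h X 0 (2 * PI))))%C by (field; apply Ci_nz).
    rewrite G2. ring. }
  apply Rnot_lt_le. intros Hlt. set (a := (c + RtoC r * al)%C) in *.
  assert (E0 : moebius c r al 0 = a).
  { unfold moebius, a. field. }
  assert (K : Ccont (fun u => f (moebius c r al u)) 0%C).
  { apply Cexd_cont. apply (Cexd_comp f (moebius c r al)).
    - apply Hf. apply moebius_mod; auto. rewrite Cmod_0; lra.
    - apply Cexd_moebius; auto. rewrite Cmod_0; lra. }
  destruct (K ((Cmod (f a) - M) / 2)) as [de [Hde K2]]; [lra|].
  (* Far enough left, the circle of radius e^X lies where the values differ from [f a] by at most
     half the supposed excess of |f a| over [M]. *)
  set (X := Rmin 0 (ln (de / 2))). assert (HX : X <= 0) by apply Rmin_l.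
  assert (HX2 : exp X < de).
  { apply Rle_lt_trans with (exp (ln (de / 2))). apply exp_le, Rmin_r. rewrite exp_ln; lra. }
  assert (B1 : Cmod (vint h 0 0 (2 * PI)) <= (2 * PI - 0) * M).
  { apply vint_bound; try lra. intros y Hy; apply Hc; lra. auto. }
  assert (B2 : Cmod (vint (fun w => h w - f a)%C X 0 (2 * PI)) <= (2 * PI - 0) * ((Cmod (f a) - M) / 2)).
  { apply vint_bound; try lra.
    - intros y Hy. apply Ccont_minus; auto. apply Cexd_cont, Cexd_const.
    - intros y Hy. apply Rlt_le. unfold h. rewrite <- E0 at 1. apply K2.
      replace (Cexp (X, y) - 0)%C with (Cexp (X, y)) by ring. rewrite Cmod_Cexp. exact HX2. }
  unfold vint in B2. rewrite CInt_minus in B2.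
  2:{ apply ex_vint; [lra|]. intros y Hy; auto. }
  2:{ eexists. apply (is_RInt_const (V := C_R_NormedModule)). }
  fold (vint h X 0 (2 * PI)) in B2. rewrite (Hv X HX), CInt_const in B2.
  pose proof (Cmod_rev_tri ((2 * PI - 0)%R * f a) (vint h 0 0 (2 * PI))) as B3.
  rewrite Cmod_sub_sym, Cmod_mult, Cmod_R, Rabs_pos_eq in B3 by lra. nra.
Qed.

Lemma bounded_on_segment (g : R -> R) (a b : R) : a <= b ->
  (forall x, a <= x <= b -> continuity_pt g x) -> exists M, forall x, a <= x <= b -> g x <= M.
Proof.
  intros Hab H. destruct (continuity_ab_maj g a b Hab H) as [m [Hm _]]. exists (g m). exact Hm.
Qed.

(** A Schwarz argument: f / (z - c)^N is again entire, and comparing [a], at distance d from [c],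
    with the circle of radius 2d bounds |f a| by M 2^(-N) for every N. *)
Lemma entire_zero (f : C -> C) (c : C) (r : R) : 0 < r ->
  (forall z, Cexd f z) -> (forall z, Cmod (z - c) < r -> f z = 0%C) -> forall a, f a = 0%C.
Proof.
  intros Hr Hf H0 a. destruct (Ceq_dec a c) as [->|Hac].
  { apply H0. replace (c - c)%C with (RtoC 0) by ring. rewrite Cmod_0; auto. }
  assert (D : 0 < Cmod (a - c)) by (apply Cmod_gt_0, Cminus_eq_contra; auto).
  set (d := Cmod (a - c)) in *. set (al := ((a - c) / RtoC (2 * d))%C).
  assert (Hd2 : RtoC (2 * d) <> 0%C) by (intros E; apply RtoC_inj in E; lra).
  assert (Hal : Cmod al < 1).
  { unfold al. rewrite Cmod_div, Cmod_R, Rabs_pos_eq by (auto; lra). fold d.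
    replace (d / (2 * d)) with (/ 2) by (field; lra). lra. }
  assert (Ea : (c + RtoC (2 * d) * al)%C = a) by (unfold al; field; auto).
  pose proof PI_RGT_0 as HPI.
  assert (He : forall y, Cmod (Cexp (0, y)) = 1).
  { intros y. rewrite Cmod_Cexp. apply exp_0. }
  assert (Mod : forall y, Cmod (moebius c (2 * d) al (Cexp (0, y)) - c) = 2 * d).
  { intros y. apply moebius_mod; auto; try lra. rewrite He; lra. }
  destruct (bounded_on_segment (fun y => Cmod (f (moebius c (2 * d) al (Cexp (0, y))))) 0 (2 * PI))
    as [M HM]; [lra| |].
  { intros y _. apply continuity_pt_filterlim.
    apply (continuous_comp (U := R_UniformSpace) (V := C_UniformSpace) (W := R_UniformSpace)
       (fun y => f (moebius c (2 * d) al (Cexp (0, y)))) Cmod); [|apply Cmod_continuous].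
    apply (vert_continuous (fun w => f (moebius c (2 * d) al (Cexp w)))).
    apply Cexd_cont. apply (Cexd_comp f (fun w => moebius c (2 * d) al (Cexp w))); auto.
    apply (Cexd_comp (moebius c (2 * d) al) Cexp). apply Cexd_moebius; auto. rewrite He; lra.
    eexists; apply Cder_Cexp. }
  assert (B : forall N, Cmod (f a) <= M * (/ 2) ^ N).
  (* The numerator vanishes near [c], so [g] is identically 0 there, at [c] too whatever the inverse
     of 0 is. *)
  { intros N. set (g := fun z => (f z / Cpow (z - c) N)%C).
    assert (Hg : forall z, Cexd g z).
    { intros z. destruct (Ceq_dec z c) as [->|Hz].
      - apply (Cexd_ext_loc (fun _ => RtoC 0) g c r Hr); [|apply Cexd_const].
        intros w Hw. unfold g. rewrite (H0 w Hw). unfold Cdiv. ring.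
      - apply Cexd_div; auto. apply Cpow_nz, Cminus_eq_contra; auto.
        apply Cexd_pow. apply Cexd_minus; [apply Cexd_id|apply Cexd_const]. }
    assert (P : 0 < (2 * d) ^ N) by (apply pow_lt; lra).
    assert (Q : 0 < d ^ N) by (apply pow_lt; lra).
    pose proof (moebius_mean_bound g c al (2 * d) (M / (2 * d) ^ N) ltac:(lra) Hal
       ltac:(auto)) as T. rewrite Ea in T.
    assert (T2 : Cmod (g a) <= M / (2 * d) ^ N).
    { apply T. intros y Hy. unfold g. rewrite Cmod_div, Cmod_pow, Mod.
      - apply Rmult_le_compat_r. apply Rlt_le, Rinv_0_lt_compat; auto. apply HM; auto.
      - apply Cpow_nz, Cmod_gt_0. rewrite Mod; lra. }
    unfold g in T2. rewrite Cmod_div, Cmod_pow in T2 by (apply Cpow_nz, Cminus_eq_contra; auto).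
    fold d in T2. apply Rmult_le_compat_r with (r := d ^ N) in T2; [|lra].
    replace (Cmod (f a) / d ^ N * d ^ N) with (Cmod (f a)) in T2 by (field; lra).
    eapply Rle_trans; [exact T2|]. right. rewrite Rpow_mult_distr, pow_inv. field.
    split; apply pow_nonzero; lra. }
  apply Cmod_le_imp_zero. intros e He2.
  destruct (half_pow_lt (Rabs M) e (Rabs_pos M) He2) as [n Hn]. eapply Rle_trans; [apply (B n)|].
  assert (0 < (/2)^n) by (apply pow_lt; lra). pose proof (Rle_abs M). nra.
Qed.

Lemma entire_ext_half_plane (f g : C -> C) (x : R) : entire f -> entire g ->
  (forall s, x < Re s -> f s = g s) -> forall s, f s = g s.
Proof.
  intros Hf Hg H s. apply Ceq_minus.
  apply (entire_zero (fun z => f z - g z)%C (RtoC (x + 1)) 1 Rlt_0_1).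
  - intros z. apply Cexd_minus; auto.
  - intros z Hz. rewrite H. ring.
    pose proof (re_le_Cmod (z - RtoC (x + 1))) as A.
    replace (Re (z - RtoC (x + 1))%C) with (Re z - (x + 1)) in A by reflexivity.
    pose proof (Rle_abs (- (Re z - (x + 1)))) as B. rewrite Rabs_Ropp in B. lra.
Qed.

(** * Residues of the kernel 1 / (nome w - 1) *)

Lemma nome_eq (x y : R) :
  nome (x, y) = (exp (- (2 * PI * y)) * cos (2 * PI * x), exp (- (2 * PI * y)) * sin (2 * PI * x)).
Proof.
  unfold nome, Cexp. replace (2 * PI * Ci * (x, y))%C with (- (2 * PI * y), 2 * PI * x).
  reflexivity. unfold Ci, Cmult, RtoC; simpl. f_equal; ring.
Qed.

Lemma Cmod_nome (w : C) : Cmod (nome w) = exp (- (2 * PI * Im w)).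
Proof.
  unfold nome. rewrite Cmod_Cexp. f_equal. destruct w as [x y].
  unfold Ci, Cmult, RtoC; simpl. ring.
Qed.

Lemma nome_plus (a b : C) : nome (a + b) = (nome a * nome b)%C.
Proof. unfold nome. rewrite <- Cexp_plus. f_equal. ring. Qed.

Lemma nome_0 : nome 0 = 1%C.
Proof. unfold nome. replace (2 * PI * Ci * 0)%C with (RtoC 0) by ring. apply Cexp_0. Qed.

Lemma nome_opp (a : C) : nome (- a) = (/ nome a)%C.
Proof. unfold nome. rewrite <- Cexp_opp. f_equal. ring. Qed.

Lemma nome_nz (a : C) : nome a <> 0%C.
Proof. apply Cexp_nz. Qed.

Lemma nome_INR_mul (n : nat) (a : C) : nome (RtoC (INR n) * a) = Cpow (nome a) n.
Proof. unfold nome. rewrite Cexp_pow. f_equal. ring. Qed.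

Lemma nome_1 : nome 1 = 1%C.
Proof.
  unfold RtoC. rewrite nome_eq, !Rmult_0_r, Ropp_0, exp_0, Rmult_1_r, cos_2PI, sin_2PI.
  unfold RtoC; f_equal; ring.
Qed.

Lemma nome_INR (n : nat) : nome (RtoC (INR n)) = 1%C.
Proof.
  replace (RtoC (INR n)) with (RtoC (INR n) * 1)%C by ring.
  rewrite nome_INR_mul, nome_1. apply Cpow_1_l.
Qed.

Lemma nome_half (x y : R) : x = 1/2 \/ x = -1/2 -> nome (x, y) = RtoC (- exp (- (2 * PI * y))).
Proof.
  intros [->| ->]; rewrite nome_eq.
  - replace (2 * PI * (1/2)) with PI by field. rewrite cos_PI, sin_PI. unfold RtoC; f_equal; ring.
  - replace (2 * PI * (-1/2)) with (- PI) by field.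
    rewrite cos_neg, sin_neg, cos_PI, sin_PI. unfold RtoC; f_equal; ring.
Qed.

Lemma Cexd_nome w : Cexd nome w.
Proof.
  unfold nome. apply Cexd_Cexp, Cexd_mult; [apply Cexd_const|apply Cexd_id].
Qed.

(** Period 1, a simple pole of residue 1 / (2 pi i) at each integer, limit 0 as Im w tends to minus
    infinity and -1 as it tends to plus infinity. *)
Definition ker (w : C) : C := (/ (nome w - 1))%C.

Lemma nome_neq1_im (w : C) : Im w <> 0 -> nome w <> 1%C.
Proof.
  intros H E. apply (f_equal Cmod) in E. rewrite Cmod_nome, Cmod_1, <- exp_0 in E.
  apply exp_inv in E. pose proof PI_RGT_0. apply H. nra.
Qed.

Lemma nome_neq1_strip (w : C) : -1/2 <= Re w <= 1/2 -> w <> 0%C -> nome w <> 1%C.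
Proof.
  intros H Hw. destruct (Req_dec (Im w) 0) as [E|E]; [|apply nome_neq1_im; auto].
  destruct w as [x y]. simpl in H, E. subst y. rewrite nome_eq, Rmult_0_r, Ropp_0, exp_0, !Rmult_1_l.
  intros F. apply (f_equal fst) in F. simpl in F.
  replace (2 * PI * x) with (2 * (PI * x)) in F by ring. rewrite cos_2a_sin in F.
  assert (S : sin (PI * x) = 0) by nra. pose proof PI_RGT_0.
  destruct (Rtotal_order x 0) as [L|[L|L]].
  - assert (0 < sin (- (PI * x))) by (apply sin_gt_0; nra). rewrite sin_neg in H1. lra.
  - apply Hw. subst x. reflexivity.
  - assert (0 < sin (PI * x)) by (apply sin_gt_0; nra). lra.
Qed.

Lemma Cexd_ker (z w : C) : nome (w - z) <> 1%C -> Cexd (fun u => ker (u - z)) w.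
Proof.
  intros H. unfold ker. apply (Cexd_inv (fun u => nome (u - z) - 1)%C).
  - apply Cminus_eq_contra; auto.
  - apply Cexd_minus; [|apply Cexd_const].
    apply (Cexd_comp nome (fun u => u - z)%C). apply Cexd_nome.
    apply Cexd_minus; [apply Cexd_id|apply Cexd_const].
Qed.

Lemma ker_bound_low (w : C) : Im w < 0 -> Cmod (ker w) <= / (exp (- (2 * PI * Im w)) - 1).
Proof.
  intros H. unfold ker. rewrite Cmod_inv by (apply Cminus_eq_contra, nome_neq1_im; lra).
  pose proof PI_RGT_0.
  assert (1 < exp (- (2 * PI * Im w))) by (rewrite <- exp_0; apply exp_increasing; nra).
  apply Rinv_le_contravar; [lra|]. pose proof (Cmod_rev_tri (nome w) 1) as A.
  rewrite Cmod_nome, Cmod_1 in A. exact A.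
Qed.

Lemma ker_bound_high (w : C) : 0 < Im w -> Cmod (ker w) <= / (1 - exp (- (2 * PI * Im w))).
Proof.
  intros H. unfold ker. rewrite Cmod_inv by (apply Cminus_eq_contra, nome_neq1_im; lra).
  pose proof PI_RGT_0.
  assert (exp (- (2 * PI * Im w)) < 1) by (rewrite <- exp_0; apply exp_increasing; nra).
  apply Rinv_le_contravar; [lra|]. pose proof (Cmod_rev_tri 1 (nome w)) as A.
  rewrite Cmod_nome, Cmod_1, Cmod_sub_sym in A. exact A.
Qed.

Lemma Cmod_nome_sub1_half (w : C) : nome w = RtoC (- exp (- (2 * PI * Im w))) ->
  Cmod (nome w - 1) = 1 + exp (- (2 * PI * Im w)).
Proof.
  intros ->. rewrite <- RtoC_minus, Cmod_R, Rabs_left1.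
  ring. pose proof (exp_pos (- (2 * PI * Im w))). lra.
Qed.

Lemma ker_bound_half (w : C) : nome w = RtoC (- exp (- (2 * PI * Im w))) ->
  Cmod (ker w) = / (1 + exp (- (2 * PI * Im w))).
Proof.
  intros H. pose proof (Cmod_nome_sub1_half w H) as E. unfold ker.
  pose proof (exp_pos (- (2 * PI * Im w))).
  rewrite Cmod_inv, E; auto. apply Cmod_gt_0. lra.
Qed.

Lemma nome_period (x y : R) (z : C) : nome (((x + 1/2)%R, y) - z) = nome (((x - 1/2)%R, y) - z).
Proof.
  replace (((x + 1/2)%R, y) - z)%C with ((((x - 1/2)%R, y) - z) + 1)%C.
  rewrite nome_plus, nome_1. ring.
  destruct z as [a b]. unfold Cminus, Cplus, Copp, RtoC; simpl. f_equal; field.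
Qed.

Lemma hint_shift_periodic (F : C -> C) (x y1 y2 : R) : y1 <= y2 ->
  (forall t, F (x + 1/2, t) = F (x - 1/2, t)) ->
  (forall u v, x - 1/2 <= u <= x + 1/2 -> y1 <= v <= y2 -> Cexd F (u, v)) ->
  hint F y1 (x - 1/2) (x + 1/2) = hint F y2 (x - 1/2) (x + 1/2).
Proof.
  intros Hy P Hd. pose proof (goursat F (x - 1/2) (x + 1/2) y1 y2 ltac:(lra) Hy Hd) as G.
  unfold rint in G.
  assert (E : vint F (x + 1/2) y1 y2 = vint F (x - 1/2) y1 y2) by (apply CInt_ext; auto).
  rewrite E in G. apply Ceq_minus. rewrite <- G. ring.
Qed.

Lemma exp_large (M : R) : exists Y, 0 < Y /\ M < exp Y.
Proof.
  exists (Rabs M + 1). pose proof (Rabs_pos M). pose proof (Rle_abs M). split; [lra|].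
  pose proof (exp_ineq1 (Rabs M + 1)). lra.
Qed.

(** The integral over a period does not depend on the height below the pole, and the kernel decays
    there. With the value -1 above the pole this yields the residue without any local
    computation. *)
Lemma hint_ker_low (x y y1 : R) : y1 < y ->
  hint (fun w => ker (w - (x, y))) y1 (x - 1/2) (x + 1/2) = 0%C.
Proof.
  intros Hy. apply Cmod_le_imp_zero. intros e He. pose proof PI_RGT_0.
  destruct (exp_large (1 + / e)) as [Y [HY K]].
  assert (He' : 0 < / e) by (apply Rinv_0_lt_compat; auto).
  assert (Hd : forall u v, v <= y1 -> Cexd (fun w => ker (w - (x, y))) (u, v)).
  { intros u v Hv. apply Cexd_ker, nome_neq1_im. simpl. lra. }
  rewrite <- (hint_shift_periodic _ x (y1 - Y) y1); [|lra| |].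
  - eapply Rle_trans; [apply hint_bound with (M := e); [lra| |]|lra].
    + intros u Hu. apply Cexd_cont, Hd. lra.
    + intros u Hu. eapply Rle_trans; [apply ker_bound_low; simpl; lra|].
      rewrite <- (Rinv_inv e). apply Rinv_le_contravar; auto.
      assert (exp Y <= exp (- (2 * PI * Im ((u, (y1 - Y)%R) - (x, y))))).
      { apply exp_le. simpl. pose proof PI_4. pose proof PI2_1. unfold PI2 in *. nra. }
      lra.
  - intros t. unfold ker. rewrite nome_period. reflexivity.
  - intros u v _ Hv. apply Hd; lra.
Qed.

Lemma ker_succ (w : C) : nome w <> 1%C -> (ker w + 1)%C = (nome w * ker w)%C.
Proof. intros H. unfold ker. field. apply Cminus_eq_contra; auto. Qed.

Lemma hint_ker_high (x y y2 : R) : y < y2 ->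
  hint (fun w => ker (w - (x, y))) y2 (x - 1/2) (x + 1/2) = (- (1))%C.
Proof.
  intros Hy.
  assert (Hd : forall u v, y2 <= v -> Cexd (fun w => ker (w - (x, y))) (u, v)).
  { intros u v Hv. apply Cexd_ker, nome_neq1_im. simpl. lra. }
  assert (E : hint (fun w => ker (w - (x, y)) - - (1))%C y2 (x - 1/2) (x + 1/2) =
     (hint (fun w => ker (w - (x, y))) y2 (x - 1/2) (x + 1/2) + 1)%C).
  { unfold hint. rewrite CInt_minus, CInt_const.
    replace (x + 1/2 - (x - 1/2)) with 1 by field. ring.
    apply (ex_hint (fun w => ker (w - (x, y)))); [lra|]. intros u Hu. apply Cexd_cont, Hd; lra.
    eexists. apply (is_RInt_const (V := C_R_NormedModule)). }
  assert (Z : hint (fun w => ker (w - (x, y)) - - (1))%C y2 (x - 1/2) (x + 1/2) = 0%C).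
  2:{ rewrite Z in E. apply Ceq_minus.
      replace (hint (fun w => ker (w - (x, y))) y2 (x - 1 / 2) (x + 1 / 2) - - (1))%C with
       (hint (fun w => ker (w - (x, y))) y2 (x - 1 / 2) (x + 1 / 2) + 1)%C by ring. auto. }
  apply Cmod_le_imp_zero. intros e He. pose proof PI_RGT_0.
  destruct (exp_large (1 + / e)) as [Y [HY K]].
  assert (He' : 0 < / e) by (apply Rinv_0_lt_compat; auto).
  rewrite (hint_shift_periodic _ x y2 (y2 + Y)); [|lra| |].
  - eapply Rle_trans; [apply hint_bound with (M := e); [lra| |]|lra].
    + intros u Hu. apply Cexd_cont, Cexd_minus; [apply Hd; lra|apply Cexd_const].
    + intros u Hu. set (w := ((u, (y2 + Y)%R) - (x, y))%C).
      assert (HI : Im w = y2 + Y - y) by reflexivity.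
      replace (ker w - - (1))%C with (ker w + 1)%C by ring.
      rewrite ker_succ by (apply nome_neq1_im; lra).
      rewrite Cmod_mult, Cmod_nome.
      set (q := exp (- (2 * PI * Im w))).
      assert (Hq : q * exp Y <= 1).
      { unfold q. rewrite <- exp_plus, <- exp_0. apply exp_le. rewrite HI.
        pose proof PI2_1. unfold PI2 in *. nra. }
      assert (Hq0 : 0 < q) by apply exp_pos.
      pose proof (ker_bound_high w ltac:(lra)) as B. fold q in B.
      assert (q < 1) by nra.
      apply Rle_trans with (q * / (1 - q)). apply Rmult_le_compat_l; lra.
      apply Rmult_le_reg_r with (1 - q); [lra|]. rewrite Rmult_assoc, Rinv_l, Rmult_1_r by lra.
      assert (q * (1 + / e) <= 1) by nra.
      assert (q * (1 + / e) * e <= 1 * e) by (apply Rmult_le_compat_r; lra).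
      replace (q * (1 + / e) * e) with (q * e + q) in H2 by (field; lra). lra.
  - intros t. unfold ker. rewrite nome_period. reflexivity.
  - intros u v _ Hv. apply Cexd_minus; [apply Hd; lra|apply Cexd_const].
Qed.

(** As pi <= 4, |u| <= 1/48 puts 2 pi |u| below 1/6, and half of 2 pi |u| is still at least |u|. *)
Lemma ker_bound_near (u : C) : u <> 0%C -> Cmod u <= 1/48 -> Cmod (ker u) <= / Cmod u.
Proof.
  intros Hu H. apply Cmod_gt_0 in Hu. unfold ker, nome.
  pose proof (Cexp_sub1_lower (2 * PI * Ci * u)) as L.
  pose proof PI_4. pose proof PI_RGT_0. pose proof PI2_1. unfold PI2 in *.
  rewrite !Cmod_mult, Cmod_Ci, !Cmod_R, !Rabs_pos_eq in L by lra.
  specialize (L ltac:(nra)).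
  assert (P : Cmod u <= Cmod (Cexp (2 * PI * Ci * u) - 1)) by nra.
  rewrite Cmod_inv by (apply Cmod_gt_0; lra). apply Rinv_le_contravar; auto.
Qed.

(* Bounded integrands are insensitive to a puncture: shrink a square around it. *)
Lemma goursat_punctured (h : C -> C) (x y x1 x2 y1 y2 r M : R) :
  x1 < x < x2 -> y1 < y < y2 -> 0 < r ->
  (forall u v, x1 <= u <= x2 -> y1 <= v <= y2 -> (u, v) <> (x, y) -> Cexd h (u, v)) ->
  (forall w, w <> (x, y) -> Cmod (w - (x, y)) < r -> Cmod (h w) <= M) ->
  rint h x1 x2 y1 y2 = 0%C.
Proof.
  intros Hx Hy Hr Hd HM. apply Cmod_le_imp_zero. intros e He.
  set (m := Rmin (Rmin (x - x1) (x2 - x)) (Rmin (y - y1) (y2 - y))).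
  assert (Hm : 0 < m) by (repeat apply Rmin_pos; lra).
  assert (Hm1 : m <= x - x1 /\ m <= x2 - x /\ m <= y - y1 /\ m <= y2 - y).
  { unfold m. pose proof (Rmin_l (Rmin (x - x1) (x2 - x)) (Rmin (y - y1) (y2 - y))).
    pose proof (Rmin_r (Rmin (x - x1) (x2 - x)) (Rmin (y - y1) (y2 - y))).
    pose proof (Rmin_l (x - x1) (x2 - x)). pose proof (Rmin_r (x - x1) (x2 - x)).
    pose proof (Rmin_l (y - y1) (y2 - y)). pose proof (Rmin_r (y - y1) (y2 - y)). lra. }
  set (k := e / (8 * (Rabs M + 1))). pose proof (Rabs_pos M).
  assert (Hk : 0 < k) by (apply Rdiv_lt_0_compat; lra).
  set (d := Rmin (Rmin (m / 2) (r / 4)) k).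
  assert (Hd0 : 0 < d) by (repeat apply Rmin_pos; lra).
  assert (Hd1 : d <= m / 2 /\ d <= r / 4 /\ d <= k).
  { unfold d. pose proof (Rmin_l (Rmin (m / 2) (r / 4)) k). pose proof (Rmin_r (Rmin (m / 2) (r / 4)) k).
    pose proof (Rmin_l (m / 2) (r / 4)). pose proof (Rmin_r (m / 2) (r / 4)). lra. }
  assert (N : forall u v, u <> x \/ v <> y -> (u, v) <> (x, y)).
  { intros u v [A|A] E; injection E; auto. }
  assert (Hc : forall u v, x1 <= u <= x2 -> y1 <= v <= y2 -> u <> x \/ v <> y -> Ccont h (u, v)).
  { intros. apply Cexd_cont, Hd; auto. }
  rewrite (rint_split_x h x1 (x - d) x2); try lra; try (intros ? ?; apply Hc; lra).
  rewrite (rint_split_x h (x - d) (x + d) x2); try lra; try (intros ? ?; apply Hc; lra).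
  rewrite (rint_split_y h (x - d) (x + d) y1 (y - d) y2); try lra; try (intros ? ?; apply Hc; lra).
  rewrite (rint_split_y h (x - d) (x + d) (y - d) (y + d) y2); try lra; try (intros ? ?; apply Hc; lra).
  rewrite (goursat h x1 (x - d)); try lra; [|intros; apply Hd; try lra; apply N; lra].
  rewrite (goursat h (x + d) x2); try lra; [|intros; apply Hd; try lra; apply N; lra].
  rewrite (goursat h (x - d) (x + d) y1); try lra; [|intros; apply Hd; try lra; apply N; lra].
  rewrite (goursat h (x - d) (x + d) (y + d)); try lra; [|intros; apply Hd; try lra; apply N; lra].
  replace (0 + (0 + (rint h (x - d) (x + d) (y - d) (y + d) + 0) + 0))%C with
    (rint h (x - d) (x + d) (y - d) (y + d)) by ring.
  eapply Rle_trans.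
  - apply rint_bound with (M := Rabs M + 1); try lra; try (intros ? ?; apply Hc; lra).
    intros u v Hu Hv B. apply Rle_trans with M; [|pose proof (Rle_abs M); lra].
    apply HM. apply N. lra. rewrite pair_sub. eapply Rle_lt_trans; [apply Cmod_le_abs|].
    assert (Rabs (u - x) <= d) by (apply Rabs_le; lra).
    assert (Rabs (v - y) <= d) by (apply Rabs_le; lra). lra.
  - replace (2 * (x + d - (x - d) + (y + d - (y - d))) * (Rabs M + 1)) with (d * (8 * (Rabs M + 1))) by ring.
    apply Rle_trans with (k * (8 * (Rabs M + 1))). apply Rmult_le_compat_r; lra.
    unfold k. right. field. lra.
Qed.

(** Split f = f(z) + (f - f(z)): the constant part reduces to period integrals of the kernel, the
    rest times the kernel is bounded near [z]. Asking only for a Lipschitz bound at [z] admits an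
    [f] defined there by a limit value. *)
Lemma residue_ker (f : C -> C) (x y y1 y2 r B : R) : y1 < y < y2 -> 0 < r ->
  (forall u v, x - 1/2 <= u <= x + 1/2 -> y1 <= v <= y2 -> (u, v) <> (x, y) -> Cexd f (u, v)) ->
  (forall w, Cmod (w - (x, y)) < r -> Cmod (f w - f (x, y)) <= B * Cmod (w - (x, y))) ->
  rint (fun w => f w * ker (w - (x, y)))%C (x - 1/2) (x + 1/2) y1 y2 = f (x, y).
Proof.
  intros Hy Hr Hd HL. set (z := (x, y)) in *.
  assert (N : forall u v, x - 1/2 <= u <= x + 1/2 -> (u, v) <> z -> Cexd (fun w => ker (w - z)) (u, v)).
  { intros u v Hu Hz. apply Cexd_ker, nome_neq1_strip.
    unfold z; simpl; lra. apply Cminus_eq_contra; auto. }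
  assert (Nz : forall u v, u <> x \/ v <> y -> (u, v) <> z).
  { intros u v [A|A] E; injection E; auto. }
  assert (Hf1 : forall u v, x - 1/2 <= u <= x + 1/2 -> y1 <= v <= y2 -> (u, v) <> z ->
     Cexd (fun w => f w * ker (w - z))%C (u, v)).
  { intros. apply Cexd_mult; auto. }
  assert (E : rint (fun w => (f w - f z) * ker (w - z))%C (x - 1/2) (x + 1/2) y1 y2 = 0%C).
  { apply (goursat_punctured _ x y _ _ _ _ (Rmin r (1/48)) (Rabs B)); try lra.
    - apply Rmin_pos; lra.
    - intros u v Hu Hv Hz. apply Cexd_mult; auto. apply Cexd_minus; auto. apply Cexd_const.
    - intros w Hw Hwr. pose proof (Rmin_l r (1/48)). pose proof (Rmin_r r (1/48)).
      assert (P : 0 < Cmod (w - z)) by (apply Cmod_gt_0, Cminus_eq_contra; auto).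
      rewrite Cmod_mult. fold z in Hwr.
      pose proof (ker_bound_near (w - z) ltac:(apply Cmod_gt_0; auto) ltac:(lra)).
      specialize (HL w ltac:(lra)). pose proof (Rle_abs B).
      apply Rle_trans with ((Rabs B * Cmod (w - z)) * / Cmod (w - z)).
      + apply Rmult_le_compat; try apply Cmod_ge_0; auto. nra.
      + right. field. lra. }
  (* Bottom side 0, minus the top side -1, and vertical sides that cancel by periodicity. *)
  assert (R1 : rint (fun w => ker (w - z)) (x - 1/2) (x + 1/2) y1 y2 = 1%C).
  { unfold rint. unfold z. rewrite hint_ker_low, hint_ker_high by lra.
    replace (vint (fun w => ker (w - (x, y))) (x + 1/2) y1 y2) with
       (vint (fun w => ker (w - (x, y))) (x - 1/2) y1 y2).
    ring.
    apply CInt_ext; [lra|]. intros t _. unfold ker. rewrite nome_period. reflexivity. }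
  replace (rint (fun w => (f w - f z) * ker (w - z))%C (x - 1/2) (x + 1/2) y1 y2) with
    (rint (fun w => f w * ker (w - z) - f z * ker (w - z))%C (x - 1/2) (x + 1/2) y1 y2) in E.
  2:{ unfold rint, hint, vint.
      f_equal; [f_equal; apply CInt_ext; try lra; intros; ring|].
      f_equal; f_equal; apply CInt_ext; try lra; intros; ring. }
  rewrite rint_minus in E; try lra;
    try (intros ? ?; apply Cexd_cont, Hf1; [lra|lra|apply Nz; lra]);
    try (intros ? ?; apply Ccont_scal, Cexd_cont, N; [lra|apply Nz; lra]).
  rewrite rint_scal in E; try lra;
    try (intros ? ?; apply Cexd_cont, N; [lra|apply Nz; lra]).
  rewrite R1 in E. apply Ceq_minus. rewrite <- E. ring.
Qed.

(** * Integrals along a Hankel path *)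

(* Integral along the Hankel-type path -1/2 - iT, -1/2 + ib, 1/2 + ib, 1/2 - iT. *)
Definition path_int (b T : R) (F : C -> C) : C :=
  (Ci * vint F (-1/2) (-T) b + hint F b (-1/2) (1/2) - Ci * vint F (1/2) (-T) b)%C.

Definition on_path (b : R) (w : C) : Prop :=
  ((Re w = -1/2 \/ Re w = 1/2) /\ Im w <= b) \/ (-1/2 <= Re w <= 1/2 /\ Im w = b).

Definition path_cont (F : C -> C) (b : R) : Prop := forall w, on_path b w -> Ccont F w.

(** The legs go down, so e^(Im w) is decay; it makes the integral over the infinite path absolutely
    convergent. *)
Definition path_dec (F : C -> C) (b M : R) : Prop :=
  forall w, on_path b w -> Cmod (F w) <= M * exp (Im w).

Lemma path_onV F b x a : path_cont F b -> x = -1/2 \/ x = 1/2 -> onV F x a b.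
Proof. intros H Hx y Hy. apply H. left. simpl. split; auto; lra. Qed.

Lemma path_onH F b : path_cont F b -> onH F b (-1/2) (1/2).
Proof. intros H x Hx. apply H. right. simpl. auto. Qed.

Lemma on_path_low b x y : x = -1/2 \/ x = 1/2 -> y <= b -> on_path b (x, y).
Proof. intros. left. auto. Qed.

Lemma on_path_top b x : -1/2 <= x <= 1/2 -> on_path b (x, b).
Proof. intros. right. auto. Qed.

Lemma vint_bound_exp F x a b M : a <= b -> onV F x a b ->
  (forall y, a <= y <= b -> Cmod (F (x, y)) <= M * exp y) ->
  Cmod (vint F x a b) <= M * (exp b - exp a).
Proof. intros. apply CInt_bound_exp; auto using ex_vint. Qed.

Lemma path_int_bound b T F M : - T <= b -> 0 <= M -> path_cont F b -> path_dec F b M ->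
  Cmod (path_int b T F) <= 3 * M * exp b.
Proof.
  intros HT HM0 Hc Hd. unfold path_int.
  pose proof (vint_bound_exp F (-1/2) (-T) b M HT (path_onV _ _ _ _ Hc (or_introl eq_refl))
    ltac:(intros; apply Hd, on_path_low; auto; lra)) as A.
  pose proof (vint_bound_exp F (1/2) (-T) b M HT (path_onV _ _ _ _ Hc (or_intror eq_refl))
    ltac:(intros; apply Hd, on_path_low; auto; lra)) as B.
  pose proof (hint_bound F b (-1/2) (1/2) (M * exp b) ltac:(lra) (path_onH _ _ Hc)
    ltac:(intros; apply Hd, on_path_top; auto)) as D.
  eapply Rle_trans; [apply Cmod_sub_le|].
  eapply Rle_trans; [apply Rplus_le_compat_r, Cmod_triangle|].
  rewrite !Cmod_mult, Cmod_Ci. pose proof (exp_pos (-T)). nra.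
Qed.

Lemma path_int_tail b T T' F M : - T <= b -> T <= T' -> 0 <= M -> path_cont F b -> path_dec F b M ->
  Cmod (path_int b T' F - path_int b T F) <= 2 * M * exp (- T).
Proof.
  intros HT HT' HM0 Hc Hd. unfold path_int.
  rewrite <- (vint_Chasles F (-1/2) (-T') (-T) b), <- (vint_Chasles F (1/2) (-T') (-T) b);
    try lra; try (apply path_onV; auto; fail).
  pose proof (vint_bound_exp F (-1/2) (-T') (-T) M ltac:(lra)) as A.
  pose proof (vint_bound_exp F (1/2) (-T') (-T) M ltac:(lra)) as B.
  match goal with |- Cmod ?e <= _ =>
    replace e with (Ci * (vint F (-1/2) (-T') (-T) - vint F (1/2) (-T') (-T)))%C by ring end.
  rewrite Cmod_mult, Cmod_Ci. eapply Rle_trans; [apply Rmult_le_compat_l; [lra|apply Cmod_sub_le]|].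
  specialize (A ltac:(intros y Hy; apply Hc, on_path_low; auto; lra)
    ltac:(intros; apply Hd, on_path_low; auto; lra)).
  specialize (B ltac:(intros y Hy; apply Hc, on_path_low; auto; lra)
    ltac:(intros; apply Hd, on_path_low; auto; lra)).
  pose proof (exp_pos (-T')). nra.
Qed.

Lemma exp_neg_lim : is_lim_seq (fun n => exp (- INR n)) 0.
Proof.
  apply is_lim_seq_ext with (fun n => (exp (-1)) ^ n).
  - induction n as [|n IH].
    + simpl. rewrite Ropp_0, exp_0. reflexivity.
    + rewrite S_INR, <- tech_pow_Rmult, IH, <- exp_plus. f_equal. ring.
  - apply is_lim_seq_geom. rewrite Rabs_pos_eq; [|apply Rlt_le, exp_pos].
    rewrite <- exp_0. apply exp_increasing. lra.
Qed.

(** The integral over the infinite path, its legs cut at depths -n; [epsilon] picks the limit, which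
    [path_lim_spec] provides under continuity and decay. *)
Definition path_lim (b : R) (F : C -> C) : C :=
  epsilon (inhabits (RtoC 0)) (Climit (fun n => path_int b (INR n) F)).

Lemma path_lim_spec b F M : 0 <= b -> 0 <= M -> path_cont F b -> path_dec F b M ->
  Climit (fun n => path_int b (INR n) F) (path_lim b F).
Proof.
  intros Hb HM Hc Hd. unfold path_lim; apply epsilon_spec. apply Climit_cauchy. intros e He.
  pose proof exp_neg_lim as L. apply is_lim_seq_spec in L.
  assert (P : 0 < e / (4 * (M + 1))) by (apply Rdiv_lt_0_compat; lra).
  destruct (L (mkposreal _ P)) as [N HN]. exists N.
  assert (K : forall n, (N <= n)%nat -> Cmod (path_int b (INR n) F - path_int b (INR N) F) < e / 2).
  { intros n Hn. eapply Rle_lt_trans.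
    - apply (path_int_tail b (INR N) (INR n) F M); auto. pose proof (pos_INR N); lra.
      apply le_INR; auto.
    - specialize (HN N (le_n N)). simpl in HN. rewrite Rminus_0_r, Rabs_pos_eq in HN
        by (apply Rlt_le, exp_pos). pose proof (exp_pos (- INR N)).
      apply Rmult_lt_compat_l with (r := 2 * (M + 1)) in HN; [|lra].
      replace (2 * (M + 1) * (e / (4 * (M + 1)))) with (e / 2) in HN by (field; lra). nra. }
  intros n m Hn Hm. pose proof (K n Hn). pose proof (K m Hm) as K2. rewrite Cmod_sub_sym in K2.
  pose proof (Cmod_tri3 (path_int b (INR n) F) (path_int b (INR N) F) (path_int b (INR m) F)). lra.
Qed.

Lemma path_lim_unique b F l : Climit (fun n => path_int b (INR n) F) l -> path_lim b F = l.
Proof.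
  intros H. apply (Climit_unique (fun n => path_int b (INR n) F)); auto.
  unfold path_lim; apply epsilon_spec. exists l; auto.
Qed.

Lemma path_lim_bound b F M : 0 <= b -> 0 <= M -> path_cont F b -> path_dec F b M ->
  Cmod (path_lim b F) <= 3 * M * exp b.
Proof.
  intros Hb HM Hc Hd. apply Climit_le with (u := fun n => path_int b (INR n) F).
  - intros n. apply path_int_bound; try assumption. pose proof (pos_INR n); lra.
  - apply path_lim_spec with M; assumption.
Qed.

Lemma path_int_minus b T F G : - T <= b -> path_cont F b -> path_cont G b ->
  path_int b T (fun w => F w - G w)%C = (path_int b T F - path_int b T G)%C.
Proof.
  intros HT HF HG. unfold path_int.
  rewrite (hint_minus F G), (vint_minus F G (-1/2)), (vint_minus F G (1/2));
    try assumption; try lra; try (apply path_onH; assumption);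
    try (apply path_onV; [assumption|auto]).
  ring.
Qed.

Lemma path_int_scal b T c F : - T <= b -> path_cont F b ->
  path_int b T (fun w => c * F w)%C = (c * path_int b T F)%C.
Proof.
  intros HT HF. unfold path_int.
  rewrite (hint_scal c F), (vint_scal c F (-1/2)), (vint_scal c F (1/2));
    try assumption; try lra; try (apply path_onH; assumption);
    try (apply path_onV; [assumption|auto]).
  ring.
Qed.

Lemma path_int_ext b T F G : - T <= b -> (forall w, on_path b w -> F w = G w) ->
  path_int b T F = path_int b T G.
Proof.
  intros HT H. unfold path_int, vint, hint.
  rewrite (CInt_ext (fun y => F (-1/2, y)) (fun y => G (-1/2, y))); auto.
  2:{ intros; apply H, on_path_low; auto; lra. }
  rewrite (CInt_ext (fun y => F (1/2, y)) (fun y => G (1/2, y))); auto.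
  2:{ intros; apply H, on_path_low; auto; lra. }
  rewrite (CInt_ext (fun x => F (x, b)) (fun x => G (x, b))); auto; try lra.
  intros; apply H, on_path_top; auto; lra.
Qed.

Lemma path_lim_minus b F G M N : 0 <= b -> 0 <= M -> 0 <= N ->
  path_cont F b -> path_cont G b -> path_dec F b M -> path_dec G b N ->
  path_lim b (fun w => F w - G w)%C = (path_lim b F - path_lim b G)%C.
Proof.
  intros. apply path_lim_unique.
  apply Climit_ext with (fun n => path_int b (INR n) F - path_int b (INR n) G)%C.
  - intros n. rewrite path_int_minus; auto. pose proof (pos_INR n); lra.
  - apply Climit_minus; [apply path_lim_spec with M|apply path_lim_spec with N]; assumption.
Qed.

Lemma path_lim_scal b c F M : 0 <= b -> 0 <= M -> path_cont F b -> path_dec F b M ->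
  path_lim b (fun w => c * F w)%C = (c * path_lim b F)%C.
Proof.
  intros. apply path_lim_unique.
  apply Climit_ext with (fun n => c * path_int b (INR n) F)%C.
  - intros n. rewrite path_int_scal; auto. pose proof (pos_INR n); lra.
  - apply Climit_scal, path_lim_spec with M; assumption.
Qed.

Lemma path_lim_ext b F G M : 0 <= b -> 0 <= M -> path_cont F b -> path_dec F b M ->
  (forall w, on_path b w -> F w = G w) -> path_lim b F = path_lim b G.
Proof.
  intros Hb HM Hc Hd H. symmetry. apply path_lim_unique.
  apply Climit_ext with (fun n => path_int b (INR n) F).
  - intros n. apply path_int_ext; auto. pose proof (pos_INR n); lra.
  - apply path_lim_spec with M; assumption.
Qed.

(* The difference quotients of [F n] stay uniformly close to [D n], so [D n] is Cauchy. *)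
Lemma Cexd_limit (F : nat -> C -> C) (f : C -> C) (D : nat -> C) (s : C) (M : R) : 0 <= M ->
  (forall h, Cmod h <= 1 -> Climit (fun n => F n (s + h)%C) (f (s + h)%C)) ->
  (forall n h, Cmod h <= 1 ->
     Cmod (F n (s + h)%C - F n s - h * D n) <= M * (Cmod h * Cmod h)) ->
  Cexd f s.
Proof.
  intros HM Hl Hb.
  assert (Hl0 : Climit (fun n => F n s) (f s)).
  { specialize (Hl 0%C). rewrite Cmod_0 in Hl. specialize (Hl ltac:(lra)).
    replace (s + 0)%C with s in Hl by ring. exact Hl. }
  assert (HD : exists d, Climit D d).
  { apply Climit_cauchy. intros e He.
    (* Two remainders of size M t^2 <= e t / 4 and two limit errors of size e t / 8 add up to less
       than e t. *)
    set (t := Rmin 1 (e / (4 * (M + 1)))).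
    assert (Ht : 0 < t) by (apply Rmin_pos; [lra|]; apply Rdiv_lt_0_compat; lra).
    assert (Ht1 : t <= 1) by apply Rmin_l.
    assert (Ht2 : M * t <= e / 4).
    { assert (t <= e / (4 * (M + 1))) by apply Rmin_r.
      apply Rmult_le_compat_l with (r := M + 1) in H; [|lra].
      replace ((M + 1) * (e / (4 * (M + 1)))) with (e / 4) in H by (field; lra). nra. }
    assert (HtC : RtoC t <> 0%C) by (intros E; apply RtoC_inj in E; lra).
    assert (Hm : Cmod t = t) by (rewrite Cmod_R, Rabs_pos_eq; lra).
    pose proof (Climit_minus _ _ _ _ (Hl (RtoC t) ltac:(lra)) Hl0) as L.
    destruct (L (e * t / 8)) as [N HN]; [apply Rdiv_lt_0_compat; nra|]. exists N.
    intros n m Hn Hm2. pose proof (HN n Hn) as A. pose proof (HN m Hm2) as B.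
    rewrite Cmod_sub_sym in B.
    pose proof (Cmod_tri3 (F n (s + t)%C - F n s) (f (s + t)%C - f s) (F m (s + t)%C - F m s)) as T1.
    pose proof (Hb n (RtoC t) ltac:(lra)) as X. pose proof (Hb m (RtoC t) ltac:(lra)) as Y.
    rewrite Hm in X, Y. rewrite Cmod_sub_sym in X.
    pose proof (Cmod_tri3 (t * D n) (F n (s + t)%C - F n s) (F m (s + t)%C - F m s)) as T2.
    pose proof (Cmod_tri3 (t * D n) (F m (s + t)%C - F m s) (t * D m)) as T3.
    assert (Z : Cmod (t * D n - t * D m) < e * t).
    { assert (0 < e * t) by (apply Rmult_lt_0_compat; auto).
      assert (M * t * t <= e / 4 * t) by (apply Rmult_le_compat_r; lra). lra. }
    replace (t * D n - t * D m)%C with (t * (D n - D m))%C in Z by ring.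
    rewrite Cmod_mult, Hm in Z. apply Rmult_lt_reg_l with t; lra. }
  destruct HD as [d HD]. exists d. apply Cder_eps. intros e He.
  assert (P : 0 < e / (M + 1)) by (apply Rdiv_lt_0_compat; lra).
  exists (Rmin 1 (e / (M + 1))). split; [apply Rmin_pos; lra|]. intros w Hw.
  pose proof (Rmin_l 1 (e / (M + 1))). pose proof (Rmin_r 1 (e / (M + 1))).
  set (h := (w - s)%C) in *. replace w with (s + h)%C by (unfold h; ring).
  assert (B : Cmod (f (s + h)%C - f s - d * h) <= M * (Cmod h * Cmod h)).
  { apply Climit_le with (u := fun n => (F n (s + h)%C - F n s - h * D n)%C).
    - intros n. apply Hb. lra.
    - replace (d * h)%C with (h * d)%C by ring.
      apply Climit_minus; [apply Climit_minus; auto; apply Hl; lra|]. apply Climit_scal; auto. }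
  eapply Rle_trans; [exact B|]. pose proof (Cmod_ge_0 h).
  assert (M * Cmod h <= e).
  { assert (X : Cmod h <= e / (M + 1)) by lra.
    apply Rmult_le_compat_l with (r := M + 1) in X; [|lra].
    replace ((M + 1) * (e / (M + 1))) with e in X by (field; lra). nra. }
  nra.
Qed.

(** The 3 absorbs the rest of the second order bound: |l|^2 is at most e^(2 |l|), and e^(|h l|) at
    most e^(|l|). *)
Lemma Cexp_mul_remainder (l s h : C) : Cmod h <= 1 ->
  Cmod (Cexp ((s + h) * l) - Cexp (s * l) - h * (l * Cexp (s * l))) <=
  exp ((Cmod s + 3) * Cmod l) * (Cmod h * Cmod h).
Proof.
  intros Hh.
  replace ((s + h) * l)%C with (s * l + h * l)%C by ring. rewrite Cexp_plus.
  replace (Cexp (s * l) * Cexp (h * l) - Cexp (s * l) - h * (l * Cexp (s * l)))%C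
    with (Cexp (s * l) * (Cexp (h * l) - 1 - h * l))%C by ring.
  rewrite Cmod_mult, Cmod_Cexp. pose proof (Cexp_sub2_bound (h * l)) as B.
  rewrite Cmod_mult in B. pose proof (Cmod_ge_0 h). pose proof (Cmod_ge_0 l).
  set (a := Cmod h) in *. set (x := Cmod l) in *.
  assert (X : x <= exp x). { pose proof (exp_ineq1_le x); lra. }
  assert (E1 : exp (Re (s * l)%C) <= exp (Cmod s * x)).
  { apply exp_le. pose proof (re_le_Cmod (s * l)) as A. rewrite Cmod_mult in A.
    pose proof (Rle_abs (Re (s * l)%C)). fold x in A. lra. }
  assert (E2 : exp (a * x) <= exp x) by (apply exp_le; nra).
  replace (exp ((Cmod s + 3) * x)) with (exp (Cmod s * x) * (exp x * exp x * exp x))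
    by (rewrite <- !exp_plus; f_equal; ring).
  rewrite Rmult_assoc. pose proof (exp_pos (a * x)). pose proof (exp_pos x).
  apply Rmult_le_compat; auto; try apply Cmod_ge_0. apply Rlt_le, exp_pos.
  eapply Rle_trans; [exact B|].
  replace (a * x * (a * x) * exp (a * x)) with (x * x * exp (a * x) * (a * a)) by ring.
  apply Rmult_le_compat_r; [nra|]. apply Rmult_le_compat; try nra.
Qed.

Lemma pw_remainder (w s h : C) : Cmod h <= 1 ->
  Cmod (pw w (s + h) - pw w s - h * (- lg w * pw w s)) <=
  exp ((Cmod s + 3) * Cmod (lg w)) * (Cmod h * Cmod h).
Proof.
  intros Hh. unfold pw. pose proof (Cexp_mul_remainder (- lg w) s h Hh) as R. rewrite Cmod_opp in R.
  replace (- (s + h) * lg w)%C with ((s + h) * - lg w)%C by ring.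
  replace (- s * lg w)%C with (s * - lg w)%C by ring. exact R.
Qed.

Lemma pw_le_exp_lg w s : Cmod (pw w s) <= exp (Cmod s * Cmod (lg w)).
Proof.
  unfold pw. rewrite Cmod_Cexp. apply exp_le.
  pose proof (re_le_Cmod (- s * lg w)) as A. rewrite Cmod_mult, Cmod_opp in A.
  pose proof (Rle_abs (Re (- s * lg w)%C)). lra.
Qed.

Lemma ln_le_sub1 x : 0 < x -> ln x <= x - 1.
Proof.
  intros Hx. pose proof (exp_ineq1_le (ln x)) as H. rewrite exp_ln in H by auto. lra.
Qed.

Lemma on_path_slit b w : 0 < b -> on_path b w -> slit w.
Proof. intros Hb [[[H|H] _]|[_ H]]; apply slit_intro; lra. Qed.

(** Away from 0 the logarithm grows more slowly than any multiple of |w|: for |w| >= 1 use ln x <= x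
    - 1 at x = |w| / (A + 1), otherwise |ln m| bounds it. *)
Lemma lg_bound (A m : R) : 0 <= A -> 0 < m -> exists K, 0 <= K /\
  forall w, m <= Cmod w -> exp (A * Cmod (lg w)) <= K * exp (Cmod w).
Proof.
  intros HA Hm.
  set (K0 := (A + 1) * Rabs (ln (A + 1)) + A * Rabs (ln m) + A * (2 * PI)).
  exists (exp K0). split; [apply Rlt_le, exp_pos|]. intros w Hmw. rewrite <- exp_plus. apply exp_le.
  assert (HL : A * Rabs (ln (Cmod w)) <= Cmod w + (A + 1) * Rabs (ln (A + 1)) + A * Rabs (ln m)).
  { pose proof (Rabs_pos (ln (A + 1))). pose proof (Rabs_pos (ln m)).
    pose proof (Rle_abs (ln (A + 1))).
    destruct (Rle_dec 0 (ln (Cmod w))) as [L|L].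
    - rewrite Rabs_pos_eq by auto.
      pose proof (ln_le_sub1 (Cmod w / (A + 1)) ltac:(apply Rdiv_lt_0_compat; lra)) as X.
      unfold Rdiv in X. rewrite ln_mult, ln_Rinv in X by (try apply Rinv_0_lt_compat; lra).
      apply Rmult_le_compat_l with (r := A + 1) in X; [|lra].
      replace ((A + 1) * (Cmod w * / (A + 1) - 1)) with (Cmod w - (A + 1)) in X by (field; lra).
      assert (0 <= A * Rabs (ln m)) by (apply Rmult_le_pos; auto).
      assert ((A + 1) * ln (A + 1) <= (A + 1) * Rabs (ln (A + 1))) by (apply Rmult_le_compat_l; lra).
      nra.
    - assert (X : ln m <= ln (Cmod w)) by (apply ln_le; auto).
      rewrite (Rabs_left1 (ln (Cmod w))) by lra. rewrite (Rabs_left1 (ln m)) in * by lra.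
      assert (0 <= (A + 1) * Rabs (ln (A + 1))) by (apply Rmult_le_pos; lra).
      assert (A * - ln (Cmod w) <= A * - ln m) by (apply Rmult_le_compat_l; lra).
      pose proof (Cmod_ge_0 w). lra. }
  assert (HG : Cmod (lg w) <= Rabs (ln (Cmod w)) + 2 * PI).
  { eapply Rle_trans; [apply Cmod_le_abs|]. pose proof (larg_bound w). lra. }
  apply Rmult_le_compat_l with (r := A) in HG; auto. unfold K0. lra.
Qed.

(** On the path |w| stays above min(b, 1/2) and below 1/2 + 2b - Im w, so powers of [w] grow at most
    like e^(-Im w) down the legs. *)
Lemma lg_path_bound (A b : R) : 0 <= A -> 0 < b -> exists K, 0 <= K /\
  forall w, on_path b w -> exp (A * Cmod (lg w)) <= K * exp (- Im w).
Proof.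
  intros HA Hb. set (m := Rmin b (1/2)). assert (Hm : 0 < m) by (apply Rmin_pos; lra).
  assert (m <= b) by apply Rmin_l. assert (m <= 1/2) by apply Rmin_r.
  destruct (lg_bound A m HA Hm) as [K [HK0 HK]].
  exists (K * exp (1/2 + 2 * b)). split. apply Rmult_le_pos; auto. apply Rlt_le, exp_pos.
  intros w Hw.
  assert (Hmw : m <= Cmod w).
  { pose proof (re_le_Cmod w) as X. pose proof (im_le_Cmod w) as Y.
    pose proof (Rle_abs (Re w)). pose proof (Rle_abs (Im w)).
    pose proof (Rle_abs (- Re w)) as Z. rewrite Rabs_Ropp in Z.
    destruct Hw as [[[E|E] _]|[_ E]]; lra. }
  assert (Hw2 : Cmod w <= 1/2 + 2 * b - Im w).
  { destruct w as [x y]. eapply Rle_trans; [apply Cmod_le_abs|].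
    destruct Hw as [[E L]|[L E]]; simpl in *.
    - assert (Rabs x <= 1/2) by (apply Rabs_le; destruct E; lra).
      assert (Rabs y <= 2 * b - y) by (apply Rabs_le; lra). lra.
    - assert (Rabs x <= 1/2) by (apply Rabs_le; lra).
      assert (Rabs y <= 2 * b - y) by (apply Rabs_le; lra). lra. }
  eapply Rle_trans; [apply HK, Hmw|]. rewrite Rmult_assoc, <- exp_plus.
  apply Rmult_le_compat_l; auto. apply exp_le. lra.
Qed.

(** Rate 2 leaves e^(Im w) after the growth e^(-Im w) of the power; kernels and exponentials decay
    at rate at least 2 pi. *)
Definition path_dec2 (k : C -> C) (b M : R) : Prop :=
  forall w, on_path b w -> Cmod (k w) <= M * exp (2 * Im w).

Lemma pw_cont w s : slit w -> Ccont (fun u => pw u s) w.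
Proof. intros. apply Cexd_cont, Cexd_pw; auto. Qed.

Lemma Ccont_mult f g z : Ccont f z -> Ccont g z -> Ccont (fun w => f w * g w)%C z.
Proof.
  intros Hf Hg e He. pose proof (Cmod_ge_0 (f z)). pose proof (Cmod_ge_0 (g z)).
  set (k := Rmin 1 (e / (Cmod (f z) + Cmod (g z) + 2))).
  assert (Hk : 0 < k) by (apply Rmin_pos; [lra|]; apply Rdiv_lt_0_compat; lra).
  assert (k <= 1) by apply Rmin_l.
  assert (Hk2 : k * (Cmod (f z) + Cmod (g z) + 2) <= e).
  { assert (X : k <= e / (Cmod (f z) + Cmod (g z) + 2)) by apply Rmin_r.
    apply Rmult_le_compat_r with (r := Cmod (f z) + Cmod (g z) + 2) in X; [|lra].
    replace (e / (Cmod (f z) + Cmod (g z) + 2) * (Cmod (f z) + Cmod (g z) + 2)) with e in X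
      by (field; lra). auto. }
  destruct (Hf k Hk) as [d1 [P1 K1]]. destruct (Hg k Hk) as [d2 [P2 K2]].
  exists (Rmin d1 d2). split; [apply Rmin_pos; auto|]. intros w Hw.
  pose proof (Rmin_l d1 d2). pose proof (Rmin_r d1 d2).
  specialize (K1 w ltac:(lra)). specialize (K2 w ltac:(lra)).
  replace (f w * g w - f z * g z)%C with
    ((f w - f z) * (g w - g z) + f z * (g w - g z) + (f w - f z) * g z)%C by ring.
  eapply Rle_lt_trans; [apply Cmod_triangle|].
  eapply Rle_lt_trans; [apply Rplus_le_compat_r, Cmod_triangle|]. rewrite !Cmod_mult.
  pose proof (Cmod_ge_0 (f w - f z)). pose proof (Cmod_ge_0 (g w - g z)). nra.
Qed.

Lemma path_pw_cont k s b : 0 < b -> path_cont k b -> path_cont (fun w => pw w s * k w)%C b.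
Proof.
  intros Hb Hk w Hw. apply Ccont_mult; auto. apply pw_cont. eapply on_path_slit; eauto.
Qed.

Lemma path_pw_dec s b : 0 < b -> exists K, 0 <= K /\
  forall k M, 0 <= M -> path_dec2 k b M -> path_dec (fun w => pw w s * k w)%C b (K * M).
Proof.
  intros Hb. destruct (lg_path_bound (Cmod s) b (Cmod_ge_0 s) Hb) as [K [HK0 HK]].
  exists K. split; auto. intros k M HM Hk w Hw. rewrite Cmod_mult.
  specialize (HK w Hw). specialize (Hk w Hw). pose proof (pw_le_exp_lg w s).
  replace (K * M * exp (Im w)) with ((K * exp (- Im w)) * (M * exp (2 * Im w))).
  - apply Rmult_le_compat; try apply Cmod_ge_0; lra.
  - replace (exp (Im w)) with (exp (- Im w) * exp (2 * Im w)) by (rewrite <- exp_plus; f_equal; ring). ring.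
Qed.

(** Differentiation under the integral: the truncated integrals have difference quotients within
    O(h) of the integral of -lg w w^(-s) k(w), uniformly in the truncation. *)
Lemma path_lim_pw_entire k b M : 0 < b -> 0 <= M -> path_cont k b -> path_dec2 k b M ->
  forall s, Cexd (fun s => path_lim b (fun w => pw w s * k w)%C) s.
Proof.
  intros Hb HM Hk Hd s.
  destruct (lg_path_bound (Cmod s + 3) b) as [K [HK0 HK]]; auto. { pose proof (Cmod_ge_0 s); lra. }
  assert (Hlg : path_cont lg b) by (intros w Hw; apply lg_cont; eapply on_path_slit; eauto).
  assert (HD : path_cont (fun w => - (1) * (lg w * (pw w s * k w)))%C b).
  { intros w Hw. apply Ccont_scal, Ccont_mult; auto. apply path_pw_cont with (b := b); auto. }
  apply (Cexd_limit (fun n s => path_int b (INR n) (fun w => pw w s * k w)%C) _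
     (fun n => path_int b (INR n) (fun w => - (1) * (lg w * (pw w s * k w)))%C) s (3 * (K * M) * exp b)).
  - pose proof (exp_pos b). assert (0 <= K * M) by (apply Rmult_le_pos; auto). nra.
  - intros h Hh. destruct (path_pw_dec (s + h)%C b Hb) as [K1 [HK1 HK2]].
    apply path_lim_spec with (M := K1 * M); auto; try lra.
    apply Rmult_le_pos; auto. apply path_pw_cont; auto.
  - intros n h Hh. assert (Hn : - INR n <= b) by (pose proof (pos_INR n); lra).
    rewrite <- path_int_minus by (auto; apply path_pw_cont; auto).
    rewrite <- path_int_scal by auto.
    rewrite <- path_int_minus; auto.
    2:{ intros w Hw. apply Ccont_minus; apply path_pw_cont with (b := b); auto. }
    2:{ intros w Hw. apply Ccont_scal, HD; auto. }
    replace (3 * (K * M) * exp b * (Cmod h * Cmod h)) with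
      (3 * (K * M * (Cmod h * Cmod h)) * exp b) by ring.
    pose proof (Cmod_ge_0 h).
    apply path_int_bound; auto.
    + repeat apply Rmult_le_pos; auto.
    + intros w Hw. apply Ccont_minus; [apply Ccont_minus; apply path_pw_cont with (b := b); auto|].
      apply Ccont_scal, HD; auto.
    + intros w Hw.
      replace (pw w (s + h) * k w - pw w s * k w - h * (- (1) * (lg w * (pw w s * k w))))%C with
        ((pw w (s + h) - pw w s - h * (- lg w * pw w s)) * k w)%C by ring.
      rewrite Cmod_mult. pose proof (pw_remainder w s h Hh) as R. specialize (HK w Hw).
      specialize (Hd w Hw).
      replace (K * M * (Cmod h * Cmod h) * exp (Im w)) with
        ((K * exp (- Im w) * (Cmod h * Cmod h)) * (M * exp (2 * Im w))).
      * apply Rmult_le_compat; try apply Cmod_ge_0; auto. eapply Rle_trans; [exact R|].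
        apply Rmult_le_compat_r; auto. nra.
      * replace (exp (Im w)) with (exp (- Im w) * exp (2 * Im w)) by (rewrite <- exp_plus; f_equal; ring). ring.
Qed.

(** * Hankel's integral *)

(* [nat_pow r s] is [r ^ (s - 1)], the coefficient in Lipschitz' formula. *)
Definition nat_pow (r : nat) (s : C) : C := Cexp ((s - 1) * RtoC (ln (INR r))).

(** The function e^(-2 pi i r w); below the real axis the kernel is the sum of these over r >= 1. *)
Definition expk (r : nat) (w : C) : C := nome (- (RtoC (INR r) * w)).

(* [hankel s = (- 2 pi i) ^ s / Gamma s], by Hankel's integral. *)
Definition hankel (s : C) : C := path_lim 1 (fun w => pw w s * expk 1 w)%C.

(* Riemann's contour integral for the sum of all [n ^ (-s)], n <> 0 (arguments 0 and PI). *)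
Definition riemann_int (s : C) : C := path_lim 1 (fun w => pw w s * ker (w - 0))%C.

Lemma Cmod_expk r w : Cmod (expk r w) = exp (2 * PI * INR r * Im w).
Proof.
  unfold expk. rewrite Cmod_nome, im_opp, im_scal_l. f_equal. ring.
Qed.

Lemma Cexd_expk r w : Cexd (expk r) w.
Proof.
  unfold expk. apply (Cexd_comp nome (fun w => - (INR r * w))%C). apply Cexd_nome.
  apply Cexd_opp, Cexd_mult; [apply Cexd_const|apply Cexd_id].
Qed.

Lemma on_path_im b w : on_path b w -> Im w <= b.
Proof. intros [[_ H]|[_ H]]; lra. Qed.

Lemma PI_ge_2 : 2 <= PI.
Proof. pose proof PI2_1. unfold PI2 in *. lra. Qed.

Lemma exp_dec2 (p v b : R) : 2 <= p -> 0 <= b -> v <= b -> exp (p * v) <= exp (p * b) * exp (2 * v).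
Proof. intros. rewrite <- exp_plus. apply exp_le. nra. Qed.

Lemma expk_dec2 r b : (1 <= r)%nat -> 0 <= b -> path_dec2 (expk r) b (exp (2 * PI * INR r * b)).
Proof.
  intros Hr Hb w Hw. rewrite Cmod_expk. apply on_path_im in Hw.
  apply le_INR in Hr. simpl in Hr. pose proof PI_ge_2. apply exp_dec2; auto. nra.
Qed.

Lemma expk_cont r b : path_cont (expk r) b.
Proof. intros w _. apply Cexd_cont, Cexd_expk. Qed.

Lemma hankel_entire : entire hankel.
Proof.
  intros s. apply (path_lim_pw_entire (expk 1) 1 (exp (2 * PI * INR 1 * 1))); try lra.
  apply Rlt_le, exp_pos. apply expk_cont. apply expk_dec2; auto; lra.
Qed.

Lemma path_int_raise F b1 b2 T : - T <= b1 <= b2 ->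
  onV F (-1/2) (-T) b2 -> onV F (1/2) (-T) b2 ->
  path_int b1 T F = (path_int b2 T F + rint F (-1/2) (1/2) b1 b2)%C.
Proof.
  intros HT H1 H2. unfold path_int, rint.
  rewrite <- (vint_Chasles F (-1/2) (-T) b1 b2), <- (vint_Chasles F (1/2) (-T) b1 b2) by auto. ring.
Qed.

(** Between the two heights the integrand is holomorphic, so Cauchy's theorem moves the top side. *)
Lemma path_lim_expk_indep s r b1 b2 : (1 <= r)%nat -> 0 < b1 <= b2 ->
  path_lim b1 (fun w => pw w s * expk r w)%C = path_lim b2 (fun w => pw w s * expk r w)%C.
Proof.
  intros Hr Hb. apply path_lim_unique.
  destruct (path_pw_dec s b2 ltac:(lra)) as [K [HK0 HK]].
  eapply Climit_ext; [|apply (path_lim_spec b2 _ (K * exp (2 * PI * INR r * b2)))]; try lra.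
  - intros n. rewrite (path_int_raise _ b1 b2); [|pose proof (pos_INR n); lra| |].
    + rewrite goursat; try lra. ring. intros x y Hx Hy. apply Cexd_mult; [|apply Cexd_expk].
      apply Cexd_pw, slit_intro. simpl; lra.
    + intros y Hy. apply Ccont_mult; [|apply Cexd_cont, Cexd_expk]. apply pw_cont, slit_intro. simpl; lra.
    + intros y Hy. apply Ccont_mult; [|apply Cexd_cont, Cexd_expk]. apply pw_cont, slit_intro. simpl; lra.
  - apply Rmult_le_pos; auto. apply Rlt_le, exp_pos.
  - apply path_pw_cont; [lra|apply expk_cont].
  - apply HK. apply Rlt_le, exp_pos. apply expk_dec2; auto; lra.
Qed.

Lemma Cder_nome w : Cder nome w (2 * PI * Ci * nome w)%C.
Proof.
  unfold nome. replace (2 * PI * Ci * Cexp (2 * PI * Ci * w))%C with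
    ((0 * w + 2 * PI * Ci * 1) * Cexp (2 * PI * Ci * w))%C by ring.
  apply (Cder_comp Cexp (fun w => 2 * PI * Ci * w)%C). apply Cder_Cexp.
  apply (Cder_mult (fun _ => 2 * PI * Ci)%C (fun w => w)). apply Cder_const. apply Cder_id.
Qed.

Lemma Cder_expk1 w : Cder (expk 1) w (- (2 * PI * Ci) * expk 1 w)%C.
Proof.
  unfold expk. simpl INR.
  replace (- (2 * PI * Ci) * nome (- (1 * w)))%C with
     (- (0 * w + 1 * 1) * (2 * PI * Ci * nome (- (1 * w))))%C by ring.
  apply (Cder_comp nome (fun w => - (1 * w))%C). apply Cder_nome.
  apply Cder_opp. apply (Cder_mult (fun _ => RtoC 1) (fun w => w)). apply Cder_const. apply Cder_id.
Qed.

Lemma path_int_primitive (P F : C -> C) b T : - T <= b -> path_cont F b ->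
  (forall w, on_path b w -> Cder P w (F w)) ->
  path_int b T F = (P ((1/2)%R, (-T)%R) - P ((-1/2)%R, (-T)%R))%C.
Proof.
  intros HT Hc Hd. unfold path_int.
  rewrite (vint_primitive P F (-1/2)), (vint_primitive P F (1/2)), (hint_primitive P F);
    try lra; try (apply path_onV; auto; fail); try (apply path_onH; auto; fail);
    try (intros; apply Hd, on_path_low; auto; lra); try (intros; apply Hd, on_path_top; lra).
  ring.
Qed.

Lemma is_lim_seq_exp_scal K : is_lim_seq (fun n => K * exp (- INR n)) 0.
Proof.
  apply is_lim_seq_scal_0, exp_neg_lim.
Qed.

(** Integration by parts: the derivative of w^(-s) e^(-2 pi i w) has integral 0, because its
    boundary values at the ends of the legs decay. *)
Lemma hankel_rec s : (s * hankel (s + 1))%C = (- (2 * PI * Ci) * hankel s)%C.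
Proof.
  set (P := fun w => (pw w s * expk 1 w)%C).
  set (A := fun w => (- s * (pw w (s + 1) * expk 1 w))%C).
  set (B := fun w => (2 * PI * Ci * (pw w s * expk 1 w))%C).
  assert (E1 : 0 <= exp (2 * PI * INR 1 * 1)) by (apply Rlt_le, exp_pos).
  assert (D1 : path_dec2 (expk 1) 1 (exp (2 * PI * INR 1 * 1))) by (apply expk_dec2; auto; lra).
  assert (C1 : forall s, path_cont (fun w => pw w s * expk 1 w)%C 1).
  { intros. apply path_pw_cont; [lra|apply expk_cont]. }
  destruct (path_pw_dec s 1 ltac:(lra)) as [K [HK0 HK]].
  destruct (path_pw_dec (s + 1)%C 1 ltac:(lra)) as [K' [HK0' HK']].
  specialize (HK _ _ E1 D1). specialize (HK' _ _ E1 D1).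
  assert (L1 : Climit (fun n => path_int 1 (INR n) (fun w => A w - B w)%C)
                 (- s * hankel (s + 1) - 2 * PI * Ci * hankel s)%C).
  { apply Climit_ext with (fun n => - s * path_int 1 (INR n) (fun w => pw w (s+1) * expk 1 w)
       - 2 * PI * Ci * path_int 1 (INR n) (fun w => pw w s * expk 1 w))%C.
    - intros n. assert (- INR n <= 1) by (pose proof (pos_INR n); lra).
      rewrite path_int_minus; auto; try (intros w Hw; apply Ccont_scal, C1; auto).
      unfold A, B. rewrite !path_int_scal; auto.
    - apply Climit_minus; apply Climit_scal;
        [apply path_lim_spec with (K' * exp (2 * PI * INR 1 * 1))
        |apply path_lim_spec with (K * exp (2 * PI * INR 1 * 1))];
        try lra; auto; apply Rmult_le_pos; auto. }
  assert (L2 : Climit (fun n => path_int 1 (INR n) (fun w => A w - B w)%C) 0%C).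
  { apply Climit_zero with (fun n => (2 * (K * exp (2 * PI * INR 1 * 1))) * exp (- INR n));
      [|apply is_lim_seq_exp_scal].
    intros n. assert (Hn : - INR n <= 1) by (pose proof (pos_INR n); lra).
    rewrite (path_int_primitive P); auto.
    - eapply Rle_trans; [apply Cmod_sub_le|].
      pose proof (HK (1/2, - INR n) (on_path_low 1 (1/2) (- INR n) (or_intror eq_refl) Hn)) as X.
      pose proof (HK (-1/2, - INR n) (on_path_low 1 (-1/2) (- INR n) (or_introl eq_refl) Hn)) as Y.
      simpl Im in X, Y. unfold P. lra.
    - intros w Hw. apply Ccont_minus; apply Ccont_scal, C1; auto.
    - intros w Hw. unfold P, A, B.
      replace (- s * (pw w (s + 1) * expk 1 w) - 2 * PI * Ci * (pw w s * expk 1 w))%C with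
        (- s * pw w (s + 1) * expk 1 w + pw w s * (- (2 * PI * Ci) * expk 1 w))%C by ring.
      apply (Cder_mult (fun w => pw w s) (expk 1)). apply Cder_pw. eapply on_path_slit; eauto; lra. apply Cder_expk1. }
  pose proof (Climit_unique _ _ _ L1 L2) as E. apply Ceq_minus.
  transitivity (- (- s * hankel (s + 1) - 2 * PI * Ci * hankel s))%C; [ring|]. rewrite E. ring.
Qed.

Lemma rint_ext f g x1 x2 y1 y2 : x1 <= x2 -> y1 <= y2 ->
  (forall x y, x1 <= x <= x2 -> y1 <= y <= y2 -> (x = x1 \/ x = x2 \/ y = y1 \/ y = y2) ->
     f (x, y) = g (x, y)) -> rint f x1 x2 y1 y2 = rint g x1 x2 y1 y2.
Proof.
  intros Hx Hy H. unfold rint, hint, vint.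
  f_equal; [f_equal|f_equal; f_equal]; apply CInt_ext; auto; intros; apply H; auto; lra.
Qed.

Lemma pw_0 w : pw w 0 = 1%C.
Proof. unfold pw. replace (- 0 * lg w)%C with (RtoC 0) by ring. apply Cexp_0. Qed.

Lemma pw_1 w : slit w -> pw w 1 = (/ w)%C.
Proof.
  intros H. replace (RtoC 1) with (0 + 1)%C by ring. rewrite pw_succ, pw_0 by auto.
  unfold Cdiv. ring.
Qed.

(** At s = 1 the integrand e^(-2 pi i w) / w is single-valued and the path closes up. It equals f(w)
    times the kernel with f(w) = (1 - e^(-2 pi i w)) / w and f(0) = 2 pi i, so [residue_ker]
    applies; the path is clockwise, hence the minus sign. *)
Lemma hankel_1 : hankel 1 = (- (2 * PI * Ci))%C.
Proof.
  set (f := fun w => if Ceq_dec w 0 then (2 * PI * Ci)%C else ((1 - expk 1 w) / w)%C).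
  set (F := fun w => (expk 1 w / w)%C).
  pose proof PI_ge_2 as P2.
  assert (Hn0 : (2 * PI * Ci)%C <> 0%C).
  { apply Cmod_gt_0. rewrite !Cmod_mult, Cmod_Ci, !Cmod_R, !Rabs_pos_eq; lra. }
  assert (R : forall n, rint F (-1/2) (1/2) (- INR (S n)) 1 = (2 * PI * Ci)%C).
  { intros n. pose proof (pos_INR n) as Hn. rewrite S_INR.
    pose proof (residue_ker f 0 0 (- (INR n + 1)) 1 1
      (2 * PI * (2 * PI) * exp (2 * PI)) ltac:(lra) ltac:(lra)) as X.
    replace (0 - 1/2) with (-1/2) in X by field. replace (0 + 1/2) with (1/2) in X by field.
    change (0, 0) with (RtoC 0) in X.
    assert (Ff : forall w : C, w <> RtoC 0 -> f w = ((1 - expk 1 w) / w)%C).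
    { intros w Hw. unfold f. destruct (Ceq_dec w 0) as [E|E]; [elim Hw; exact E|reflexivity]. }
    assert (F0 : f 0%C = (2 * PI * Ci)%C).
    { unfold f. destruct (Ceq_dec 0 0) as [_|N]; [reflexivity|elim N; reflexivity]. }
    rewrite F0 in X. rewrite <- X.
    - apply rint_ext; try lra. intros x y Hx Hy Hb.
      assert (Hz : (x, y) <> RtoC 0).
      { intros E. injection E. intros. lra. }
      unfold F. rewrite Ff by auto.
      assert (Hnm : nome (x, y) <> 1%C) by (apply nome_neq1_strip; auto).
      assert (Hk : ker ((x, y) - 0) = (/ (nome (x, y) - 1))%C).
      { unfold ker. do 3 f_equal. ring. }
      rewrite Hk. unfold expk. simpl INR.
      replace (- (1 * (x, y)))%C with (- (x, y))%C by ring. rewrite nome_opp.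
      field. repeat split; auto using nome_nz, Cminus_eq_contra.
    - intros u v Hu Hv Hz.
      apply (Cexd_ext_loc (fun w => (1 - expk 1 w) / w)%C f _ (Cmod (u, v))).
      + apply Cmod_gt_0; auto.
      + intros w Hw. rewrite Ff; auto. intros E. subst w.
        rewrite Cmod_sub_sym in Hw. replace ((u, v) - 0)%C with (u, v) in Hw by (unfold Cminus, Cplus, Copp, RtoC; simpl; f_equal; ring). lra.
      + apply Cexd_div; auto. apply Cexd_minus; [apply Cexd_const|apply Cexd_expk]. apply Cexd_id.
    - intros w Hw. replace (w - 0)%C with w in * by ring.
      destruct (Ceq_dec w 0) as [E|E].
      + subst w. rewrite F0. replace (2 * PI * Ci - 2 * PI * Ci)%C with (RtoC 0) by ring.
        rewrite Cmod_0. lra.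
      + rewrite Ff by auto. unfold expk, nome. simpl INR.
        replace (2 * PI * Ci * - (1 * w))%C with (- (2 * PI * Ci * w))%C by ring.
        set (v := (- (2 * PI * Ci * w))%C).
        replace ((1 - Cexp v) / w - 2 * PI * Ci)%C with (- (Cexp v - 1 - v) / w)%C
          by (unfold v; field; auto).
        rewrite Cmod_div, Cmod_opp by auto.
        assert (Hv : Cmod v = 2 * PI * Cmod w).
        { unfold v. rewrite Cmod_opp, !Cmod_mult, Cmod_Ci, !Cmod_R, !Rabs_pos_eq by lra. ring. }
        pose proof (Cexp_sub2_bound v) as B. rewrite Hv in B.
        apply Cmod_gt_0 in E. apply Rmult_le_reg_r with (Cmod w); auto.
        unfold Rdiv. rewrite Rmult_assoc, Rinv_l, Rmult_1_r by lra.
        eapply Rle_trans; [exact B|].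
        assert (exp (2 * PI * Cmod w) <= exp (2 * PI)) by (apply exp_le; nra).
        assert (0 <= 2 * PI * Cmod w * (2 * PI * Cmod w)) by nra.
        replace (2 * PI * (2 * PI) * exp (2 * PI) * Cmod w * Cmod w) with
          (2 * PI * Cmod w * (2 * PI * Cmod w) * exp (2 * PI)) by ring.
        apply Rmult_le_compat_l; auto. }
  assert (HF : forall w : C, w <> RtoC 0 -> Cexd F w).
  { intros w Hw. apply Cexd_div; auto. apply Cexd_expk. apply Cexd_id. }
  unfold hankel. apply path_lim_unique. apply (Climit_shift _ _ 1).
  apply (Climit_squeeze _ (fun _ => - (2 * PI * Ci))%C _ (fun n => 1 * exp (- INR n)));
    [|apply is_lim_seq_exp_scal|apply Climit_const].
  intros n. rewrite Nat.add_1_r.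
  - pose proof (pos_INR n) as Hn. specialize (R n). rewrite S_INR in *.
    rewrite (path_int_ext 1 _ _ F); try lra.
    2:{ intros w Hw. unfold F. rewrite pw_1 by (eapply on_path_slit; eauto; lra).
        unfold Cdiv. ring. }
    unfold rint in R. unfold path_int.
    (* The truncated path is the reversed rectangle without its bottom side, so the bottom side is
       the whole error. *)
    match goal with |- Cmod ?e <= _ => replace e with (hint F (- (INR n + 1)) (-1/2) (1/2)) end.
    2:{ rewrite <- R. ring. }
    apply Rle_trans with ((1/2 - -1/2) * exp (- (INR n + 1)));
      [|assert (exp (- (INR n + 1)) <= exp (- INR n)) by (apply exp_le; lra); lra].
    assert (Hnz : forall x, (x, - (INR n + 1)) <> RtoC 0).
    { intros x E. injection E. intros. lra. }
    apply hint_bound; try lra.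
    + intros x Hx. apply Cexd_cont, HF; auto.
    + intros x Hx. unfold F. rewrite Cmod_div, Cmod_expk by auto. simpl INR. simpl Im.
      pose proof (im_le_Cmod (x, - (INR n + 1))) as I. simpl in I.
      rewrite Rabs_Ropp, Rabs_pos_eq in I by lra.
      apply Rle_trans with (exp (2 * PI * 1 * - (INR n + 1)) / 1).
      * apply Rmult_le_compat_l; [apply Rlt_le, exp_pos|]. apply Rinv_le_contravar; lra.
      * unfold Rdiv. rewrite Rinv_1, Rmult_1_r. apply exp_le. nra.
Qed.

(** * Fourier expansion *)

Lemma lg_scal (r : R) (w : C) : 0 < r -> slit w -> lg (RtoC r * w) = (RtoC (ln r) + lg w)%C.
Proof.
  intros Hr Hw. pose proof (slit_nz w Hw) as P. unfold slit in Hw.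
  unfold lg, larg. rewrite Cmod_mult, Cmod_R, (Rabs_pos_eq r), re_scal_l, im_scal_l, ln_mult by lra.
  replace (r * Cmod w + r * Im w) with (r * (Cmod w + Im w)) by ring.
  replace (- (r * Re w) / (r * (Cmod w + Im w))) with (- Re w / (Cmod w + Im w)) by (field; split; lra).
  unfold RtoC, Cplus; simpl. f_equal. ring.
Qed.

(** r^s is split as r times r^(s-1): the factor r becomes the Jacobian of the dilation of the path
    by r. *)
Lemma pw_scal (r : nat) (w s : C) : (1 <= r)%nat -> slit w ->
  pw w s = (RtoC (INR r) * nat_pow r s * pw (RtoC (INR r) * w) s)%C.
Proof.
  intros Hr Hw. apply le_INR in Hr. simpl in Hr. unfold pw, nat_pow. rewrite lg_scal by (auto; lra).
  assert (E : RtoC (INR r) = Cexp (RtoC (ln (INR r)))).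
  { unfold Cexp; simpl. rewrite exp_ln, cos_0, sin_0 by lra. unfold RtoC; f_equal; ring. }
  rewrite E at 1. rewrite <- !Cexp_plus. f_equal. ring.
Qed.

Lemma RtoC_mul_pair (r x y : R) : (RtoC r * (x, y))%C = ((r * x)%R, (r * y)%R).
Proof. unfold Cmult, RtoC; simpl. f_equal; ring. Qed.

Lemma vint_dilate (G : C -> C) (c : C) (r x a b : R) : 0 < r -> a <= b ->
  onV G (r * x) (r * a) (r * b) ->
  vint (fun w => RtoC r * c * G (RtoC r * w))%C x a b = (c * vint G (r * x) (r * a) (r * b))%C.
Proof.
  intros Hr Hab Hc.
  assert (E : ex_CInt (fun t => G ((r * x)%R, t)) (r * a + 0) (r * b + 0)).
  { rewrite !Rplus_0_r. apply ex_vint; auto. nra. }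
  pose proof (ex_RInt_comp_lin (V := C_R_NormedModule) (fun t => G ((r * x)%R, t)) r 0 a b E) as E2.
  pose proof (RInt_comp_lin (V := C_R_CompleteNormedModule) (fun t => G ((r * x)%R, t)) r 0 a b E) as L.
  rewrite !Rplus_0_r in L. unfold vint. rewrite <- L.
  rewrite <- (CInt_scal c) by exact E2. apply CInt_ext; auto. intros t _.
  rewrite scal_R_Cmult, RtoC_mul_pair, Rplus_0_r. ring.
Qed.

Lemma hint_dilate (G : C -> C) (c : C) (r y a b : R) : 0 < r -> a <= b ->
  onH G (r * y) (r * a) (r * b) ->
  hint (fun w => RtoC r * c * G (RtoC r * w))%C y a b = (c * hint G (r * y) (r * a) (r * b))%C.
Proof.
  intros Hr Hab Hc.
  assert (E : ex_CInt (fun t => G (t, (r * y)%R)) (r * a + 0) (r * b + 0)).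
  { rewrite !Rplus_0_r. apply ex_hint; auto. nra. }
  pose proof (ex_RInt_comp_lin (V := C_R_NormedModule) (fun t => G (t, (r * y)%R)) r 0 a b E) as E2.
  pose proof (RInt_comp_lin (V := C_R_CompleteNormedModule) (fun t => G (t, (r * y)%R)) r 0 a b E) as L.
  rewrite !Rplus_0_r in L. unfold hint. rewrite <- L.
  rewrite <- (CInt_scal c) by exact E2. apply CInt_ext; auto. intros t _.
  rewrite scal_R_Cmult, RtoC_mul_pair, Rplus_0_r. ring.
Qed.

Lemma expk_scal r w : expk r w = expk 1 (RtoC (INR r) * w)%C.
Proof. unfold expk. simpl INR. f_equal. ring. Qed.

(* The dilated path [r * path] is moved back to the path by Cauchy's theorem. *)
Lemma path_int_dilate (G : C -> C) (c : C) (r b T : R) : 1 <= r -> 0 < b -> 0 <= T ->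
  (forall x y, (x <= -1/2 \/ 1/2 <= x \/ b <= y) -> Cexd G (x, y)) ->
  path_int b T (fun w => RtoC r * c * G (RtoC r * w))%C =
  (c * (path_int (r * b) (r * T) G
        + (hint G (- (r * T)) (- (r / 2)) (-1/2) + hint G (- (r * T)) (1/2) (r / 2))))%C.
Proof.
  intros Hr Hb HT Hd.
  assert (Hc : forall x y, (x <= -1/2 \/ 1/2 <= x \/ b <= y) -> Ccont G (x, y)).
  { intros. apply Cexd_cont; auto. }
  assert (HrT : 0 <= r * T) by (apply Rmult_le_pos; lra). assert (Hrb : b <= r * b) by nra.
  unfold path_int.
  rewrite (vint_dilate G c r (-1/2)); [|lra|lra|intros y Hy; apply Hc; lra].
  rewrite (vint_dilate G c r (1/2)); [|lra|lra|intros y Hy; apply Hc; lra].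
  rewrite (hint_dilate G c r b); [|lra|lra|intros y Hy; apply Hc; lra].
  replace (r * (-1/2)) with (- (r / 2)) by field. replace (r * (1/2)) with (r / 2) by field.
  replace (r * - T) with (- (r * T)) by ring.
  pose proof (goursat G (- (r/2)) (-1/2) (- (r * T)) (r * b) ltac:(lra) ltac:(lra)
    ltac:(intros; apply Hd; lra)) as L.
  pose proof (goursat G (1/2) (r/2) (- (r * T)) (r * b) ltac:(lra) ltac:(lra)
    ltac:(intros; apply Hd; lra)) as R.
  unfold rint in L, R.
  rewrite <- (hint_Chasles G (r * b) (- (r/2)) (-1/2) (r/2)); [|lra|intros x Hx; apply Hc; lra].
  rewrite <- (hint_Chasles G (r * b) (-1/2) (1/2) (r/2)); [|lra|intros x Hx; apply Hc; lra].
  apply Ceq_minus.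
  match type of L with ?l = _ => match type of R with ?r = _ =>
    transitivity (- (c * (l + r)))%C; [ring|] end end.
  rewrite L, R. ring.
Qed.

(** Substituting r w for [w] turns e^(-2 pi i r w) into e^(-2 pi i w) and pulls out r^(s-1), up to
    moving the dilated path back. *)
Lemma path_lim_expk s r : (1 <= r)%nat ->
  path_lim 1 (fun w => pw w s * expk r w)%C = (nat_pow r s * hankel s)%C.
Proof.
  intros Hr. pose proof Hr as Hr'. apply le_INR in Hr'. simpl in Hr'. set (x := INR r) in *.
  set (G := fun w => (pw w s * expk 1 w)%C).
  assert (HG : forall u v, (u <= -1/2 \/ 1/2 <= u \/ 1 <= v) -> Cexd G (u, v)).
  { intros u v H. apply Cexd_mult; [|apply Cexd_expk]. apply Cexd_pw, slit_intro. simpl; lra. }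
  (* The dilation by [x] raises the top side from height 1 to height [x], so Hankel's integral is
     taken at that height. *)
  unfold hankel. rewrite (path_lim_expk_indep s 1 1 x); auto; try lra. fold G.
  apply path_lim_unique.
  apply Climit_ext with (fun n => nat_pow r s * (path_int x (INR (r * n)) G
     + (hint G (- (x * INR n)) (- (x/2)) (-1/2) + hint G (- (x * INR n)) (1/2) (x/2))))%C.
  { intros n. pose proof (pos_INR n).
    rewrite (path_int_ext 1 (INR n) _ (fun w => x * nat_pow r s * G (x * w))%C); [|lra|].
    - rewrite (path_int_dilate G); auto; try lra. rewrite Rmult_1_r, mult_INR. reflexivity.
    - intros w Hw. unfold G. rewrite (pw_scal r w s), (expk_scal r); auto.
      fold x. ring. eapply on_path_slit; eauto; lra. }
  replace (nat_pow r s * path_lim x G)%C with (nat_pow r s * (path_lim x G + 0))%C by ring.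
  apply Climit_scal, Climit_plus.
  - apply (Climit_subseq (fun n => path_int x (INR n) G) _ (fun n => (r * n)%nat)).
    { intros n. nia. }
    destruct (path_pw_dec s x ltac:(lra)) as [K [HK0 HK]].
    apply path_lim_spec with (K * exp (2 * PI * INR 1 * x)); try lra.
    + apply Rmult_le_pos; auto. apply Rlt_le, exp_pos.
    + apply path_pw_cont; [lra|apply expk_cont].
    + apply HK. apply Rlt_le, exp_pos. apply expk_dec2; auto; lra.
  (* The bottom segments joining the legs at distance x / 2 to those at 1/2 vanish in the limit:
     they have fixed length, and the exponential beats the power. *)
  - destruct (lg_bound (Cmod s) (1/2) (Cmod_ge_0 s) ltac:(lra)) as [K [HK0 HK]].
    apply Climit_zero with (fun n => (x * K * exp x) * exp (- INR n)); [|apply is_lim_seq_exp_scal].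
    intros n. pose proof (pos_INR n).
    assert (HxN : 0 <= x * INR n) by (apply Rmult_le_pos; lra).
    assert (B : forall u, (u <= -1/2 \/ 1/2 <= u) -> - (x/2) <= u <= x / 2 ->
       Cmod (G (u, - (x * INR n))) <= K * exp x * exp (- INR n)).
    { intros u Hu Hu2. unfold G. rewrite Cmod_mult, Cmod_expk. simpl INR. simpl Im.
      set (w := (u, - (x * INR n))).
      assert (M1 : 1/2 <= Cmod w).
      { pose proof (re_le_Cmod w) as X. simpl in X. pose proof (Rle_abs u).
        pose proof (Rle_abs (- u)). rewrite Rabs_Ropp in H1. lra. }
      assert (M2 : Cmod w <= x / 2 + x * INR n).
      { eapply Rle_trans; [apply Cmod_le_abs|]. rewrite Rabs_Ropp, (Rabs_pos_eq (x * INR n)) by auto.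
        assert (Rabs u <= x/2) by (apply Rabs_le; lra). lra. }
      pose proof (pw_le_exp_lg w s) as P1. specialize (HK w M1). pose proof PI_ge_2.
      assert (P2 : Cmod (pw w s) <= K * exp (x / 2 + x * INR n)).
      { eapply Rle_trans; [exact P1|]. eapply Rle_trans; [exact HK|].
        apply Rmult_le_compat_l; auto. apply exp_le; auto. }
      apply Rle_trans with (K * exp (x / 2 + x * INR n) * exp (2 * PI * 1 * - (x * INR n))).
      - apply Rmult_le_compat_r; auto. apply Rlt_le, exp_pos.
      - rewrite !Rmult_assoc, <- !exp_plus. apply Rmult_le_compat_l; auto. apply exp_le.
        assert (INR n <= x * INR n) by nra. nra. }
    eapply Rle_trans; [apply Cmod_triangle|].
    pose proof (hint_bound G (- (x * INR n)) (- (x/2)) (-1/2) _ ltac:(lra)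
      ltac:(intros u Hu; apply Cexd_cont, HG; lra) ltac:(intros u Hu; apply B; lra)).
    pose proof (hint_bound G (- (x * INR n)) (1/2) (x/2) _ ltac:(lra)
      ltac:(intros u Hu; apply Cexd_cont, HG; lra) ltac:(intros u Hu; apply B; lra)).
    assert (0 <= K * exp x * exp (- INR n)).
    { apply Rmult_le_pos; [apply Rmult_le_pos; auto|]; apply Rlt_le, exp_pos. }
    nra.
Qed.

Fixpoint csum (f : nat -> C) (n : nat) : C :=
  match n with O => RtoC 0 | S m => (csum f m + f m)%C end.

Lemma csum_ext f g n : (forall i, (i < n)%nat -> f i = g i) -> csum f n = csum g n.
Proof.
  induction n; intros H; simpl; auto. rewrite IHn, H by auto with arith. reflexivity.
Qed.

(** The path stays at least Im z - b below the row of poles, so |nome| >= k > 1 and 1 / (X - 1) <=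
    (k / (k - 1)) / X for X >= k. The factor depending on [n] sends the remainder of the expansion
    to 0. *)
Lemma ker_low_dec2 (z : C) (b : R) : 0 <= b < Im z -> exists M, 0 <= M /\ forall n : nat,
  path_dec2 (fun w => expk n (w - z) * ker (w - z))%C b (M * exp (- (2 * PI * INR n * (Im z - b)))).
Proof.
  intros Hb. pose proof PI_ge_2 as HP.
  set (k := exp (2 * PI * (Im z - b))).
  assert (Hk : 1 < k) by (unfold k; rewrite <- exp_0; apply exp_increasing; nra).
  exists (k / (k - 1) * exp (2 * PI * b)). split.
  { apply Rmult_le_pos; [|apply Rlt_le, exp_pos]. apply Rlt_le, Rdiv_lt_0_compat; lra. }
  intros n w Hw. apply on_path_im in Hw. rewrite Cmod_mult, Cmod_expk.
  assert (HI : Im (w - z)%C = Im w - Im z) by reflexivity. rewrite HI.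
  pose proof (ker_bound_low (w - z) ltac:(rewrite HI; lra)) as B. rewrite HI in B.
  set (X := exp (- (2 * PI * (Im w - Im z)))) in *.
  assert (HX : k <= X) by (apply exp_le; nra).
  assert (B2 : Cmod (ker (w - z)) <= k / (k - 1) * / X).
  { eapply Rle_trans; [exact B|]. apply Rmult_le_reg_r with ((X - 1) * X); [nra|].
    replace (/ (X - 1) * ((X - 1) * X)) with X by (field; lra).
    replace (k / (k - 1) * / X * ((X - 1) * X)) with (k * (X - 1) / (k - 1)) by (field; lra).
    apply Rmult_le_reg_r with (k - 1); [lra|].
    replace (k * (X - 1) / (k - 1) * (k - 1)) with (k * (X - 1)) by (field; lra). nra. }
  assert (B3 : / X <= exp (2 * PI * b) * exp (2 * Im w)).
  { unfold X. rewrite <- exp_Ropp, <- exp_plus. apply exp_le. nra. }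
  assert (B4 : exp (2 * PI * INR n * (Im w - Im z)) <= exp (- (2 * PI * INR n * (Im z - b)))).
  { apply exp_le. pose proof (pos_INR n). assert (0 <= 2 * PI * INR n) by nra. nra. }
  assert (0 < k / (k - 1)) by (apply Rdiv_lt_0_compat; lra).
  replace (k / (k - 1) * exp (2 * PI * b) * exp (- (2 * PI * INR n * (Im z - b))) * exp (2 * Im w))
   with (exp (- (2 * PI * INR n * (Im z - b))) * (k / (k - 1) * (exp (2 * PI * b) * exp (2 * Im w)))) by ring.
  apply Rmult_le_compat; auto. apply Rlt_le, exp_pos. apply Cmod_ge_0.
  eapply Rle_trans; [exact B2|]. apply Rmult_le_compat_l; lra.
Qed.

Lemma ker_low_cont (z : C) (b : R) n : b < Im z ->
  path_cont (fun w => expk n (w - z) * ker (w - z))%C b.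
Proof.
  intros Hb w Hw. apply on_path_im in Hw. apply Cexd_cont, Cexd_mult.
  - apply (Cexd_comp (expk n) (fun w => w - z)%C). apply Cexd_expk.
    apply Cexd_minus; [apply Cexd_id|apply Cexd_const].
  - apply Cexd_ker, nome_neq1_im. replace (Im (w - z)%C) with (Im w - Im z) by reflexivity. lra.
Qed.

(** The geometric expansion of the kernel in telescoping form: the remainder after [n] terms is
    [expk n] times the kernel. *)
Lemma expk_ker_step (u : C) n : nome u <> 1%C ->
  (expk n u * ker u - expk (S n) u * ker u)%C = expk (S n) u.
Proof.
  intros H. unfold expk, ker. rewrite S_INR, RtoC_plus.
  replace (- ((INR n + 1) * u))%C with (- (INR n * u) + - u)%C by ring.
  rewrite nome_plus, (nome_opp u). field. split; [apply nome_nz|apply Cminus_eq_contra; auto].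
Qed.

Lemma expk_sub n w z : expk n (w - z)%C = (nome (RtoC (INR n) * z) * expk n w)%C.
Proof. unfold expk. rewrite <- nome_plus. f_equal. ring. Qed.

Lemma expk_0 w : expk 0 w = 1%C.
Proof. unfold expk. simpl. replace (- (0 * w))%C with (RtoC 0) by ring. apply nome_0. Qed.

Definition fourier_term (s z : C) (i : nat) : C :=
  (nome (RtoC (INR (S i)) * z) * nat_pow (S i) s * hankel s)%C.

(** The integrals [I n] of the remainders telescope: each difference is one Fourier term, evaluated
    by [path_lim_expk], and [I n] decays geometrically. *)
Lemma fourier (s z : C) (b : R) : 0 < b <= 1 -> b < Im z ->
  Climit (csum (fourier_term s z)) (path_lim b (fun w => pw w s * ker (w - z))%C).
Proof.
  intros Hb Hz.
  destruct (ker_low_dec2 z b ltac:(lra)) as [M [HM0 HM]].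
  destruct (path_pw_dec s b ltac:(lra)) as [K [HK0 HK]].
  set (I := fun n => path_lim b (fun w => pw w s * (expk n (w - z) * ker (w - z)))%C).
  assert (P : forall n, 0 <= M * exp (- (2 * PI * INR n * (Im z - b)))).
  { intros n. apply Rmult_le_pos; auto. apply Rlt_le, exp_pos. }
  assert (Ct : forall n, path_cont (fun w => pw w s * (expk n (w - z) * ker (w - z)))%C b).
  { intros n. apply path_pw_cont; [lra|]. apply ker_low_cont; auto. }
  assert (Dt : forall n, path_dec (fun w => pw w s * (expk n (w - z) * ker (w - z)))%C b
     (K * (M * exp (- (2 * PI * INR n * (Im z - b)))))).
  { intros n. apply HK; auto. }
  assert (Step : forall n, (I n - I (S n))%C = fourier_term s z n).
  { intros n. unfold I. erewrite <- path_lim_minus; [|lra| | |apply Ct|apply Ct|apply Dt|apply Dt];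
      try (apply Rmult_le_pos; auto).
    set (c := nome (INR (S n) * z)).
    transitivity (path_lim b (fun w => c * (pw w s * expk (S n) w))%C).
    - apply path_lim_ext with (K * (M * exp (- (2 * PI * INR n * (Im z - b))))
         + K * (M * exp (- (2 * PI * INR (S n) * (Im z - b))))); try lra.
      + apply Rplus_le_le_0_compat; apply Rmult_le_pos; auto.
      + intros w Hw. apply Ccont_minus; apply Ct; auto.
      + intros w Hw. eapply Rle_trans; [apply Cmod_sub_le|]. rewrite Rmult_plus_distr_r.
        apply Rplus_le_compat; apply Dt; auto.
      + intros w Hw. apply on_path_im in Hw.
        replace (pw w s * (expk n (w - z) * ker (w - z)) - pw w s * (expk (S n) (w - z) * ker (w - z)))%C
          with (pw w s * (expk n (w - z) * ker (w - z) - expk (S n) (w - z) * ker (w - z)))%C by ring.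
        rewrite expk_ker_step, expk_sub. fold c. ring.
        apply nome_neq1_im. replace (Im (w - z)%C) with (Im w - Im z) by reflexivity. lra.
    - assert (E2 : 0 <= exp (2 * PI * INR (S n) * b)) by (apply Rlt_le, exp_pos).
      rewrite path_lim_scal with (M := K * exp (2 * PI * INR (S n) * b)); try lra.
      + rewrite (path_lim_expk_indep s (S n) b 1) by (try lia; lra).
        rewrite path_lim_expk by lia. unfold fourier_term. fold c. ring.
      + apply Rmult_le_pos; auto.
      + apply path_pw_cont; [lra|apply expk_cont].
      + apply HK; auto. apply expk_dec2; [lia|lra]. }
  assert (Tel : forall n, csum (fourier_term s z) n = (I O - I n)%C).
  { induction n; simpl. ring. rewrite IHn, <- Step. ring. }
  assert (E0 : I O = path_lim b (fun w => pw w s * ker (w - z))%C).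
  { unfold I. eapply path_lim_ext; [lra| |apply Ct|apply Dt|].
    apply Rmult_le_pos; auto. intros w _. rewrite expk_0. ring. }
  apply Climit_ext with (fun n => I O - I n)%C. { intros; rewrite Tel; reflexivity. }
  replace (path_lim b (fun w => pw w s * ker (w - z))%C) with (I O - 0)%C by (rewrite <- E0; ring).
  apply Climit_minus; [apply Climit_const|].
  set (q := exp (- (2 * PI * (Im z - b)))).
  apply Climit_zero with (fun n => 3 * (K * M) * exp b * q ^ n).
  - intros n. eapply Rle_trans.
    + apply (path_lim_bound b (fun w => pw w s * (expk n (w - z) * ker (w - z)))%C
        (K * (M * exp (- (2 * PI * INR n * (Im z - b)))))); auto; try lra.
      apply Rmult_le_pos; auto.
    + right. replace (exp (- (2 * PI * INR n * (Im z - b)))) with (q ^ n). ring.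
      unfold q. clear. induction n. simpl. rewrite <- exp_0. f_equal. ring.
      rewrite S_INR, <- tech_pow_Rmult, IHn, <- exp_plus. f_equal. ring.
  - apply is_lim_seq_scal_0, is_lim_seq_geom. unfold q.
    rewrite Rabs_pos_eq by (apply Rlt_le, exp_pos). rewrite <- exp_0. apply exp_increasing.
    pose proof PI_ge_2. nra.
Qed.

(** * Sums over a row of the lattice *)

Lemma Cder_lipschitz f z d : Cder f z d -> exists r B, 0 < r /\
  forall w, Cmod (w - z) < r -> Cmod (f w - f z) <= B * Cmod (w - z).
Proof.
  intros H. apply Cder_eps with (eps := 1) in H; [|lra]. destruct H as [r [Hr K]].
  exists r, (Cmod d + 1). split; auto. intros w Hw. specialize (K w Hw).
  replace (f w - f z)%C with ((f w - f z - d * (w - z)) + d * (w - z))%C by ring.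
  eapply Rle_trans; [apply Cmod_triangle|]. rewrite Cmod_mult. lra.
Qed.

Lemma nome_shift_Z (a : C) (m n : nat) : nome (a - RtoC (INR m - INR n)) = nome a.
Proof.
  replace (a - RtoC (INR m - INR n))%C with (a + (- INR m + INR n))%C
    by (rewrite RtoC_minus; ring).
  rewrite !nome_plus, nome_opp, !nome_INR. field.
Qed.

Lemma rint_degenerate f x y1 y2 : rint f x x y1 y2 = 0%C.
Proof.
  unfold rint, hint.
  assert (E : forall g, CInt g x x = RtoC 0).
  { intros g. apply (@RInt_point C_R_CompleteNormedModule). }
  rewrite !E. ring.
Qed.

(** The box is cut into unit-width rectangles centred at the poles z + (j - N); periodicity moves
    each kernel to its own pole, where [residue_ker] gives one term. *)
Lemma strip_sum (s z : C) (b Y : R) (N m : nat) : 0 < b < Im z -> Im z < Y ->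
  rint (fun w => pw w s * ker (w - z))%C (Re z - INR N - 1/2) (Re z - INR N - 1/2 + INR m) b Y
  = csum (fun j => pw (z + RtoC (INR j - INR N)) s) m.
Proof.
  intros Hb HY. set (F := fun w => (pw w s * ker (w - z))%C).
  assert (HF : forall x y, 0 < y -> y <> Im z -> Ccont F (x, y)).
  { intros x y Hy Hne. apply Cexd_cont, Cexd_mult. apply Cexd_pw, slit_intro; simpl; lra.
    apply Cexd_ker, nome_neq1_im. simpl. intros E. apply Hne. unfold Im. lra. }
  induction m.
  - simpl INR. rewrite Rplus_0_r. apply rint_degenerate.
  - rewrite S_INR. pose proof (pos_INR m).
    rewrite (rint_split_x F _ (Re z - INR N - 1/2 + INR m)); try lra;
      try (intros ? ?; apply HF; lra).
    rewrite IHm. simpl csum. f_equal.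
    set (x := Re z + (INR m - INR N)).
    replace (Re z - INR N - 1/2 + INR m) with (x - 1/2) by (unfold x; ring).
    replace (Re z - INR N - 1/2 + (INR m + 1)) with (x + 1/2) by (unfold x; field).
    assert (Ez : (z + RtoC (INR m - INR N))%C = (x, Im z)).
    { destruct z as [p q]. unfold x, Cplus, RtoC; simpl. f_equal; ring. }
    rewrite Ez.
    assert (Hs : forall u v, b <= v <= Y -> slit (u, v)) by (intros; apply slit_intro; simpl; lra).
    destruct (Cder_lipschitz (fun w => pw w s) (x, Im z) _ (Cder_pw (x, Im z) s (Hs x (Im z) ltac:(lra))))
      as [r [B [Hr HB]]].
    transitivity (rint (fun w => pw w s * ker (w - (x, Im z)))%C (x - 1/2) (x + 1/2) b Y).
    + apply rint_ext; try lra. intros. unfold F, ker. rewrite <- Ez.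
      replace ((x0, y) - (z + RtoC (INR m - INR N)))%C with ((x0, y) - z - RtoC (INR m - INR N))%C by ring.
      rewrite nome_shift_Z. reflexivity.
    + apply (residue_ker (fun w => pw w s) x (Im z) b Y r B); auto; try lra.
      intros u v _ Hv _. apply Cexd_pw; auto.
Qed.

Lemma exp_ge_2 x : 1 <= x -> 2 <= exp x.
Proof. intros H. pose proof (exp_ineq1 x ltac:(lra)). lra. Qed.

Lemma nome_side (x v : R) (n : nat) : x = 1/2 + INR n \/ x = - (1/2) - INR n ->
  nome (x, v) = RtoC (- exp (- (2 * PI * v))).
Proof.
  intros [->| ->].
  - rewrite <- (nome_shift_Z _ n 0).
    replace (((1/2 + INR n)%R, v) - RtoC (INR n - INR 0))%C with ((1/2)%R, v).
    apply nome_half; auto. unfold RtoC, Cminus, Cplus, Copp; simpl; f_equal; field.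
  - rewrite <- (nome_shift_Z _ 0 n).
    replace (((- (1/2) - INR n)%R, v) - RtoC (INR 0 - INR n))%C with ((-1/2)%R, v).
    apply nome_half; auto. unfold RtoC, Cminus, Cplus, Copp; simpl; f_equal; field.
Qed.

(** The bottom side of the box cannot cross the slit, so only its parts left and right of the path
    are pushed down to height -T, by Cauchy's theorem on two blocks. What remains beside the path
    lies far from the origin. *)
Lemma box_identity (F : C -> C) (b X1 X2 T Y : R) : 0 <= T -> 0 < b < Y -> X1 <= -1/2 -> 1/2 <= X2 ->
  (forall x, X1 <= x <= X2 -> Ccont F (x, b)) ->
  (forall x y, X1 <= x <= X2 -> (x <= -1/2 \/ 1/2 <= x) -> y <= b -> Cexd F (x, y)) ->
  rint F X1 X2 b Y = (path_int b T F + (hint F (-T) X1 (-1/2) + hint F (-T) (1/2) X2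
    - Ci * vint F X1 (-T) b + Ci * vint F X2 (-T) b - hint F Y X1 X2
    + Ci * vint F X2 b Y - Ci * vint F X1 b Y))%C.
Proof.
  intros HT Hb H1 H2 Hc Hd.
  pose proof (goursat F X1 (-1/2) (-T) b ltac:(lra) ltac:(lra) ltac:(intros; apply Hd; lra)) as L.
  pose proof (goursat F (1/2) X2 (-T) b ltac:(lra) ltac:(lra) ltac:(intros; apply Hd; lra)) as R.
  unfold rint in *. unfold path_int.
  rewrite <- (hint_Chasles F b X1 (-1/2) X2); [|lra|intros x Hx; apply Hc; lra].
  rewrite <- (hint_Chasles F b (-1/2) (1/2) X2); [|lra|intros x Hx; apply Hc; lra].
  apply Ceq_minus.
  match type of L with ?l = _ => match type of R with ?r = _ =>
    transitivity (- (l + r))%C; [ring|] end end.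
  rewrite L, R. ring.
Qed.

Lemma Cmod_add7 (a b c d e f g : C) (A B D E F G H : R) :
  Cmod a <= A -> Cmod b <= B -> Cmod c <= D -> Cmod d <= E -> Cmod e <= F -> Cmod f <= G -> Cmod g <= H ->
  Cmod (a + b - Ci * c + Ci * d - e + Ci * f - Ci * g) <= A + B + D + E + F + G + H.
Proof.
  intros.
  assert (K : forall x, Cmod (Ci * x) = Cmod x) by (intros; rewrite Cmod_mult, Cmod_Ci; ring).
  eapply Rle_trans; [apply Cmod_sub_le|]. rewrite K. apply Rplus_le_compat; auto.
  eapply Rle_trans; [apply Cmod_triangle|]. rewrite K. apply Rplus_le_compat; auto.
  eapply Rle_trans; [apply Cmod_sub_le|]. apply Rplus_le_compat; auto.
  eapply Rle_trans; [apply Cmod_triangle|]. rewrite K. apply Rplus_le_compat; auto.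
  eapply Rle_trans; [apply Cmod_sub_le|]. rewrite K. apply Rplus_le_compat; auto.
  eapply Rle_trans; [apply Cmod_triangle|]. lra.
Qed.

(** On all leftover segments the kernel is at most 2 and |w| >= N / 2: the vertical sides run midway
    between poles, the horizontal ones far from the row. The error is length times supremum. *)
Lemma lattice_row_error (s z : C) (b : R) (N : nat) : 1 < Re s -> 0 < b < Im z ->
  2 * Rabs (Re z) + 2 <= INR N ->
  Cmod (csum (fun j => pw (z + RtoC (INR j - INR N)) s) (2 * N + 1)
        - path_int b (INR N) (fun w => pw w s * ker (w - z))%C)
  <= (9 + 2 * Im z) * INR N * (2 * exp (2 * PI * Rabs (Im s)) * exp (- Re s * ln (INR N / 2))).
Proof.
  intros Hs Hb HN. pose proof (Rabs_pos (Re z)) as A0.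
  rewrite <- (strip_sum s z b (Im z + INR N) N (2 * N + 1)) by lra.
  set (F := fun w => (pw w s * ker (w - z))%C). set (n := INR N) in *.
  pose proof PI_ge_2 as HP.
  pose proof (Rle_abs (Re z)) as A1. pose proof (Rle_abs (- Re z)) as A2. rewrite Rabs_Ropp in A2.
  set (X1 := Re z - n - 1/2). set (X2 := Re z + n + 1/2). set (Y := Im z + n).
  assert (E2 : X1 + INR (2 * N + 1) = X2).
  { unfold X1, X2. rewrite plus_INR, mult_INR. simpl INR. fold n. field. }
  fold F X1 Y. rewrite E2.
  assert (Dlow : forall x y, y < Im z -> slit (x, y) -> Cexd F (x, y)).
  { intros x y Hy Hsl. apply Cexd_mult. apply Cexd_pw; auto.
    apply Cexd_ker, nome_neq1_im. simpl. unfold Im in Hy. lra. }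
  assert (Nside : forall x y, x = X1 \/ x = X2 -> nome ((x, y) - z) = RtoC (- exp (- (2 * PI * Im ((x, y) - z)%C)))).
  { intros x y H. destruct z as [p q]. rewrite pair_sub. apply (nome_side _ _ N).
    fold n. unfold X1, X2 in H; simpl in H. destruct H; [right|left]; lra. }
  assert (Bside : forall x y, x = X1 \/ x = X2 -> Cmod (ker ((x, y) - z)) <= 2).
  { intros x y H. rewrite ker_bound_half by auto.
    set (e := exp _). assert (0 < e) by apply exp_pos.
    apply Rle_trans with (/ 1); [apply Rinv_le_contravar; lra|lra]. }
  assert (Cside : forall x y, x = X1 \/ x = X2 -> slit (x, y) -> Ccont F (x, y)).
  { intros x y H Hsl. apply Cexd_cont, Cexd_mult. apply Cexd_pw; auto. apply Cexd_ker.
    rewrite Nside by auto. intros E. apply RtoC_inj in E.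
    pose proof (exp_pos (- (2 * PI * Im ((x, y) - z)%C))). lra. }
  set (Q := exp (2 * PI * Rabs (Im s)) * exp (- Re s * ln (n / 2))).
  assert (HQ : 0 < Q) by (apply Rmult_lt_0_compat; apply exp_pos).
  assert (Bpw : forall w, n / 2 <= Cmod w -> Cmod (pw w s) <= Q).
  { intros w Hw. eapply Rle_trans; [apply Cmod_pw|]. unfold Q. rewrite <- exp_plus. apply exp_le.
    assert (ln (n/2) <= ln (Cmod w)) by (apply ln_le; lra). nra. }
  assert (Bre : forall x y, n / 2 <= Rabs x -> n / 2 <= Cmod (x, y)).
  { intros x y H. pose proof (re_le_Cmod (x, y)). simpl in H0. lra. }
  assert (Bim : forall x y, n / 2 <= Rabs y -> n / 2 <= Cmod (x, y)).
  { intros x y H. pose proof (im_le_Cmod (x, y)). simpl in H0. lra. }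
  assert (BF : forall w, n / 2 <= Cmod w -> Cmod (ker (w - z)) <= 2 -> Cmod (F w) <= 2 * Q).
  { intros w H1 H2. unfold F. rewrite Cmod_mult, Rmult_comm.
    apply Rmult_le_compat; auto; apply Cmod_ge_0. }
  assert (HX1 : n / 2 <= Rabs X1) by (rewrite Rabs_left1; unfold X1; lra).
  assert (HX2 : n / 2 <= Rabs X2) by (rewrite Rabs_pos_eq; unfold X2; lra).
  assert (Klow : forall x, Cmod (ker ((x, (- n)%R) - z)) <= 2).
  { intros x. set (w := ((x, (- n)%R) - z)%C). assert (HI : Im w = - n - Im z) by reflexivity.
    eapply Rle_trans; [apply ker_bound_low; lra|]. rewrite HI.
    assert (2 <= exp (- (2 * PI * (- n - Im z)))) by (apply exp_ge_2; nra).
    apply Rle_trans with (/ 1); [apply Rinv_le_contravar; lra|lra]. }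
  assert (Ktop : forall x, Cmod (ker ((x, Y) - z)) <= 2).
  { intros x. set (w := ((x, Y) - z)%C).
    assert (HI : Im w = n) by (unfold w, Y; destruct z; simpl; ring).
    eapply Rle_trans; [apply ker_bound_high; lra|]. rewrite HI.
    assert (2 <= exp (2 * PI * n)) by (apply exp_ge_2; nra).
    rewrite exp_Ropp. assert (/ exp (2 * PI * n) <= / 2) by (apply Rinv_le_contravar; lra).
    apply Rle_trans with (/ (/ 2)); [apply Rinv_le_contravar; lra|lra]. }
  assert (Side : forall x a c, x = X1 \/ x = X2 -> a <= c -> Cmod (vint F x a c) <= (c - a) * (2 * Q)).
  { intros x a c Hx Hac. apply vint_bound; auto.
    - intros y _. apply Cside; auto. apply slit_intro. simpl. left. unfold X1, X2 in Hx. lra.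
    - intros y _. apply BF; auto. apply Bre. destruct Hx; subst x; auto. }
  assert (Low : forall a c, a <= c -> (c <= -1/2 \/ 1/2 <= a) -> Cmod (hint F (- n) a c) <= (c - a) * (2 * Q)).
  { intros a c Hac Hx. apply hint_bound; auto.
    - intros x Hxx. apply Cexd_cont, Dlow; [lra|]. apply slit_intro. simpl. lra.
    - intros x _. apply BF; auto. apply Bim. rewrite Rabs_left1; lra. }
  assert (Top : Cmod (hint F Y X1 X2) <= (X2 - X1) * (2 * Q)).
  { apply hint_bound. unfold X1, X2; lra.
    - intros x _. apply Cexd_cont, Cexd_mult. apply Cexd_pw, slit_intro; simpl; unfold Y; lra.
      apply Cexd_ker, nome_neq1_im. unfold Y. destruct z; simpl in *. lra.
    - intros x _. apply BF; auto. apply Bim. unfold Y. rewrite Rabs_pos_eq; lra. }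
  rewrite (box_identity F b X1 X2 n Y); try (unfold X1, X2, Y; lra).
  2:{ intros x Hx. apply Cexd_cont, Dlow; [lra|]. apply slit_intro; simpl; lra. }
  2:{ intros x y _ Hx Hy. apply Dlow; [lra|]. apply slit_intro; simpl; lra. }
  match goal with |- Cmod (path_int b n F + ?e - path_int b n F) <= _ =>
    replace (path_int b n F + e - path_int b n F)%C with e by ring end.
  eapply Rle_trans.
  - apply Cmod_add7; [apply Low|apply Low|apply Side|apply Side|exact Top|apply Side|apply Side];
      try (unfold X1, X2, Y; lra); auto.
  (* The segments have total length 8n + 1 + 2 Im z, which is at most (9 + 2 Im z) n because n >=
     2. *)
  - replace (2 * exp (2 * PI * Rabs (Im s)) * exp (- Re s * ln (n / 2))) with (2 * Q) by (unfold Q; ring).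
    rewrite <- !Rmult_plus_distr_r. apply Rmult_le_compat_r; [lra|]. unfold X1, X2, Y.
    assert (0 <= Im z * (n - 1)) by (apply Rmult_le_pos; lra). lra.
Qed.

Lemma exp_ln_lim (c : R) : c < 0 -> is_lim_seq (fun N => exp (c * ln (INR N / 2))) 0.
Proof.
  intros Hc. apply is_lim_seq_spec. intros e. pose proof (cond_pos e) as He.
  destruct (INR_unbounded (2 * exp (ln e / c))) as [N HN]. exists N. intros n Hn.
  apply le_INR in Hn. rewrite Rminus_0_r, Rabs_pos_eq by (apply Rlt_le, exp_pos).
  apply Rlt_le_trans with (exp (ln e)); [|rewrite exp_ln; lra]. apply exp_increasing.
  assert (L : ln e / c < ln (INR n / 2)).
  { rewrite <- (ln_exp (ln e / c)). apply ln_increasing. apply exp_pos. lra. }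
  apply Rmult_lt_gt_compat_neg_l with (r := c) in L; auto.
  replace (c * (ln e / c)) with (ln e) in L by (field; lra). lra.
Qed.

(** The contour error is of order N^(1 - Re s), so Re s > 1 makes the symmetric partial sums
    converge to the integral. *)
Lemma lattice_row (s z : C) (b : R) : 1 < Re s -> 0 < b < Im z ->
  Climit (fun N => csum (fun j => pw (z + RtoC (INR j - INR N)) s) (2 * N + 1))
    (path_lim b (fun w => pw w s * ker (w - z))%C).
Proof.
  intros Hs Hb. destruct (INR_unbounded (2 * Rabs (Re z) + 2)) as [k Hk].
  destruct (ker_low_dec2 z b ltac:(lra)) as [M [HM0 HM]].
  destruct (path_pw_dec s b ltac:(lra)) as [K [HK0 HK]].
  assert (L : Climit (fun n => path_int b (INR n) (fun w => pw w s * ker (w - z))%C)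
     (path_lim b (fun w => pw w s * ker (w - z))%C)).
  (* [expk 0] is 1, so the bound for the remainder after 0 terms is the one for the kernel
     itself. *)
  { specialize (HM 0%nat). specialize (HK _ _ ltac:(apply Rmult_le_pos; [exact HM0|apply Rlt_le, exp_pos]) HM).
    apply path_lim_spec with (K * (M * exp (- (2 * PI * INR 0 * (Im z - b))))); try lra.
    - apply Rmult_le_pos; auto. apply Rmult_le_pos; auto. apply Rlt_le, exp_pos.
    - apply path_pw_cont; [lra|]. intros w Hw. apply on_path_im in Hw.
      apply Cexd_cont, Cexd_ker, nome_neq1_im.
      replace (Im (w - z)%C) with (Im w - Im z) by reflexivity. lra.
    - intros w Hw. specialize (HK w Hw). cbv beta in HK. rewrite expk_0, Cmult_1_l in HK. exact HK. }
  apply (Climit_shift _ _ k).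
  apply (Climit_squeeze _ (fun n => path_int b (INR (n + k)) (fun w => pw w s * ker (w - z))%C) _
    (fun n => (9 + 2 * Im z) * 4 * exp (2 * PI * Rabs (Im s)) *
       exp ((1 - Re s) * ln (INR (n + k) / 2)))).
  - intros n. pose proof (Rabs_pos (Re z)).
    assert (HN : 2 * Rabs (Re z) + 2 <= INR (n + k)) by (rewrite plus_INR; pose proof (pos_INR n); lra).
    eapply Rle_trans; [apply lattice_row_error; auto|]. right.
    set (x := INR (n + k)) in *.
    replace (exp ((1 - Re s) * ln (x / 2))) with (x / 2 * exp (- Re s * ln (x / 2))). field.
    rewrite <- (exp_ln (x / 2)) at 1 by lra. rewrite <- exp_plus. f_equal. ring.
  - apply is_lim_seq_scal_0.
    apply (is_lim_seq_incr_n (fun n => exp ((1 - Re s) * ln (INR n / 2))) k), exp_ln_lim. lra.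
  - apply (Climit_subseq (fun n => path_int b (INR n) (fun w => pw w s * ker (w - z))%C) _
      (fun n => (n + k)%nat)); auto. intros; lia.
Qed.

(** * Riemann's integral *)

Fixpoint rsum (f : nat -> R) (n : nat) : R :=
  match n with O => 0 | S m => rsum f m + f m end.

Lemma csum_tail f B n m : (forall i, Cmod (f i) <= B i) -> (n <= m)%nat ->
  Cmod (csum f m - csum f n) <= rsum B m - rsum B n.
Proof.
  intros H Hnm. induction Hnm.
  - replace (csum f n - csum f n)%C with (RtoC 0) by ring. rewrite Cmod_0. lra.
  - simpl. replace (csum f m + f m - csum f n)%C with ((csum f m - csum f n) + f m)%C by ring.
    eapply Rle_trans; [apply Cmod_triangle|]. specialize (H m). lra.
Qed.

Lemma csum_minus f g n : csum (fun i => f i - g i)%C n = (csum f n - csum g n)%C.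
Proof. induction n; simpl. ring. rewrite IHn. ring. Qed.

Lemma csum_plus f g n : csum (fun i => f i + g i)%C n = (csum f n + csum g n)%C.
Proof. induction n; simpl. ring. rewrite IHn. ring. Qed.

Lemma csum_scal c f n : csum (fun i => c * f i)%C n = (c * csum f n)%C.
Proof. induction n; simpl. ring. rewrite IHn. ring. Qed.

Lemma Climit_csum (a : nat -> nat -> C) (l : nat -> C) n :
  (forall i, Climit (fun j => a j i) (l i)) -> Climit (fun j => csum (a j) n) (csum l n).
Proof.
  intros H. induction n; simpl. apply Climit_const. apply Climit_plus; auto.
Qed.

Lemma rsum_le f g n : (forall i, f i <= g i) -> rsum f n <= rsum g n.
Proof. intros H. induction n; simpl. lra. specialize (H n). lra. Qed.

Lemma rsum_scal c f n : rsum (fun i => c * f i) n = c * rsum f n.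
Proof. induction n; simpl. ring. rewrite IHn. ring. Qed.

Lemma bounded_tail (B : nat -> R) (U : R) : (forall i, 0 <= B i) -> (forall n, rsum B n <= U) ->
  forall e, 0 < e -> exists N, forall n m, (N <= n)%nat -> (n <= m)%nat -> rsum B m - rsum B n < e.
Proof.
  intros HB HU e He.
  destruct (ex_finite_lim_seq_incr (rsum B) U) as [l Hl]; auto.
  { intros n. simpl. specialize (HB n). lra. }
  apply is_lim_seq_spec in Hl. destruct (Hl (mkposreal (e/2) ltac:(lra))) as [N HN]. exists N.
  intros n m Hn Hm. pose proof (HN n Hn) as A. pose proof (HN m ltac:(lia)) as D. simpl in A, D.
  apply Rabs_def2 in A. apply Rabs_def2 in D. lra.
Qed.

Lemma csum_converges (f : nat -> C) (B : nat -> R) (U : R) :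
  (forall i, Cmod (f i) <= B i) -> (forall n, rsum B n <= U) -> exists l, Climit (csum f) l.
Proof.
  intros HB HU. apply Climit_cauchy. intros e He.
  assert (P : forall i, 0 <= B i) by (intros i; eapply Rle_trans; [apply Cmod_ge_0|apply HB]).
  destruct (bounded_tail B U P HU e He) as [N HN]. exists N. intros n m Hn Hm.
  destruct (le_ge_dec n m) as [L|L].
  - rewrite Cmod_sub_sym. eapply Rle_lt_trans; [apply (csum_tail f B n m); auto|]. apply HN; auto.
  - eapply Rle_lt_trans; [apply (csum_tail f B m n); auto|]. apply HN; auto.
Qed.

Lemma csum_limit_tail (f : nat -> C) (B : nat -> R) (l : C) (n : nat) (e : R) :
  (forall i, Cmod (f i) <= B i) -> Climit (csum f) l ->
  (forall m, (n <= m)%nat -> rsum B m - rsum B n <= e) -> Cmod (l - csum f n) <= e.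
Proof.
  intros HB Hl He.
  apply (Climit_le (fun m => csum f (m + n) - csum f n)%C).
  - intros m. eapply Rle_trans; [apply (csum_tail f B); auto; lia|]. apply He; lia.
  - apply Climit_minus; [|apply Climit_const].
    apply (Climit_subseq (csum f) l (fun m => (m + n)%nat)); auto. intros; lia.
Qed.

(** Dominated convergence for series: the common majorant makes the tails small uniformly in [j], so
    the limits in [j] and in the number of terms may be exchanged. *)
Lemma tannery (a : nat -> nat -> C) (B : nat -> R) (U : R) (l : nat -> C) (S : nat -> C) (L : C) :
  (forall j i, Cmod (a j i) <= B i) -> (forall n, rsum B n <= U) ->
  (forall i, Climit (fun j => a j i) (l i)) -> (forall j, Climit (csum (a j)) (S j)) ->
  Climit S L -> Climit (csum l) L.
Proof.
  intros HB HU Hl HS HL e He.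
  assert (P : forall i, 0 <= B i) by (intros i; eapply Rle_trans; [apply Cmod_ge_0|apply (HB O)]).
  destruct (bounded_tail B U P HU (e/4) ltac:(lra)) as [N HN]. exists N. intros n Hn.
  destruct (HL (e/4) ltac:(lra)) as [j1 J1].
  destruct (Climit_csum a l n Hl (e/4) ltac:(lra)) as [j2 J2].
  set (j := max j1 j2). specialize (J1 j ltac:(lia)). specialize (J2 j ltac:(lia)).
  rewrite Cmod_sub_sym in J2.
  pose proof (csum_limit_tail (a j) B (S j) n (e/4) (HB j) (HS j)
    ltac:(intros m Hm; apply Rlt_le, HN; auto)) as T. rewrite Cmod_sub_sym in T.
  pose proof (Cmod_tri3 (csum l n) (csum (a j) n) L).
  pose proof (Cmod_tri3 (csum (a j) n) (S j) L). lra.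
Qed.

(** Comparison with a telescoping sum: e^t >= 1 + t gives (x + 1)^(-p) <= (x^(1-p) - (x+1)^(1-p)) /
    (p - 1). *)
Lemma p_series_bounded (p : R) : 1 < p ->
  exists U, forall n, rsum (fun i => exp (- p * ln (INR (S i)))) n <= U.
Proof.
  intros Hp. exists (1 + / (p - 1)).
  assert (Q : 0 < / (p - 1)) by (apply Rinv_0_lt_compat; lra).
  assert (H : forall n, rsum (fun i => exp (- p * ln (INR (S i)))) (S n)
     <= 1 + / (p - 1) * (1 - exp ((1 - p) * ln (INR (S n))))).
  { induction n.
    - simpl. rewrite ln_1, !Rmult_0_r, exp_0. lra.
    - change (rsum (fun i => exp (- p * ln (INR (S i)))) (S (S n))) with
        (rsum (fun i => exp (- p * ln (INR (S i)))) (S n) + exp (- p * ln (INR (S (S n))))).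
      assert (H1 : 0 < INR (S n)) by (apply lt_0_INR; lia).
      set (x := INR (S n)) in *.
      assert (E : INR (S (S n)) = x + 1) by (unfold x; rewrite (S_INR (S n)); ring). rewrite E.
      assert (D : / (x + 1) <= ln (x + 1) - ln x).
      { pose proof (ln_le_sub1 (x / (x + 1)) ltac:(apply Rdiv_lt_0_compat; lra)) as L.
        unfold Rdiv in L. rewrite ln_mult, ln_Rinv in L by (try apply Rinv_0_lt_compat; lra).
        replace (x * / (x + 1) - 1) with (- / (x + 1)) in L by (field; lra). lra. }
      set (A := (1 - p) * ln x) in *. set (B := (1 - p) * ln (x + 1)).
      assert (F : (A - B) * exp B <= exp A - exp B).
      { replace (exp A) with (exp (A - B) * exp B) by (rewrite <- exp_plus; f_equal; ring).
        assert (1 + (A - B) <= exp (A - B)).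
        { apply exp_ineq1_le. }
        pose proof (exp_pos B). nra. }
      assert (G : exp (- p * ln (x + 1)) = / (x + 1) * exp B).
      { rewrite <- (exp_ln (x + 1)) at 2 by lra. rewrite <- exp_Ropp, <- exp_plus. f_equal.
        unfold B. ring. }
      rewrite G.
      assert (G2 : / (x + 1) <= / (p - 1) * (A - B)).
      { replace (/ (p - 1) * (A - B)) with (ln (x + 1) - ln x) by (unfold A, B; field; lra). auto. }
      pose proof (exp_pos B).
      assert (/ (x + 1) * exp B <= / (p - 1) * ((A - B) * exp B)) by nra.
      assert (/ (p - 1) * ((A - B) * exp B) <= / (p - 1) * (exp A - exp B)) by nra.
      lra. }
  intros [|n]. simpl. lra. eapply Rle_trans; [apply H|].
  pose proof (exp_pos ((1 - p) * ln (INR (S n)))). nra.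
Qed.

Lemma Climit_Ccont f z (u : nat -> C) : Ccont f z -> Climit u z -> Climit (fun n => f (u n)) (f z).
Proof.
  intros Hf Hu e He. destruct (Hf e He) as [d [Hd K]]. destruct (Hu d Hd) as [N HN].
  exists N. intros n Hn. apply K, HN, Hn.
Qed.

(** The pole i eta lies inside the path of height 1, at distance at least 1/2 from it, so the
    constants are uniform in [eta]. *)
Lemma ker_eps_path (eta : R) : 0 <= eta <= 1/2 ->
  path_cont (fun w => ker (w - (0, eta))) 1 /\
  path_dec2 (fun w => ker (w - (0, eta))) 1 (2 * exp (2 * PI)).
Proof.
  intros He. pose proof PI_ge_2 as HP.
  assert (V : forall w, Re w = -1/2 \/ Re w = 1/2 ->
     nome (w - (0, eta)) = RtoC (- exp (- (2 * PI * Im (w - (0, eta))%C)))).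
  { intros [x y] H. rewrite pair_sub. simpl in *. apply nome_half. lra. }
  assert (I : forall w, Im (w - (0, eta))%C = Im w - eta) by reflexivity.
  split; intros w [[H1 H2]|[H1 H2]].
  - apply Cexd_cont, Cexd_ker. rewrite V by auto. intros E. apply RtoC_inj in E.
    pose proof (exp_pos (- (2 * PI * Im (w - (0, eta))%C))). lra.
  - apply Cexd_cont, Cexd_ker, nome_neq1_im. rewrite I. lra.
  - rewrite ker_bound_half by auto. rewrite I.
    set (e := exp (- (2 * PI * (Im w - eta)))). assert (0 < e) by apply exp_pos.
    apply Rle_trans with (/ e); [apply Rinv_le_contravar; lra|].
    unfold e. rewrite <- exp_Ropp, Ropp_involutive.
    apply Rle_trans with (exp (2 * PI) * exp (2 * Im w)).
    + rewrite <- exp_plus. apply exp_le. nra.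
    + pose proof (exp_pos (2 * PI)). pose proof (exp_pos (2 * Im w)). nra.
  - eapply Rle_trans; [apply ker_bound_high; rewrite I; lra|]. rewrite I, H2.
    assert (2 <= exp (2 * PI * (1 - eta))) by (apply exp_ge_2; nra).
    rewrite exp_Ropp. assert (/ exp (2 * PI * (1 - eta)) <= / 2) by (apply Rinv_le_contravar; lra).
    apply Rle_trans with (/ (/ 2)); [apply Rinv_le_contravar; lra|].
    rewrite Rinv_inv, Rmult_assoc, <- exp_plus.
    assert (2 <= exp (2 * PI + 2 * 1)) by (apply exp_ge_2; lra). lra.
Qed.

Lemma riemann_int_entire : entire riemann_int.
Proof.
  intros s. destruct (ker_eps_path 0 ltac:(lra)) as [A B].
  apply (path_lim_pw_entire (fun w => ker (w - 0)) 1 (2 * exp (2 * PI))); auto; try lra.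
  pose proof (exp_pos (2 * PI)). lra.
Qed.

Definition riemann_int_shift (s : C) (eta : R) : C := path_lim 1 (fun w => pw w s * ker (w - (0, eta)))%C.

(** Raising the path from height eta / 2 to 1 crosses the single pole i eta, whose residue is the
    term n = 0 of the row through i eta. *)
Lemma riemann_int_shift_cross s eta : 0 < eta <= 1/2 ->
  path_lim (eta / 2) (fun w => pw w s * ker (w - (0, eta)))%C = (riemann_int_shift s eta + pw (0, eta) s)%C.
Proof.
  intros He. set (F := fun w => (pw w s * ker (w - (0, eta)))%C).
  destruct (ker_eps_path eta ltac:(lra)) as [A B].
  destruct (path_pw_dec s 1 ltac:(lra)) as [K [HK0 HK]].
  assert (P : 0 <= 2 * exp (2 * PI)) by (pose proof (exp_pos (2 * PI)); lra).
  specialize (HK _ _ P B).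
  assert (Hc : path_cont F 1) by (apply path_pw_cont; [lra|exact A]).
  apply path_lim_unique.
  apply Climit_ext with (fun n => path_int 1 (INR n) F + pw (0, eta) s)%C.
  - intros n. pose proof (pos_INR n).
    rewrite (path_int_raise F (eta / 2) 1); try lra; try (apply path_onV; auto).
    f_equal. symmetry.
    assert (Hs : forall u v, 0 < v -> slit (u, v)) by (intros; apply slit_intro; simpl; lra).
    destruct (Cder_lipschitz (fun w => pw w s) (0, eta) _ (Cder_pw (0, eta) s (Hs 0 eta ltac:(lra))))
      as [r [D [Hr HD]]].
    pose proof (residue_ker (fun w => pw w s) 0 eta (eta/2) 1 r D ltac:(lra) Hr) as R.
    replace (0 - 1/2) with (-1/2) in R by field. replace (0 + 1/2) with (1/2) in R by field.
    apply R; auto. intros u v _ Hv _. apply Cexd_pw, Hs. lra.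
  - apply Climit_plus; [|apply Climit_const].
    apply path_lim_spec with (K * (2 * exp (2 * PI))); auto; try lra. apply Rmult_le_pos; auto.
Qed.

Lemma riemann_int_shift_limit s (eta : nat -> R) : (forall j, 0 < eta j <= 1/2) -> is_lim_seq eta 0 ->
  Climit (fun j => riemann_int_shift s (eta j)) (riemann_int s).
Proof.
  intros He Hl. destruct (path_pw_dec s 1 ltac:(lra)) as [K [HK0 HK]].
  set (P := 2 * exp (2 * PI)).
  assert (HP : 0 < P) by (pose proof (exp_pos (2 * PI)); unfold P; lra).
  destruct (ker_eps_path 0 ltac:(lra)) as [A0 B0]. change (0, 0) with (RtoC 0) in *. fold P in B0.
  pose proof PI_ge_2 as HPI.
  apply (Climit_squeeze _ (fun _ => riemann_int s) _
    (fun j => 3 * K * (2 * PI * exp (2 * PI) * (P * exp 2 + 1) * P) * exp 1 * eta j));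
    [|apply is_lim_seq_scal_0; auto
     |apply Climit_const].
  intros j. specialize (He j). destruct (ker_eps_path (eta j) ltac:(lra)) as [A B]. fold P in B.
  set (h := eta j) in *. unfold riemann_int_shift, riemann_int.
  set (N := 2 * PI * exp (2 * PI) * (P * exp 2 + 1) * P * h).
  assert (HN : 0 <= N).
  { unfold N. pose proof (exp_pos (2 * PI)). pose proof (exp_pos 2).
    assert (0 <= P * exp 2) by (apply Rmult_le_pos; lra).
    repeat (lra || apply Rmult_le_pos). }
  rewrite <- (path_lim_minus 1 (fun w => pw w s * ker (w - (0, h)))%C (fun w => pw w s * ker (w - 0))%C
     (K * P) (K * P)); try lra; try (apply Rmult_le_pos; lra);
    try (apply path_pw_cont; [lra|assumption]); try (apply HK; [lra|assumption]).
  replace (3 * K * (2 * PI * exp (2 * PI) * (P * exp 2 + 1) * P) * exp 1 * h) with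
    (3 * (K * N) * exp 1) by (unfold N; ring).
  assert (D : path_dec2 (fun w => ker (w - (0, h)) - ker (w - 0))%C 1 N).
  { intros w Hw.
    assert (Hn : nome (0, h)%C <> 0%C) by apply nome_nz.
    assert (N1 : nome (w - (0, h)) <> 1%C /\ nome (w - 0) <> 1%C).
    { assert (Q : forall t, 0 <= t <= 1/2 -> nome (w - (0, t)) <> 1%C).
      { intros t Ht. destruct w as [x y]. rewrite pair_sub. destruct Hw as [[H1 H2]|[H1 H2]]; simpl in *.
        - rewrite nome_half by lra. intros E. apply RtoC_inj in E.
          pose proof (exp_pos (- (2 * PI * (y - t)))). lra.
        - apply nome_neq1_im. simpl. lra. }
      split; [apply Q; lra|]. apply (Q 0); lra. }
    destruct N1 as [N1 N2].
    assert (E : nome (w - (0, h)) = (nome (w - 0) * RtoC (exp (2 * PI * h)))%C).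
    { replace (w - (0, h))%C with (w - 0 + (0, - h)%R)%C.
      - rewrite nome_plus. f_equal. rewrite nome_eq, !Rmult_0_r, cos_0, sin_0.
        replace (- (2 * PI * - h)) with (2 * PI * h) by ring. unfold RtoC; f_equal; ring.
      - destruct w; unfold Cminus, Cplus, Copp, RtoC; simpl; f_equal; ring. }
    (* The difference of the kernels factors with 1 - e^(2 pi h) in front; the other factors are
       bounded on the path, so it is O(h) with the same decay. *)
    replace (ker (w - (0, h)) - ker (w - 0))%C with
      (RtoC (1 - exp (2 * PI * h)) * (nome (w - 0) * ker (w - 0)) * ker (w - (0, h)))%C.
    2:{ unfold ker. rewrite E in *. rewrite RtoC_minus. field.
        split; apply Cminus_eq_contra; auto. }
    rewrite <- ker_succ by auto. rewrite !Cmod_mult, Cmod_R.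
    specialize (B w Hw). specialize (B0 w Hw). cbv beta in B, B0.
    pose proof (on_path_im 1 w Hw) as Hi.
    assert (X1 : Rabs (1 - exp (2 * PI * h)) <= 2 * PI * h * exp (2 * PI)).
    { assert (0 <= 2 * PI * h) by nra. assert (2 * PI * h <= 2 * PI) by nra.
      assert (1 <= exp (2 * PI * h)) by (rewrite <- exp_0; apply exp_le; auto).
      assert (exp (2 * PI * h) <= exp (2 * PI)) by (apply exp_le; auto).
      rewrite Rabs_left1 by lra.
      assert (1 - 2 * PI * h <= exp (- (2 * PI * h))).
      { pose proof (exp_ineq1_le (- (2 * PI * h))). lra. }
      rewrite exp_Ropp in H3. set (e := exp (2 * PI * h)) in *.
      apply Rmult_le_compat_r with (r := e) in H3; [|lra]. rewrite Rinv_l in H3 by lra. nra. }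
    assert (X2 : Cmod (ker (w - 0) + 1) <= P * exp 2 + 1).
    { eapply Rle_trans; [apply Cmod_triangle|]. rewrite Cmod_1.
      assert (exp (2 * Im w) <= exp 2) by (apply exp_le; lra). nra. }
    unfold N.
    replace (2 * PI * exp (2 * PI) * (P * exp 2 + 1) * P * h * exp (2 * Im w)) with
      ((2 * PI * h * exp (2 * PI) * (P * exp 2 + 1)) * (P * exp (2 * Im w))) by ring.
    apply Rmult_le_compat; auto; try apply Cmod_ge_0.
    apply Rmult_le_pos. apply Rabs_pos. apply Cmod_ge_0.
    apply Rmult_le_compat; auto; try apply Cmod_ge_0. apply Rabs_pos. }
  apply path_lim_bound; try lra.
  - apply Rmult_le_pos; auto.
  - intros w Hw. apply Ccont_minus; apply (path_pw_cont _ s 1); auto; lra.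
  - intros w Hw.
    replace (pw w s * ker (w - (0, h)) - pw w s * ker (w - 0))%C with
      (pw w s * (ker (w - (0, h)) - ker (w - 0)))%C by ring.
    apply (HK _ _ HN D w Hw).
Qed.

(** The sequence 2 / (j + 4): at most 1/2, and an inverse of INR / 2, so powers of it have the form
    treated by [exp_ln_lim]. *)
Definition etaj (j : nat) : R := / (INR (j + 4) / 2).

Lemma etaj_bounds j : 0 < etaj j <= 1/2.
Proof.
  unfold etaj. rewrite plus_INR. simpl. pose proof (pos_INR j). split.
  apply Rinv_0_lt_compat; lra.
  replace (1/2) with (/ 2) by field. apply Rinv_le_contravar; lra.
Qed.

Lemma etaj_lim : is_lim_seq etaj 0.
Proof.
  unfold etaj. apply (is_lim_seq_incr_n (fun n => / (INR n / 2)) 4).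
  replace (Finite 0) with (Rbar_inv p_infty) by reflexivity.
  apply is_lim_seq_inv; [|discriminate].
  apply (is_lim_seq_ext (fun n => / 2 * INR n)). intros; field.
  replace p_infty with (Rbar_mult (/ 2) p_infty).
  apply is_lim_seq_scal_l, is_lim_seq_INR.
  simpl. destruct (Rle_dec 0 (/ 2)) as [L|L]; [|exfalso; lra].
  destruct (Rle_lt_or_eq_dec 0 (/ 2) L) as [L'|L']; [reflexivity|exfalso; lra].
Qed.

Lemma etaj_Climit : Climit (fun j => (0, etaj j)) 0%C.
Proof.
  apply Climit_zero with etaj; [|apply etaj_lim]. intros j. rewrite Cmod_Im_only, Rabs_pos_eq. lra.
  pose proof (etaj_bounds j). lra.
Qed.

Lemma Cmod_nat_pow i s : Cmod (nat_pow (S i) s) = exp (- (1 - Re s) * ln (INR (S i))).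
Proof.
  unfold nat_pow. rewrite Cmod_Cexp, re_scal_r. f_equal.
  replace (Re (s - 1)%C) with (Re s - 1) by reflexivity. ring.
Qed.

(** Let eta tend to 0 in the Fourier expansion at i eta. For Re s < 0 the terms are dominated by
    r^(Re s - 1), and the crossing term (i eta)^(-s) tends to 0. *)
Lemma riemann_int_left s : Re s < 0 -> Climit (csum (fun i => nat_pow (S i) s * hankel s)%C) (riemann_int s).
Proof.
  intros Hs. destruct (p_series_bounded (1 - Re s) ltac:(lra)) as [U HU].
  apply (tannery (fun j => fourier_term s (0, etaj j))
    (fun i => Cmod (hankel s) * exp (- (1 - Re s) * ln (INR (S i)))) (Cmod (hankel s) * U) _
    (fun j => riemann_int_shift s (etaj j) + pw (0, etaj j) s)%C).
  - intros j i. unfold fourier_term. rewrite !Cmod_mult, Cmod_nat_pow, Cmod_nome, im_scal_l. simpl Im.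
    pose proof (etaj_bounds j). pose proof (pos_INR (S i)). pose proof PI_ge_2.
    assert (exp (- (2 * PI * (INR (S i) * etaj j))) <= 1).
    { rewrite <- exp_0. apply exp_le. assert (0 <= INR (S i) * etaj j) by (apply Rmult_le_pos; lra). nra. }
    pose proof (exp_pos (- (2 * PI * (INR (S i) * etaj j)))).
    pose proof (Cmod_ge_0 (hankel s)). pose proof (exp_pos (- (1 - Re s) * ln (INR (S i)))).
    set (A := exp (- (1 - Re s) * ln (INR (S i)))) in *. set (B := exp (- (2 * PI * (INR (S i) * etaj j)))) in *.
    replace (Cmod (hankel s) * A) with (1 * (A * Cmod (hankel s))) by ring. rewrite Rmult_assoc.
    apply Rmult_le_compat_r; auto. apply Rmult_le_pos; lra.
  - intros n. rewrite rsum_scal. apply Rmult_le_compat_l; auto. apply Cmod_ge_0.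
  - intros i. unfold fourier_term.
    apply Climit_ext with (fun j => (nat_pow (S i) s * hankel s) * nome (INR (S i) * (0, etaj j)))%C.
    { intros; ring. }
    assert (E : ((nat_pow (S i) s * hankel s) * nome (INR (S i) * 0))%C = (nat_pow (S i) s * hankel s)%C).
    { replace (INR (S i) * 0)%C with (RtoC 0) by ring. rewrite nome_0. ring. }
    cut (Climit (fun j => (nat_pow (S i) s * hankel s) * nome (INR (S i) * (0, etaj j)))%C
           ((nat_pow (S i) s * hankel s) * nome (INR (S i) * 0))%C); [rewrite E; auto|].
    apply Climit_scal. apply (Climit_Ccont (fun u => nome (INR (S i) * u)) 0%C).
    + apply Cexd_cont. apply (Cexd_comp nome (fun u => INR (S i) * u)%C). apply Cexd_nome.
      apply Cexd_mult; [apply Cexd_const|apply Cexd_id].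
    + apply etaj_Climit.
  - intros j. pose proof (etaj_bounds j). rewrite <- riemann_int_shift_cross by auto.
    apply fourier; simpl; lra.
  - replace (riemann_int s) with (riemann_int s + 0)%C by ring. apply Climit_plus.
    + apply riemann_int_shift_limit. apply etaj_bounds. apply etaj_lim.
    + apply Climit_zero with (fun j => exp (2 * PI * Rabs (Im s)) * exp (Re s * ln (INR (j + 4) / 2))).
      * intros j. eapply Rle_trans; [apply Cmod_pw|]. rewrite <- exp_plus. apply exp_le.
        pose proof (etaj_bounds j). rewrite Cmod_Im_only, Rabs_pos_eq by lra.
        unfold etaj. rewrite ln_Rinv. lra. rewrite plus_INR; simpl. pose proof (pos_INR j). lra.
      * apply is_lim_seq_scal_0.
        apply (is_lim_seq_incr_n (fun n => exp (Re s * ln (INR n / 2))) 4), exp_ln_lim. lra.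
Qed.

Lemma csum_shift g n : csum g (S n) = (g O + csum (fun j => g (S j)) n)%C.
Proof. induction n. simpl. ring. simpl in *. rewrite IHn. ring. Qed.

Lemma csum_symmetric (f : R -> C) N :
  csum (fun j => f (INR j - INR N)) (2 * N + 1) =
  (f 0 + csum (fun i => f (INR (S i)) + f (- INR (S i))%R)%C N)%C.
Proof.
  induction N.
  - simpl. rewrite Rminus_0_r. ring.
  - replace (2 * S N + 1)%nat with (S (S (2 * N + 1))) by lia.
    rewrite csum_shift. change (csum (fun j => f (INR (S j) - INR (S N))) (S (2 * N + 1))) with
      (csum (fun j => f (INR (S j) - INR (S N))%R) (2 * N + 1)
       + f (INR (S (2 * N + 1)) - INR (S N))%R)%C.
    rewrite (csum_ext _ (fun j => f (INR j - INR N)%R)).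
    2:{ intros i _. f_equal. rewrite !S_INR. ring. }
    rewrite IHN. cbn [csum].
    replace (INR (S (2 * N + 1)) - INR (S N)) with (INR (S N))
      by (rewrite !S_INR, plus_INR, mult_INR; simpl; ring).
    replace (INR 0 - INR (S N)) with (- INR (S N)) by (change (INR 0) with 0; ring).
    ring.
Qed.

(** Let eta tend to 0 in the lattice row through i eta. The term n = 0, singular in the limit, is
    exactly the crossing term and drops out; the others are dominated by n^(-Re s). *)
Lemma riemann_int_right s : 1 < Re s ->
  Climit (csum (fun i => pw (RtoC (INR (S i))) s + pw (RtoC (- INR (S i))) s)%C) (riemann_int s).
Proof.
  intros Hs. destruct (p_series_bounded (Re s) Hs) as [U HU].
  set (Q := exp (2 * PI * Rabs (Im s))). assert (HQ : 0 < Q) by apply exp_pos.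
  apply (tannery (fun j i => pw ((0, etaj j) + RtoC (INR (S i))) s + pw ((0, etaj j) + RtoC (- INR (S i))) s)%C
    (fun i => 2 * Q * exp (- Re s * ln (INR (S i)))) (2 * Q * U) _
    (fun j => riemann_int_shift s (etaj j))).
  - intros j i. assert (Hi : 1 <= INR (S i)) by (rewrite S_INR; pose proof (pos_INR i); lra).
    assert (B : forall w, INR (S i) <= Cmod w -> Cmod (pw w s) <= Q * exp (- Re s * ln (INR (S i)))).
    { intros w Hw. eapply Rle_trans; [apply Cmod_pw|]. unfold Q. rewrite <- exp_plus. apply exp_le.
      assert (ln (INR (S i)) <= ln (Cmod w)) by (apply ln_le; lra). nra. }
    assert (M : forall x, Rabs x = INR (S i) -> INR (S i) <= Cmod ((0, etaj j) + RtoC x)).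
    { intros x Hx. pose proof (re_le_Cmod ((0, etaj j) + RtoC x)) as R.
      rewrite re_plus, re_RtoC in R. simpl in R. rewrite Rplus_0_l in R. lra. }
    eapply Rle_trans; [apply Cmod_triangle|].
    pose proof (B _ (M (INR (S i)) ltac:(apply Rabs_pos_eq; lra))).
    pose proof (B _ (M (- INR (S i)) ltac:(rewrite Rabs_Ropp; apply Rabs_pos_eq; lra))). lra.
  - intros n. rewrite rsum_scal. apply Rmult_le_compat_l; auto. lra.
  - intros i. assert (Hi : 1 <= INR (S i)) by (rewrite S_INR; pose proof (pos_INR i); lra).
    assert (A : forall x, x <> 0 -> Climit (fun j => pw ((0, etaj j) + RtoC x) s) (pw (RtoC x) s)).
    { intros x Hx. apply (Climit_Ccont (fun w => pw w s)).
      - apply pw_cont, slit_intro. simpl. auto.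
      - cut (Climit (fun j => (0, etaj j) + RtoC x)%C (0 + RtoC x)%C);
          [rewrite Cplus_0_l; auto|].
        apply Climit_plus; [apply etaj_Climit|apply Climit_const]. }
    apply Climit_plus; apply A; lra.
  - intros j. pose proof (etaj_bounds j) as Hj.
    pose proof (lattice_row s (0, etaj j) (etaj j / 2) Hs ltac:(simpl; lra)) as L.
    rewrite riemann_int_shift_cross in L by auto.
    replace (riemann_int_shift s (etaj j)) with (riemann_int_shift s (etaj j) + pw (0, etaj j) s - pw (0, etaj j) s)%C by ring.
    eapply Climit_ext; [|apply Climit_minus; [exact L|apply Climit_const]].
    intros n. cbv beta. rewrite (csum_symmetric (fun x => pw ((0, etaj j) + RtoC x) s)).
    replace ((0, etaj j) + 0)%C with (0, etaj j). ring.
    unfold RtoC, Cplus; simpl; f_equal; ring.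
  - apply riemann_int_shift_limit. apply etaj_bounds. apply etaj_lim.
Qed.

(** * The Lambert series and the zeros at negative even integers *)

Lemma geom_rsum_bounded (r : R) : 0 < r < 1 -> forall n, rsum (fun i => r ^ S i) n <= r / (1 - r).
Proof.
  intros Hr n.
  assert (E : rsum (fun i => r ^ S i) n = r * (1 - r ^ n) / (1 - r)).
  { induction n. simpl. field. lra. cbn [rsum]. rewrite IHn. simpl. field. lra. }
  rewrite E. unfold Rdiv. apply Rmult_le_compat_r. apply Rlt_le, Rinv_0_lt_compat; lra.
  assert (0 < r ^ n) by (apply pow_lt; lra). nra.
Qed.

Lemma exp_pow_INR (x : R) (n : nat) : exp x ^ n = exp (INR n * x).
Proof.
  induction n. simpl. rewrite Rmult_0_l, exp_0. reflexivity.
  rewrite S_INR, <- tech_pow_Rmult, IHn, <- exp_plus. f_equal. ring.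
Qed.

(** Half of the exponential absorbs the power: ln (x c) <= x c - 1 with c = d / (2a) bounds x^a by a
    constant times e^(x d / 2), leaving a geometric series. *)
Lemma poly_geom_bounded (A d : R) : 0 <= A -> 0 < d ->
  exists U, forall n, rsum (fun i => exp (A * ln (INR (S i))) * exp (- d) ^ S i) n <= U.
Proof.
  intros HA Hd. set (a := A + 1). set (c := d / (2 * a)).
  assert (Hc : 0 < c) by (apply Rdiv_lt_0_compat; unfold a; lra).
  set (r := exp (- (d / 2))).
  assert (Hr : 0 < r < 1).
  { split. apply exp_pos. unfold r. rewrite <- exp_0. apply exp_increasing. lra. }
  exists (exp (- a * ln c) * (r / (1 - r))). intros n.
  apply Rle_trans with (exp (- a * ln c) * rsum (fun i => r ^ S i) n).
  2:{ apply Rmult_le_compat_l. apply Rlt_le, exp_pos. apply geom_rsum_bounded; auto. }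
  rewrite <- rsum_scal. apply rsum_le. intros i. unfold r. rewrite !exp_pow_INR, <- !exp_plus.
  apply exp_le. assert (Hi : 1 <= INR (S i)) by (rewrite S_INR; pose proof (pos_INR i); lra).
  set (x := INR (S i)) in *.
  assert (L : 0 <= ln x) by (rewrite <- ln_1; apply ln_le; lra).
  pose proof (ln_le_sub1 (x * c) ltac:(apply Rmult_lt_0_compat; lra)) as X.
  rewrite ln_mult in X by lra. apply Rmult_le_compat_l with (r := a) in X; [|unfold a; lra].
  replace (a * (x * c - 1)) with (x * (d / 2) - a) in X by (unfold c; field; unfold a; lra).
  assert (A * ln x <= a * ln x) by (unfold a; nra). unfold a in *. lra.
Qed.

(** r^(s-1) times the sum of q^(r m) over m >= 1, the geometric series over the rows being already
    summed. *)
Definition lambert_term (tau s : C) (i : nat) : C :=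
  (nat_pow (S i) s * (Cpow (nome tau) (S i) / (1 - Cpow (nome tau) (S i))))%C.

Definition lambert (tau s : C) : C := epsilon (inhabits (RtoC 0)) (Climit (csum (lambert_term tau s))).

Definition rho (tau : C) : R := exp (- (2 * PI * Im tau)).

Lemma rho_bounds tau : 0 < Im tau -> 0 < rho tau < 1.
Proof.
  intros H. unfold rho. split. apply exp_pos. rewrite <- exp_0. apply exp_increasing.
  pose proof PI_ge_2. nra.
Qed.

Lemma pow_S_le (r : R) n : 0 < r < 1 -> r ^ S n <= r.
Proof.
  intros H. simpl. assert (r ^ n <= 1) by (rewrite <- (pow1 n); apply pow_incr; lra).
  assert (0 < r ^ n) by (apply pow_lt; lra). nra.
Qed.

Lemma nome_pow_mod tau n : Cmod (Cpow (nome tau) n) = rho tau ^ n.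
Proof. rewrite Cmod_pow, Cmod_nome. reflexivity. Qed.

Lemma one_sub_nome_pow tau i : 0 < Im tau -> 1 - rho tau <= Cmod (1 - Cpow (nome tau) (S i)).
Proof.
  intros H. pose proof (rho_bounds tau H). pose proof (Cmod_rev_tri 1 (Cpow (nome tau) (S i))) as A.
  rewrite Cmod_1, nome_pow_mod in A. pose proof (pow_S_le (rho tau) i H0). lra.
Qed.

Lemma one_sub_nome_pow_nz tau i : 0 < Im tau -> (1 - Cpow (nome tau) (S i))%C <> 0%C.
Proof.
  intros H. apply Cmod_gt_0. pose proof (one_sub_nome_pow tau i H). pose proof (rho_bounds tau H). lra.
Qed.

Lemma lambert_factor_bound tau i : 0 < Im tau ->
  Cmod (Cpow (nome tau) (S i) / (1 - Cpow (nome tau) (S i))) <= rho tau ^ S i / (1 - rho tau).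
Proof.
  intros H. pose proof (rho_bounds tau H). pose proof (one_sub_nome_pow tau i H).
  rewrite Cmod_div by (apply one_sub_nome_pow_nz; auto). rewrite nome_pow_mod.
  apply Rmult_le_compat_l. apply pow_le; lra. apply Rinv_le_contravar; lra.
Qed.

Lemma ln_INR_ge0 i : 0 <= ln (INR (S i)).
Proof. rewrite <- ln_1. apply ln_le. lra. rewrite S_INR. pose proof (pos_INR i). lra. Qed.

Lemma lambert_majorant_bounded tau A : 0 < Im tau -> 0 <= A -> exists U, forall n,
  rsum (fun i => exp (A * ln (INR (S i))) * (rho tau ^ S i / (1 - rho tau))) n <= U.
Proof.
  intros H HA. pose proof (rho_bounds tau H). pose proof PI_ge_2.
  destruct (poly_geom_bounded A (2 * PI * Im tau) HA ltac:(nra)) as [U HU].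
  exists (/ (1 - rho tau) * U). intros n.
  apply Rle_trans with (/ (1 - rho tau) * rsum (fun i => exp (A * ln (INR (S i))) * rho tau ^ S i) n).
  - rewrite <- rsum_scal. apply rsum_le. intros i. right. field. lra.
  - apply Rmult_le_compat_l; [apply Rlt_le, Rinv_0_lt_compat; lra|]. apply HU.
Qed.

Lemma lambert_term_bound tau s i : 0 < Im tau ->
  Cmod (lambert_term tau s i) <= exp (Cmod (s - 1) * ln (INR (S i))) * (rho tau ^ S i / (1 - rho tau)).
Proof.
  intros H. unfold lambert_term. rewrite Cmod_mult. apply Rmult_le_compat; try apply Cmod_ge_0.
  - unfold nat_pow. rewrite Cmod_Cexp, re_scal_r. apply exp_le.
    apply Rmult_le_compat_r; [apply ln_INR_ge0|]. pose proof (re_le_Cmod (s - 1)).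
    pose proof (Rle_abs (Re (s - 1)%C)). lra.
  - apply lambert_factor_bound; auto.
Qed.

Lemma lambert_spec tau s : 0 < Im tau -> Climit (csum (lambert_term tau s)) (lambert tau s).
Proof.
  intros H. unfold lambert. apply epsilon_spec.
  destruct (lambert_majorant_bounded tau (Cmod (s - 1)) H (Cmod_ge_0 _)) as [U HU].
  eapply csum_converges; [intros i; apply (lambert_term_bound tau s i H)|exact HU].
Qed.

(** Termwise differentiation brings down ln r; the second order remainder is dominated by the
    Lambert majorant with exponent raised by 3, as in [Cexp_mul_remainder]. *)
Lemma lambert_entire tau : 0 < Im tau -> entire (lambert tau).
Proof.
  intros H s. destruct (lambert_majorant_bounded tau (Cmod (s - 1) + 3) H) as [U HU].
  { pose proof (Cmod_ge_0 (s - 1)); lra. }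
  apply (Cexd_limit (fun n s => csum (lambert_term tau s) n) _
    (fun n => csum (fun i => RtoC (ln (INR (S i))) * lambert_term tau s i)%C n) s U).
  - apply (HU O).
  - intros h _. apply lambert_spec; auto.
  - intros n h Hh. rewrite <- csum_minus, <- csum_scal, <- csum_minus.
    pose proof (csum_tail (fun i => lambert_term tau (s + h) i - lambert_term tau s i - h * (RtoC (ln (INR (S i))) * lambert_term tau s i))%C
      (fun i => (Cmod h * Cmod h) * (exp ((Cmod (s - 1) + 3) * ln (INR (S i))) * (rho tau ^ S i / (1 - rho tau))))
      0 n) as T.
    simpl csum at 2 in T. simpl rsum at 2 in T. rewrite rsum_scal in T.
    match goal with |- Cmod ?e <= _ => replace e with (e - 0)%C by ring end.
    eapply Rle_trans; [apply T; [|lia]|].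
    + intros i. unfold lambert_term, nat_pow. set (l := RtoC (ln (INR (S i)))).
      set (f := (Cpow (nome tau) (S i) / (1 - Cpow (nome tau) (S i)))%C).
      replace (s + h - 1)%C with ((s - 1) + h)%C by ring.
      pose proof (Cexp_mul_remainder l (s - 1) h Hh) as R.
      assert (E : Cmod l = ln (INR (S i))).
      { unfold l. rewrite Cmod_R, Rabs_pos_eq; auto. apply ln_INR_ge0. }
      rewrite E in R.
      replace (Cexp ((s - 1 + h) * l) * f - Cexp ((s - 1) * l) * f - h * (l * (Cexp ((s - 1) * l) * f)))%C
        with ((Cexp ((s - 1 + h) * l) - Cexp ((s - 1) * l) - h * (l * Cexp ((s - 1) * l))) * f)%C by ring.
      rewrite Cmod_mult.
      replace (Cmod h * Cmod h * (exp ((Cmod (s - 1) + 3) * ln (INR (S i))) * (rho tau ^ S i / (1 - rho tau))))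
       with ((exp ((Cmod (s - 1) + 3) * ln (INR (S i))) * (Cmod h * Cmod h)) * (rho tau ^ S i / (1 - rho tau)))
       by ring.
      apply Rmult_le_compat; try apply Cmod_ge_0; auto. apply lambert_factor_bound; auto.
    + rewrite Rminus_0_r, Rmult_comm. apply Rmult_le_compat_r; auto.
      pose proof (Cmod_ge_0 h). nra.
Qed.

Fixpoint cpoch (s : C) (n : nat) : C :=
  match n with O => RtoC 1 | S m => (cpoch s m * (s + RtoC (INR m)))%C end.

Lemma cpoch_front s n : cpoch s (S n) = (s * cpoch (s + 1) n)%C.
Proof.
  induction n.
  - simpl. ring.
  - change (cpoch s (S (S n))) with (cpoch s (S n) * (s + RtoC (INR (S n))))%C. rewrite IHn.
    change (cpoch (s + 1) (S n)) with (cpoch (s + 1) n * (s + 1 + RtoC (INR n)))%C.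
    rewrite S_INR, RtoC_plus. ring.
Qed.

Lemma cpoch_fact n : cpoch (- RtoC (INR n)) n = RtoC ((-1) ^ n * INR (fact n)).
Proof.
  induction n.
  - simpl. rewrite Rmult_1_l. reflexivity.
  - rewrite cpoch_front. replace (- RtoC (INR (S n)) + 1)%C with (- RtoC (INR n))%C
      by (rewrite S_INR, RtoC_plus; ring).
    rewrite IHn, fact_simpl, mult_INR, <- RtoC_opp, <- RtoC_mult. f_equal. simpl pow. ring.
Qed.

Lemma hankel_poch s n :
  (Cpow (- (2 * PI * Ci)) n * hankel s)%C = (cpoch s n * hankel (s + RtoC (INR n)))%C.
Proof.
  induction n.
  - simpl. replace (s + 0)%C with s by ring. ring.
  - rewrite Cpow_S. cbn [cpoch]. rewrite S_INR, RtoC_plus.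
    replace (s + (INR n + 1))%C with (s + INR n + 1)%C by ring.
    rewrite <- Cmult_assoc, IHn.
    transitivity (cpoch s n * (- (2 * PI * Ci) * hankel (s + INR n)))%C; [ring|].
    rewrite <- hankel_rec. ring.
Qed.

Lemma two_pi_i_nz : (- (2 * PI * Ci))%C <> 0%C.
Proof.
  apply Cmod_gt_0. pose proof PI_ge_2.
  rewrite Cmod_opp, !Cmod_mult, Cmod_Ci, !Cmod_R, !Rabs_pos_eq; lra.
Qed.

Definition neg_even (k : nat) : C := (- RtoC (INR (2 * k)))%C.

(** The recurrence applied 2k + 1 times writes [hankel s] with the factor s (s + 1) ... (s + 2k);
    this is what remains after removing the last factor s + 2k. *)
Definition hankel_cofactor (k : nat) (s : C) : C :=
  (cpoch s (2 * k) * hankel (s + RtoC (INR (2 * k + 1))) / Cpow (- (2 * PI * Ci)) (2 * k + 1))%C.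

Lemma hankel_factor k s : hankel s = ((s - neg_even k) * hankel_cofactor k s)%C.
Proof.
  pose proof (hankel_poch s (2 * k + 1)) as E.
  assert (P : Cpow (- (2 * PI * Ci)) (2 * k + 1) <> 0%C) by (apply Cpow_nz, two_pi_i_nz).
  assert (E2 : cpoch s (2 * k + 1) = (cpoch s (2 * k) * (s + RtoC (INR (2 * k))))%C)
    by (rewrite Nat.add_1_r; reflexivity).
  rewrite E2 in E.
  unfold hankel_cofactor, neg_even.
  transitivity (Cpow (- (2 * PI * Ci)) (2 * k + 1) * hankel s / Cpow (- (2 * PI * Ci)) (2 * k + 1))%C.
  field; auto. rewrite E. unfold Cdiv. ring.
Qed.

(** At -2k the rising factorial is (2k)!, the argument of [hankel] is 1 and its value cancels one
    factor -2 pi i; the rest is (-2 pi i)^(2k) = (-1)^k (2 pi)^(2k). This number is the derivative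
    of [hankel] at the zero. *)
Lemma hankel_cofactor_neg_even k : hankel_cofactor k (neg_even k) = RtoC (dG_coef k).
Proof.
  unfold hankel_cofactor, neg_even. rewrite cpoch_fact.
  replace (- INR (2 * k) + INR (2 * k + 1))%C with (RtoC 1)
    by (rewrite plus_INR, RtoC_plus; simpl (INR 1); ring).
  rewrite hankel_1, Cpow_add_r, Cpow_1_r.
  assert (E : Cpow (- (2 * PI * Ci)) (2 * k) = RtoC ((-1) ^ k * (2 * PI) ^ (2 * k))).
  { rewrite Cpow_mult_r. replace (Cpow (- (2 * PI * Ci)) 2) with (RtoC (-1 * (2 * PI) ^ 2)).
    - rewrite <- RtoC_pow. f_equal. rewrite Rpow_mult_distr, <- pow_mult. reflexivity.
    - assert (I2 : (Ci * Ci)%C = RtoC (-1)) by (unfold Ci, RtoC, Cmult; simpl; f_equal; ring).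
      transitivity (2 * PI * (2 * PI) * (Ci * Ci))%C; [|simpl; ring].
      rewrite I2, <- !RtoC_mult. f_equal. ring. }
  rewrite E. unfold dG_coef. rewrite (pow_mult (-1) 2 k).
  replace ((-1) ^ 2) with 1 by ring. rewrite pow1, Rmult_1_l.
  assert (HP : (2 * PI) ^ (2 * k) <> 0) by (apply pow_nonzero; pose proof PI_ge_2; lra).
  assert (H1 : (-1) ^ k * (-1) ^ k = 1) by (rewrite <- Rpow_mult_distr; replace (-1 * -1) with 1 by ring; apply pow1).
  assert (H2 : (-1) ^ k <> 0) by (intros Z; rewrite Z in H1; lra).
  assert (H3 : RtoC ((-1) ^ k * (2 * PI) ^ (2 * k)) <> 0%C).
  { intros Z. apply RtoC_inj in Z. apply (Rmult_integral_contrapositive_currified _ _ H2 HP Z). }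
  transitivity (RtoC (INR (fact (2 * k))) / RtoC ((-1) ^ k * (2 * PI) ^ (2 * k)))%C.
  { field. split; auto. pose proof two_pi_i_nz as T. split.
    - apply Ci_nz. - intros Z. apply RtoC_inj in Z. pose proof PI_ge_2; lra. }
  rewrite <- RtoC_div by (apply Rmult_integral_contrapositive_currified; auto).
  f_equal. transitivity ((-1) ^ k * (-1) ^ k * INR (fact (2 * k)) / ((-1) ^ k * (2 * PI) ^ (2 * k))).
  rewrite H1, Rmult_1_l. reflexivity. field. auto.
Qed.

Lemma Cexd_cpoch n s : Cexd (fun s => cpoch s n) s.
Proof.
  induction n; simpl. apply Cexd_const. apply Cexd_mult; auto.
  apply Cexd_plus; [apply Cexd_id|apply Cexd_const].
Qed.

Lemma Cexd_hankel_cofactor k s : Cexd (hankel_cofactor k) s.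
Proof.
  unfold hankel_cofactor, Cdiv. apply Cexd_mult; [|apply Cexd_const]. apply Cexd_mult; [apply Cexd_cpoch|].
  apply (Cexd_comp hankel (fun s => s + RtoC (INR (2 * k + 1)))%C). apply hankel_entire.
  apply Cexd_plus; [apply Cexd_id|apply Cexd_const].
Qed.

Lemma Cder_eq f z d d' : Cder f z d -> d = d' -> Cder f z d'.
Proof. intros H <-. exact H. Qed.

Lemma hankel_neg_even k : hankel (neg_even k) = 0%C.
Proof. rewrite (hankel_factor k). ring. Qed.

Lemma Cder_hankel_neg_even k : Cder hankel (neg_even k) (RtoC (dG_coef k)).
Proof.
  destruct (Cexd_hankel_cofactor k (neg_even k)) as [d Hd].
  pose proof (Cder_mult (fun s => s - neg_even k)%C (hankel_cofactor k) (neg_even k) _ _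
    (Cder_minus (fun s => s) (fun _ => neg_even k) (neg_even k) _ _ (Cder_id _) (Cder_const (neg_even k) _)) Hd) as H.
  cbv beta in H. rewrite hankel_cofactor_neg_even in H.
  apply Cder_eps. intros e He. apply Cder_eps with (eps := e) in H; auto.
  destruct H as [de [Hde K]]. exists de. split; auto. intros w Hw. specialize (K w Hw).
  rewrite (hankel_factor k w), (hankel_factor k (neg_even k)), hankel_cofactor_neg_even. rewrite hankel_cofactor_neg_even in K.
  replace (RtoC (dG_coef k)) with ((1 - 0) * RtoC (dG_coef k) + (neg_even k - neg_even k) * d)%C at 2 by ring.
  exact K.
Qed.

Lemma Climit_bounded u l : Climit u l -> exists M, forall n, Cmod (u n) <= M.
Proof.
  intros H. destruct (H 1 Rlt_0_1) as [N HN].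
  assert (P : forall n, 0 <= rsum (fun i => Cmod (u i)) n).
  { induction n; simpl. lra. pose proof (Cmod_ge_0 (u n)). lra. }
  assert (Q : forall n m, (n < m)%nat -> Cmod (u n) <= rsum (fun i => Cmod (u i)) m).
  { intros n m Hnm. induction Hnm; simpl. specialize (P n). lra. pose proof (Cmod_ge_0 (u m)). lra. }
  exists (rsum (fun i => Cmod (u i)) N + Cmod l + 1). intros n.
  pose proof (Cmod_ge_0 l). destruct (le_lt_dec N n) as [L|L].
  - specialize (HN n L). pose proof (Cmod_rev_tri (u n) l). specialize (P N). lra.
  - specialize (Q n N L). lra.
Qed.

Definition neg_even_seq (k j : nat) : C := (neg_even k + RtoC (/ (INR j + 1)))%C.

Lemma inv_INR_lim : is_lim_seq (fun j => / (INR j + 1)) 0.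
Proof.
  replace (Finite 0) with (Rbar_inv p_infty) by reflexivity.
  apply is_lim_seq_inv; [|discriminate].
  apply (is_lim_seq_ext (fun n => INR (S n))). intros; apply S_INR.
  apply (is_lim_seq_incr_1 INR), is_lim_seq_INR.
Qed.

Lemma neg_even_seq_lim k : Climit (neg_even_seq k) (neg_even k).
Proof.
  apply (Climit_squeeze _ (fun _ => neg_even k) _ (fun j => / (INR j + 1))); auto using Climit_const, inv_INR_lim.
  intros j. unfold neg_even_seq. replace (neg_even k + RtoC (/ (INR j + 1)) - neg_even k)%C with (RtoC (/ (INR j + 1))) by ring.
  rewrite Cmod_R, Rabs_pos_eq. lra. apply Rlt_le, Rinv_0_lt_compat. pose proof (pos_INR j). lra.
Qed.

Lemma Cder_quotient_limit f z d (u : nat -> C) : Cder f z d -> Climit u z -> (forall n, u n <> z) ->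
  Climit (fun n => (f (u n) - f z) / (u n - z))%C d.
Proof.
  intros H Hu Hn e He. apply Cder_eps with (eps := e / 2) in H; [|lra].
  destruct H as [de [Hde K]]. destruct (Hu de Hde) as [N HN]. exists N. intros n Hnn.
  specialize (K (u n) (HN n Hnn)). specialize (Hn n).
  assert (P : (u n - z)%C <> 0%C) by (apply Cminus_eq_contra; auto).
  replace ((f (u n) - f z) / (u n - z) - d)%C with ((f (u n) - f z - d * (u n - z)) / (u n - z))%C
    by (field; auto).
  rewrite Cmod_div by auto. apply Cmod_gt_0 in P.
  apply Rle_lt_trans with (e / 2); [|lra].
  apply Rmult_le_reg_r with (Cmod (u n - z)); auto. unfold Rdiv at 1.
  rewrite Rmult_assoc, Rinv_l by lra. lra.
Qed.

(* [riemann_int s = hankel s * sum r^(s-1)] near [-2k]; the derivative of [riemann_int] at [-2k] is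
   the limit of the quotients at [neg_even_seq k j], where the sums are dominated by [sum r^-2]. *)
Lemma Cder_riemann_int_neg_even k : (1 <= k)%nat -> riemann_int (neg_even k) = 0%C /\
  exists d, Cder riemann_int (neg_even k) d /\
    Climit (csum (fun i => nat_pow (S i) (neg_even k) * RtoC (dG_coef k))%C) d.
Proof.
  intros Hk.
  assert (Hk2 : 2 <= INR (2 * k)) by (rewrite mult_INR; apply le_INR in Hk; simpl in *; lra).
  (* -2k lies in the half-plane Re s < 0, where every partial sum carries the vanishing factor
     [hankel (neg_even k)]. *)
  assert (Z0 : riemann_int (neg_even k) = 0%C).
  { apply (Climit_unique (csum (fun i => nat_pow (S i) (neg_even k) * hankel (neg_even k))%C)).
    - apply riemann_int_left. unfold neg_even. rewrite re_opp, re_RtoC. lra.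
    - eapply Climit_ext; [|apply Climit_const]. intros n. simpl. induction n; simpl; auto.
      rewrite <- IHn, hankel_neg_even. ring. }
  split; auto. destruct (riemann_int_entire (neg_even k)) as [d Hd]. exists d. split; auto.
  assert (Hj : forall j, 0 < / (INR j + 1) <= 1).
  { intros j. pose proof (pos_INR j). split. apply Rinv_0_lt_compat; lra.
    rewrite <- Rinv_1. apply Rinv_le_contravar; lra. }
  (* As k >= 1 and the offset is at most 1, |r^(s-1)| <= r^(-2) along the whole sequence. *)
  assert (Hre : forall j, Re (neg_even_seq k j) <= -1).
  { intros j. unfold neg_even_seq, neg_even. rewrite re_plus, re_opp, !re_RtoC. specialize (Hj j). lra. }
  assert (Hne : forall j, neg_even_seq k j <> neg_even k).
  { intros j E. apply (f_equal Re) in E. unfold neg_even_seq in E. rewrite re_plus, re_RtoC in E.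
    specialize (Hj j). lra. }
  assert (Lphi : Climit (fun j => hankel_cofactor k (neg_even_seq k j)) (RtoC (dG_coef k))).
  { rewrite <- hankel_cofactor_neg_even. apply (Climit_Ccont (hankel_cofactor k)). apply Cexd_cont, Cexd_hankel_cofactor. apply neg_even_seq_lim. }
  destruct (Climit_bounded _ _ Lphi) as [M HM].
  destruct (p_series_bounded 2 ltac:(lra)) as [U HU].
  assert (HM0 : 0 <= M) by (eapply Rle_trans; [apply Cmod_ge_0|apply (HM O)]).
  apply (tannery (fun j i => nat_pow (S i) (neg_even_seq k j) * hankel_cofactor k (neg_even_seq k j))%C
    (fun i => M * exp (- 2 * ln (INR (S i)))) (M * U) _
    (fun j => (riemann_int (neg_even_seq k j) - riemann_int (neg_even k)) / (neg_even_seq k j - neg_even k))%C).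
  - intros j i. rewrite Cmod_mult, Cmod_nat_pow, Rmult_comm. apply Rmult_le_compat; auto.
    apply Cmod_ge_0. apply Rlt_le, exp_pos. apply exp_le.
    pose proof (ln_INR_ge0 i). specialize (Hre j). nra.
  - intros n. rewrite rsum_scal. apply Rmult_le_compat_l; auto.
  - intros i.
    assert (L : Climit (fun j => nat_pow (S i) (neg_even_seq k j) * hankel_cofactor k (neg_even_seq k j))%C (nat_pow (S i) (neg_even k) * hankel_cofactor k (neg_even k))%C).
    { apply (Climit_Ccont (fun s => nat_pow (S i) s * hankel_cofactor k s)%C); [|apply neg_even_seq_lim].
      apply Cexd_cont, Cexd_mult; [|apply Cexd_hankel_cofactor]. unfold nat_pow. apply Cexd_Cexp.
      apply Cexd_mult; [|apply Cexd_const]. apply Cexd_minus; [apply Cexd_id|apply Cexd_const]. }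
    rewrite hankel_cofactor_neg_even in L. exact L.
  - intros j. specialize (Hre j). specialize (Hne j).
    assert (P : (neg_even_seq k j - neg_even k)%C <> 0%C) by (apply Cminus_eq_contra; auto).
    rewrite Z0.
    replace ((riemann_int (neg_even_seq k j) - 0) / (neg_even_seq k j - neg_even k))%C with (/ (neg_even_seq k j - neg_even k) * riemann_int (neg_even_seq k j))%C
      by (field; auto).
    eapply Climit_ext; [|apply Climit_scal, riemann_int_left; lra].
    intros n. cbv beta. rewrite <- csum_scal. apply csum_ext. intros i _.
    rewrite (hankel_factor k (neg_even_seq k j)). field. auto.
  - apply Cder_quotient_limit; auto. apply neg_even_seq_lim.
Qed.

(** * Unordered sums over pairs of integers *)

Definition lsum {I : Type} (f : I -> C) (L : list I) : C :=
  fold_right (fun i acc => f i + acc)%C (RtoC 0) L.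

Definition rlsum {I : Type} (f : I -> R) (L : list I) : R :=
  fold_right (fun i acc => f i + acc) 0 L.

Lemma lsum_app {I} (f : I -> C) A B : lsum f (A ++ B) = (lsum f A + lsum f B)%C.
Proof.
  unfold lsum. induction A; simpl. rewrite Cplus_0_l. reflexivity. rewrite IHA. ring.
Qed.

Lemma lsum_perm {I} (f : I -> C) A B : Permutation A B -> lsum f A = lsum f B.
Proof.
  unfold lsum. induction 1; simpl; try congruence. ring.
Qed.

Lemma rlsum_app {I} (f : I -> R) A B : rlsum f (A ++ B) = rlsum f A + rlsum f B.
Proof. unfold rlsum. induction A; simpl. ring. rewrite IHA. ring. Qed.

Lemma rlsum_perm {I} (f : I -> R) A B : Permutation A B -> rlsum f A = rlsum f B.
Proof. unfold rlsum. induction 1; simpl; lra. Qed.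

Lemma rlsum_nonneg {I} (f : I -> R) A : (forall i, 0 <= f i) -> 0 <= rlsum f A.
Proof. unfold rlsum. intros H. induction A; simpl. lra. specialize (H a). lra. Qed.

Lemma lsum_bound {I} (f : I -> C) (g : I -> R) A :
  (forall i, Cmod (f i) <= g i) -> Cmod (lsum f A) <= rlsum g A.
Proof.
  unfold lsum, rlsum. intros H. induction A; simpl. rewrite Cmod_0. lra.
  eapply Rle_trans; [apply Cmod_triangle|]. specialize (H a). lra.
Qed.

Lemma rlsum_scal {I} c (f : I -> R) A : rlsum (fun i => c * f i) A = c * rlsum f A.
Proof. unfold rlsum. induction A; simpl. ring. rewrite IHA. ring. Qed.

(** Isolates what a larger finite set adds, both for a finite set containing a box and for a box
    containing a finite set. *)
Lemma nodup_incl_split {I} (A L : list I) :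
  NoDup A -> NoDup L -> incl A L -> exists R, Permutation L (A ++ R) /\ NoDup (A ++ R).
Proof.
  intros HA HL Hi. revert L HL Hi. induction A as [|a A IH]; intros L HL Hi.
  - exists L. simpl. split; auto.
  - inversion HA as [|? ? Hna HndA]; subst.
    destruct (in_split a L (Hi a (or_introl eq_refl))) as [L1 [L2 E]]. subst L.
    assert (P : Permutation (L1 ++ a :: L2) (a :: (L1 ++ L2))) by (apply Permutation_sym, Permutation_middle).
    assert (N : NoDup (a :: (L1 ++ L2))) by (eapply Permutation_NoDup; eauto).
    inversion N as [|? ? Hnl HndL]; subst.
    destruct (IH HndA (L1 ++ L2) HndL) as [R [P2 N2]].
    { intros x Hx. assert (X : In x (L1 ++ a :: L2)) by (apply Hi; right; auto).
      apply (Permutation_in _ P) in X. destruct X as [X|X]; auto. subst x. contradiction. }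
    exists R. simpl. split.
    + eapply Permutation_trans; [exact P|]. constructor; auto.
    + constructor; auto. intros X. apply Hnl. eapply Permutation_in; [apply Permutation_sym; exact P2|auto].
Qed.

Fixpoint int_range (N : nat) : list Z :=
  match N with
  | O => 0%Z :: nil
  | S M => Z.of_nat N :: (- Z.of_nat N)%Z :: int_range M
  end.

Definition csym (f : Z -> C) (N : nat) : C :=
  (f 0%Z + csum (fun i => f (Z.of_nat (S i)) + f (- Z.of_nat (S i))%Z) N)%C.

Definition rsym (f : Z -> R) (N : nat) : R :=
  f 0%Z + rsum (fun i => f (Z.of_nat (S i)) + f (- Z.of_nat (S i))%Z) N.

Lemma lsum_int_range f N : lsum f (int_range N) = csym f N.
Proof.
  unfold csym. induction N. unfold lsum; simpl. ring.
  cbn [csum]. transitivity (f (Z.of_nat (S N)) + (f (- Z.of_nat (S N))%Z + lsum f (int_range N)))%C.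
  reflexivity. rewrite IHN. ring.
Qed.

Lemma rlsum_int_range f N : rlsum f (int_range N) = rsym f N.
Proof.
  unfold rsym. induction N. unfold rlsum; simpl. ring.
  cbn [rsum]. transitivity (f (Z.of_nat (S N)) + (f (- Z.of_nat (S N))%Z + rlsum f (int_range N))).
  reflexivity. rewrite IHN. ring.
Qed.

Lemma in_int_range m N : In m (int_range N) <-> (Z.abs m <= Z.of_nat N)%Z.
Proof.
  induction N. simpl. split; [intros [<-|[]]; lia|lia].
  cbn [int_range In]. rewrite IHN. lia.
Qed.

Lemma nodup_int_range N : NoDup (int_range N).
Proof.
  induction N. simpl. constructor; auto. constructor.
  cbn [int_range]. constructor.
  - cbn [In]. rewrite in_int_range. lia.
  - constructor; auto. rewrite in_int_range. lia.
Qed.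

Definition box (N : nat) : list (Z * Z) := list_prod (int_range N) (int_range N).

Lemma in_box p N : In p (box N) <-> In (fst p) (int_range N) /\ In (snd p) (int_range N).
Proof. destruct p. apply in_prod_iff. Qed.

Lemma nodup_list_prod {A B} (l : list A) (m : list B) : NoDup l -> NoDup m -> NoDup (list_prod l m).
Proof.
  intros Hl Hm. induction Hl; simpl. constructor.
  apply NoDup_app; auto.
  - apply FinFun.Injective_map_NoDup; auto. intros a b E. congruence.
  - intros [a b] H1 H2. apply in_map_iff in H1. destruct H1 as [y [E _]]. inversion E; subst.
    apply in_prod_iff in H2. tauto.
Qed.

Lemma lsum_map {A B} (f : B -> C) (g : A -> B) (m : list A) :
  lsum f (map g m) = lsum (fun y => f (g y)) m.
Proof. unfold lsum. induction m; simpl. reflexivity. rewrite IHm. reflexivity. Qed.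

Lemma rlsum_map {A B} (f : B -> R) (g : A -> B) (m : list A) :
  rlsum f (map g m) = rlsum (fun y => f (g y)) m.
Proof. unfold rlsum. induction m; simpl. reflexivity. rewrite IHm. reflexivity. Qed.

Lemma lsum_list_prod {A B} (f : A * B -> C) (l : list A) (m : list B) :
  lsum f (list_prod l m) = lsum (fun x => lsum (fun y => f (x, y)) m) l.
Proof.
  induction l; simpl. reflexivity. rewrite lsum_app, lsum_map, IHl. reflexivity.
Qed.

Lemma rlsum_list_prod {A B} (f : A -> R) (g : B -> R) (l : list A) (m : list B) :
  rlsum (fun p => f (fst p) * g (snd p)) (list_prod l m) = rlsum f l * rlsum g m.
Proof.
  induction l; simpl. unfold rlsum; simpl; ring.
  rewrite rlsum_app, rlsum_map, IHl. cbn [fst snd]. rewrite rlsum_scal.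
  unfold rlsum; simpl; ring.
Qed.

Lemma list_in_box (L : list (Z * Z)) : exists M, incl L (box M).
Proof.
  induction L as [|[m n] L [M HM]].
  - exists O. intros x [].
  - exists (M + Z.to_nat (Z.abs m) + Z.to_nat (Z.abs n))%nat.
    intros p Hp. rewrite in_box, !in_int_range. destruct Hp as [<-|Hp].
    + simpl. lia.
    + apply HM in Hp. rewrite in_box, !in_int_range in Hp. lia.
Qed.

Lemma csym_ext f g N : (forall m, f m = g m) -> csym f N = csym g N.
Proof.
  intros H. unfold csym. rewrite H. f_equal. apply csum_ext. intros. rewrite !H. reflexivity.
Qed.

Lemma csym_minus f g N : csym (fun m => f m - g m)%C N = (csym f N - csym g N)%C.
Proof.
  unfold csym. rewrite (csum_ext _ (fun i => (f (Z.of_nat (S i)) + f (- Z.of_nat (S i))%Z)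
     - (g (Z.of_nat (S i)) + g (- Z.of_nat (S i))%Z))%C). rewrite csum_minus. ring.
  intros. ring.
Qed.

Lemma csym_bound f g N : (forall m, Cmod (f m) <= g m) -> Cmod (csym f N) <= rsym g N.
Proof. intros H. rewrite <- lsum_int_range, <- rlsum_int_range. apply lsum_bound; auto. Qed.

(** The product majorant controls everything outside a square box, in any finite set, by a
    difference of squares of one-dimensional sums. Inside the box only the row tails separate the
    sum from the symmetric sum of the row limits. *)
Lemma usum_by_rows (a : Z * Z -> C) (A : Z -> C) (v : nat -> R) (K U : R) (l : C) :
  0 <= K -> (forall i, 0 <= v i) -> (forall n, rsum v n <= U) ->
  (forall m n, Cmod (a (m, n)) <= K * (v (Z.abs_nat m) * v (Z.abs_nat n))) ->
  (forall m, Climit (csym (fun n => a (m, n))) (A m)) -> Climit (csym A) l -> is_usum a l.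
Proof.
  intros HK Hv HU Ha HA Hl e He.
  assert (HU0 : 0 <= U) by (eapply Rle_trans; [|apply (HU O)]; simpl; lra).
  set (u := fun m : Z => v (Z.abs_nat m)).
  assert (Hu0 : forall m, 0 <= u m) by (intros; apply Hv).
  assert (Eu : forall i, u (Z.of_nat (S i)) + u (- Z.of_nat (S i))%Z = 2 * v (S i)).
  { intros i. unfold u. replace (Z.abs_nat (Z.of_nat (S i))) with (S i) by lia.
    replace (Z.abs_nat (- Z.of_nat (S i))) with (S i) by lia. ring. }
  assert (Es : forall N, rsym u N = 2 * rsum v (S N) - v O).
  { intros N. unfold rsym. induction N. simpl. unfold u; simpl. ring.
    cbn [rsum] in *. rewrite Eu. lra. }
  assert (HuU : forall N, rsym u N <= 2 * U).
  { intros N. rewrite Es. specialize (HU (S N)). specialize (Hv O). lra. }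
  assert (Hu1 : forall N, 0 <= rsym u N).
  { intros N. rewrite <- rlsum_int_range. apply rlsum_nonneg; auto. }
  (* The budget: at most 8 K U d <= e / 2 outside the box, 4 K U d <= e / 4 for the row tails, and
     less than e / 4 for the sum over the rows. *)
  set (d := e / (16 * (K + 1) * (U + 1))).
  assert (Hd : 0 < d) by (apply Rdiv_lt_0_compat; auto; nra).
  assert (Ed : K * U * d <= e / 16).
  { apply Rle_trans with ((K + 1) * (U + 1) * d).
    - apply Rmult_le_compat_r; [lra|]. nra.
    - unfold d. right. field. lra. }
  destruct (bounded_tail v U Hv HU d Hd) as [N1 HN1].
  destruct (Hl (e/4) ltac:(lra)) as [N2 HN2].
  set (N := max N1 N2).
  assert (Htail : forall M, (N <= M)%nat -> rsym u M - rsym u N <= 2 * d).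
  { intros M HM. rewrite !Es. pose proof (HN1 (S N) (S M) ltac:(lia) ltac:(lia)). lra. }
  exists (box N). intros L HL Hi. change (Cmod (lsum a L - l) < e).
  destruct (nodup_incl_split (box N) L) as [R [P NR]]; auto.
  { apply nodup_list_prod; apply nodup_int_range. }
  rewrite (lsum_perm _ _ _ P), lsum_app.
  set (w := fun p : Z * Z => u (fst p) * u (snd p)).
  assert (BR : Cmod (lsum a R) <= K * (8 * U * d)).
  { eapply Rle_trans; [apply (lsum_bound a (fun p => K * w p))|].
    - intros [m n]. apply Ha.
    - rewrite rlsum_scal. apply Rmult_le_compat_l; auto.
      (* All points lie in a box of size M, so the majorant on [R] is at most the square of
         [rsym u M] minus that of [rsym u N], a small difference times a bounded sum. *)
      destruct (list_in_box (box N ++ R)) as [M0 HM0]. set (M := max M0 N).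
      assert (HM : incl (box N ++ R) (box M)).
      { intros p Hp. apply HM0 in Hp. rewrite in_box, !in_int_range in *. lia. }
      destruct (nodup_incl_split (box N ++ R) (box M)) as [Q [P2 _]]; auto.
      { apply nodup_list_prod; apply nodup_int_range. }
      apply (rlsum_perm w) in P2. rewrite !rlsum_app in P2.
      assert (Eb : forall N, rlsum w (box N) = rsym u N * rsym u N).
      { intros n. unfold w, box. rewrite rlsum_list_prod, rlsum_int_range. reflexivity. }
      rewrite !Eb in P2.
      assert (0 <= rlsum w Q). { apply rlsum_nonneg. intros p. apply Rmult_le_pos; apply Hu0. }
      pose proof (Htail M ltac:(lia)). pose proof (HuU M). pose proof (HuU N).
      pose proof (Hu1 M). pose proof (Hu1 N).
      assert (rsym u N <= rsym u M).
      { rewrite !Es.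
        assert (forall n m, (n <= m)%nat -> rsum v n <= rsum v m).
        { intros n0 m0 H5. induction H5; [lra|]. simpl. specialize (Hv m). lra. }
        specialize (H5 (S N) (S M) ltac:(lia)). lra. }
      assert ((rsym u M - rsym u N) * (rsym u M + rsym u N) <= 2 * d * (4 * U)).
      { apply Rmult_le_compat; lra. }
      nra. }
  assert (BB : Cmod (lsum a (box N) - csym A N) <= K * (4 * U * d)).
  { unfold box. rewrite lsum_list_prod, lsum_int_range.
    assert (E : csym (fun x => lsum (fun y => a (x, y)) (int_range N)) N = csym (fun x => csym (fun y => a (x, y)) N) N).
    { apply csym_ext. intros. apply lsum_int_range. }
    rewrite E, <- csym_minus.
    apply Rle_trans with (rsym (fun m => 2 * K * d * u m) N).
    - apply csym_bound. intros m. rewrite Cmod_sub_sym. unfold csym at 1.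
      pose proof (csum_limit_tail (fun i => a (m, Z.of_nat (S i)) + a (m, - Z.of_nat (S i))%Z)%C
        (fun i => (K * u m) * (2 * v (S i))) (A m - a (m, 0%Z))%C N (2 * K * d * u m)) as T.
      replace (A m - (a (m, 0%Z) + csum (fun i => a (m, Z.of_nat (S i)) + a (m, (- Z.of_nat (S i))%Z)) N))%C
        with (A m - a (m, 0%Z) - csum (fun i => a (m, Z.of_nat (S i)) + a (m, (- Z.of_nat (S i))%Z)) N)%C by ring.
      apply T.
      + intros i. eapply Rle_trans; [apply Cmod_triangle|]. rewrite <- Eu.
        pose proof (Ha m (Z.of_nat (S i))). pose proof (Ha m (- Z.of_nat (S i))%Z). unfold u. nra.
      + eapply Climit_ext; [|apply Climit_minus; [apply (HA m)|apply (Climit_const (a (m, 0%Z)))]].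
        intros n. cbv beta. unfold csym. ring.
      + intros M HM. rewrite !rsum_scal.
        assert (X : 2 * rsum (fun i => v (S i)) M - 2 * rsum (fun i => v (S i)) N <= 2 * d).
        { assert (Y : forall n, 2 * rsum (fun i => v (S i)) n = rsym u n - v O).
          { intros n. rewrite <- rsum_scal. unfold rsym.
            replace (rsum (fun i => u (Z.of_nat (S i)) + u (- Z.of_nat (S i))%Z) n) with
              (rsum (fun i => 2 * v (S i)) n). unfold u; simpl; ring.
            clear. induction n; cbn [rsum]; auto. rewrite IHn. f_equal.
            unfold u. replace (Z.abs_nat (Z.of_nat (S n))) with (S n) by lia.
            replace (Z.abs_nat (- Z.of_nat (S n))) with (S n) by lia. ring. }
          rewrite !Y. pose proof (Htail M HM). lra. }
        assert (0 <= K * u m) by (apply Rmult_le_pos; auto). nra.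
    - rewrite <- rlsum_int_range, rlsum_scal, rlsum_int_range.
      assert (0 <= 2 * K * d) by nra. pose proof (HuU N). nra. }
  replace (lsum a (box N) + lsum a R - l)%C with
    (lsum a R + (lsum a (box N) - csym A N) + (csym A N - l))%C by ring.
  eapply Rle_lt_trans; [apply Cmod_triangle|].
  eapply Rle_lt_trans; [apply Rplus_le_compat_r, Cmod_triangle|].
  specialize (HN2 N ltac:(lia)). lra.
Qed.

(** * The analytic continuation *)

(** [larg] lies between -pi/2 and 3 pi/2; a nonnegative sine confines it to [0, pi], where [acos]
    inverts the cosine. *)
Lemma larg_acos w : slit w -> 0 <= Im w -> larg w = acos (Re w / Cmod w).
Proof.
  intros H Hi. pose proof (slit_nz w H) as P. pose proof (Cexp_lg w H) as E.
  unfold Cexp, lg in E; simpl in E. rewrite exp_ln in E by auto.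
  assert (E1 : Cmod w * cos (larg w) = Re w) by exact (f_equal Re E).
  assert (E2 : Cmod w * sin (larg w) = Im w) by exact (f_equal Im E).
  assert (R : - PI / 2 < larg w < 3 * (PI / 2)).
  { unfold larg. pose proof (atan_bound (- Re w / (Cmod w + Im w))). lra. }
  pose proof PI_RGT_0.
  assert (S : 0 <= sin (larg w)) by nra.
  assert (R2 : 0 <= larg w <= PI).
  { split; apply Rnot_lt_le; intros L.
    - assert (sin (larg w) < 0) by (apply sin_lt_0_var; lra). lra.
    - assert (sin (larg w) < 0) by (apply sin_lt_0; lra). lra. }
  rewrite <- E1. replace (Cmod w * cos (larg w) / Cmod w) with (cos (larg w)) by (field; lra).
  rewrite acos_cos; auto.
Qed.

Lemma Cpower_upper w s : 0 < Im w -> Cpower w (- s) = pw w s.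
Proof.
  intros H. unfold Cpower, pw. do 2 f_equal. unfold Clog, lg. f_equal.
  unfold Carg. destruct (Rlt_dec 0 (Im w)); [|contradiction].
  symmetry. apply larg_acos; [apply slit_intro; auto|lra].
Qed.

Definition exp_pi_i (s : C) : C := Cexp (PI * Ci * s).

(** -w falls in the second branch of [Carg], and -acos (-x) = acos x - pi. The real axis is
    included: w > 0 gives -w the argument -pi, and w < 0 gives it 0. *)
Lemma Cpower_lower w s : slit w -> 0 <= Im w -> Cpower (- w) (- s) = (exp_pi_i s * pw w s)%C.
Proof.
  intros H Hi. unfold Cpower, pw, exp_pi_i. rewrite <- Cexp_plus. f_equal.
  assert (E : Clog (- w) = (lg w - PI * Ci)%C).
  { unfold Clog, lg. rewrite Cmod_opp.
    replace (Carg (- w)) with (larg w - PI).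
    - unfold RtoC, Ci, Cminus, Cplus, Copp, Cmult; simpl. f_equal; ring.
    - unfold Carg. rewrite im_opp, re_opp, Cmod_opp. destruct (Rlt_dec 0 (- Im w)); [lra|].
      rewrite (larg_acos w H Hi). replace (- Re w / Cmod w) with (- (Re w / Cmod w)) by (unfold Rdiv; ring).
      rewrite acos_opp. ring. }
  rewrite E. ring.
Qed.

Lemma Cmod_Cpower z s : Cmod (Cpower z (- s)) <= exp (PI * Rabs (Im s)) * exp (- Re s * ln (Cmod z)).
Proof.
  unfold Cpower. rewrite Cmod_Cexp, <- exp_plus. apply exp_le.
  rewrite re_mult, re_opp, im_opp. unfold Clog; simpl.
  assert (B : Rabs (Carg z) <= PI).
  { unfold Carg. pose proof (acos_bound (Re z / Cmod z)). apply Rabs_le.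
    destruct (Rlt_dec 0 (Im z)); lra. }
  pose proof (Rle_abs (Im s * Carg z)) as A. rewrite Rabs_mult in A.
  pose proof (Rabs_pos (Im s)). nra.
Qed.

(** The imaginary part bounds |m| by |z| / Im tau, then the real part bounds |n|. Since |m| + |n| >=
    1 away from the origin, doubling the constants pays for the two summands 1. *)
Lemma lattice_lower_bound tau : 0 < Im tau -> exists D, 0 < D /\ forall m n : Z,
  (m, n) <> (0, 0)%Z ->
  IZR (Z.abs m) + 1 <= D * Cmod (RtoC (IZR m) * tau + RtoC (IZR n)) /\
  IZR (Z.abs n) + 1 <= D * Cmod (RtoC (IZR m) * tau + RtoC (IZR n)).
Proof.
  intros Hy. set (y := Im tau) in *. set (x := Re tau).
  set (D := 2 / y + 2 + 2 * (Rabs x / y)).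
  pose proof (Rabs_pos x). assert (Hi : 0 < / y) by (apply Rinv_0_lt_compat; auto).
  assert (Hxy : 0 <= Rabs x / y) by (apply Rmult_le_pos; lra).
  exists D. split. { unfold D, Rdiv in *. lra. }
  intros m n Hmn. set (z := (RtoC (IZR m) * tau + RtoC (IZR n))%C).
  rewrite !abs_IZR.
  assert (HI : Im z = IZR m * y) by (unfold z; rewrite im_plus, im_scal_l, im_RtoC; fold y; ring).
  assert (HR : Re z = IZR m * x + IZR n) by (unfold z; rewrite re_plus, re_scal_l, re_RtoC; reflexivity).
  pose proof (im_le_Cmod z) as A. pose proof (re_le_Cmod z) as B. rewrite HI, Rabs_mult in A. rewrite HR in B.
  rewrite (Rabs_pos_eq y) in A by lra.
  set (M := Rabs (IZR m)) in *. set (Nn := Rabs (IZR n)). assert (0 <= M) by apply Rabs_pos.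
  assert (0 <= Nn) by apply Rabs_pos.
  assert (A2 : M <= Cmod z / y).
  { apply Rmult_le_reg_r with y; auto. unfold Rdiv. rewrite Rmult_assoc, Rinv_l; lra. }
  assert (B2 : Nn <= Cmod z + M * Rabs x).
  { unfold Nn. replace (IZR n) with ((IZR m * x + IZR n) + - (IZR m * x)) by ring.
    eapply Rle_trans; [apply Rabs_triang|]. rewrite Rabs_Ropp, Rabs_mult. fold M. lra. }
  assert (B3 : M * Rabs x <= Cmod z * (Rabs x / y)).
  { replace (Cmod z * (Rabs x / y)) with (Cmod z / y * Rabs x) by (unfold Rdiv; ring).
    apply Rmult_le_compat_r; auto. }
  assert (S : 1 <= M + Nn).
  { unfold M, Nn. rewrite <- !abs_IZR, <- plus_IZR. apply IZR_le.
    destruct (Z.eq_dec m 0) as [->|]; [|lia]. destruct (Z.eq_dec n 0) as [->|]; [|lia]. elim Hmn; auto. }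
  pose proof (Cmod_ge_0 z). assert (0 <= Cmod z / y) by (apply Rmult_le_pos; lra).
  assert (0 <= Cmod z * (Rabs x / y)) by (apply Rmult_le_pos; auto).
  replace (D * Cmod z) with (2 * (Cmod z / y) + 2 * Cmod z + 2 * (Cmod z * (Rabs x / y)))
    by (unfold D, Rdiv; ring).
  split; lra.
Qed.

(** |z|^(-Re s) is shared equally between the two indices; each factor is summable as soon as Re s /
    2 > 1, which is the condition Re s > 2. *)
Lemma eis_term_bound s tau : 0 < Im tau -> 0 < Re s -> exists K, 0 <= K /\ forall m n : Z,
  Cmod (eis_term s tau (m, n)) <=
  K * (exp (- (Re s / 2) * ln (INR (S (Z.abs_nat m)))) * exp (- (Re s / 2) * ln (INR (S (Z.abs_nat n))))).
Proof.
  intros Hy Hs. destruct (lattice_lower_bound tau Hy) as [D [HD HB]].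
  exists (exp (PI * Rabs (Im s)) * exp (Re s * ln D)).
  split. { apply Rmult_le_pos; apply Rlt_le, exp_pos. }
  intros m n. unfold eis_term.
  destruct (Z.eqb m 0 && Z.eqb n 0)%bool eqn:E.
  - rewrite Cmod_0. repeat apply Rmult_le_pos; apply Rlt_le, exp_pos.
  - assert (Hmn : (m, n) <> (0, 0)%Z).
    { intros Q. inversion Q; subst. simpl in E. discriminate. }
    destruct (HB m n Hmn) as [B1 B2]. set (z := (RtoC (IZR m) * tau + RtoC (IZR n))%C) in *.
    assert (C1 : forall q : Z, INR (S (Z.abs_nat q)) = IZR (Z.abs q) + 1).
    { intros q. rewrite S_INR, INR_IZR_INZ, Zabs2Nat.id_abs. reflexivity. }
    rewrite !C1.
    assert (P : forall q : Z, 0 < IZR (Z.abs q) + 1).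
    { intros q. pose proof (IZR_le 0 (Z.abs q) ltac:(lia)). lra. }
    assert (Hz : 0 < Cmod z).
    { specialize (P m). pose proof (Cmod_ge_0 z). nra. }
    eapply Rle_trans; [apply Cmod_Cpower|]. rewrite <- !exp_plus. apply exp_le.
    assert (L1 : ln (IZR (Z.abs m) + 1) <= ln D + ln (Cmod z)).
    { rewrite <- ln_mult by auto. apply ln_le; auto. }
    assert (L2 : ln (IZR (Z.abs n) + 1) <= ln D + ln (Cmod z)).
    { rewrite <- ln_mult by auto. apply ln_le; auto. }
    nra.
Qed.

Lemma csum_pow_geom (c x : C) M : x <> 1%C ->
  csum (fun m => c * Cpow x (S m))%C M = (c * (x / (1 - x)) * (1 - Cpow x M))%C.
Proof.
  intros H. assert (1 - x <> 0)%C by (apply Cminus_eq_contra; auto).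
  induction M. simpl. ring. cbn [csum]. rewrite IHM, !Cpow_S. field. auto.
Qed.

Lemma csum_exchange (f : nat -> nat -> C) M N :
  csum (fun m => csum (f m) N) M = csum (fun n => csum (fun m => f m n) M) N.
Proof.
  induction M; cbn [csum].
  - induction N; simpl; auto. rewrite <- IHN. ring.
  - rewrite IHM, <- csum_plus. reflexivity.
Qed.

Definition row (s z : C) : C := epsilon (inhabits (RtoC 0)) (Climit (csum (fourier_term s z))).

Lemma row_spec s z : 0 < Im z ->
  Climit (csum (fourier_term s z)) (row s z) /\
  (1 < Re s -> Climit (fun N => csum (fun j => pw (z + RtoC (INR j - INR N)) s) (2 * N + 1)) (row s z)).
Proof.
  intros Hz. set (b := Rmin 1 (Im z / 2)).
  assert (Hb : 0 < b) by (apply Rmin_pos; lra).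
  assert (b <= 1) by apply Rmin_l. assert (b <= Im z / 2) by apply Rmin_r.
  pose proof (fourier s z b ltac:(lra) ltac:(lra)) as F.
  assert (S : Climit (csum (fourier_term s z)) (row s z)).
  { unfold row. apply epsilon_spec. eexists; exact F. }
  split; auto. intros Hs. rewrite (Climit_unique _ _ _ S F). apply lattice_row; auto; lra.
Qed.

Lemma fourier_term_mul s tau m i :
  fourier_term s (RtoC (INR (S m)) * tau) i =
  (nat_pow (S i) s * hankel s * Cpow (Cpow (nome tau) (S i)) (S m))%C.
Proof.
  unfold fourier_term. rewrite !nome_INR_mul, <- !Cpow_mult_r, (Nat.mul_comm (S i)). ring.
Qed.

(** For finitely many rows the order of summation is exchanged, and the geometric sum over m < M
    differs from the full one by the factor 1 - q^(r M). The deviation is at most a constant times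
    rho^M, uniformly in the number of Fourier terms. *)
Lemma rows_sum s tau : 0 < Im tau ->
  Climit (csum (fun m => row s (RtoC (INR (S m)) * tau))) (hankel s * lambert tau s)%C.
Proof.
  intros Hy. pose proof (rho_bounds tau Hy) as Hr.
  destruct (lambert_majorant_bounded tau (Cmod (s - 1)) Hy (Cmod_ge_0 _)) as [U HU].
  assert (HU0 : 0 <= U) by apply (HU O).
  apply (Climit_squeeze _ (fun _ => hankel s * lambert tau s)%C _ (fun M => Cmod (hankel s) * U * rho tau ^ M)).
  - intros M.
    apply (Climit_le (fun R => csum (fun m => csum (fourier_term s (RtoC (INR (S m)) * tau)) R) M
       - hankel s * csum (lambert_term tau s) R)%C).
    + intros R. rewrite csum_exchange.
      rewrite (csum_ext _ (fun i => hankel s * lambert_term tau s i * (1 - Cpow (Cpow (nome tau) (S i)) M))%C).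
      2:{ intros i _. rewrite (csum_ext _ (fun m => (nat_pow (S i) s * hankel s) * Cpow (Cpow (nome tau) (S i)) (S m))%C).
          - rewrite csum_pow_geom. unfold lambert_term. ring.
            intros E. apply (one_sub_nome_pow_nz tau i Hy). rewrite E. ring.
          - intros m _. apply fourier_term_mul. }
      rewrite <- csum_scal, <- csum_minus.
      pose proof (csum_tail (fun i => hankel s * lambert_term tau s i * (1 - Cpow (Cpow (nome tau) (S i)) M)
         - hankel s * lambert_term tau s i)%C
         (fun i => Cmod (hankel s) * rho tau ^ M *
            (exp (Cmod (s - 1) * ln (INR (S i))) * (rho tau ^ S i / (1 - rho tau)))) 0 R) as T.
      simpl csum at 2 in T. simpl rsum at 2 in T. rewrite rsum_scal in T.
      match goal with |- Cmod ?e <= _ => replace e with (e - 0)%C by ring end.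
      eapply Rle_trans; [apply T; [|lia]|].
      * intros i.
        replace (hankel s * lambert_term tau s i * (1 - Cpow (Cpow (nome tau) (S i)) M) - hankel s * lambert_term tau s i)%C
          with (- (hankel s * (Cpow (Cpow (nome tau) (S i)) M) * lambert_term tau s i))%C by ring.
        rewrite Cmod_opp, !Cmod_mult.
        apply Rmult_le_compat; try apply Cmod_ge_0.
        { apply Rmult_le_pos; apply Cmod_ge_0. }
        { apply Rmult_le_compat_l; [apply Cmod_ge_0|]. rewrite Cmod_pow, nome_pow_mod.
          apply pow_incr. split. apply pow_le; lra. apply pow_S_le; auto. }
        { apply lambert_term_bound; auto. }
      * rewrite Rminus_0_r.
        replace (Cmod (hankel s) * U * rho tau ^ M) with (Cmod (hankel s) * rho tau ^ M * U) by ring.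
        apply Rmult_le_compat_l; auto. apply Rmult_le_pos. apply Cmod_ge_0. apply pow_le; lra.
    + apply Climit_minus; [|apply Climit_scal, lambert_spec; auto].
      clear HU. induction M; cbn [csum]. apply Climit_const. apply Climit_plus; auto.
      apply row_spec. rewrite im_scal_l. apply Rmult_lt_0_compat; auto. apply lt_0_INR; lia.
  - apply is_lim_seq_scal_0, is_lim_seq_geom. rewrite Rabs_pos_eq; lra.
  - apply Climit_const.
Qed.

(** The first summand is the row m = 0; the second collects the rows m > 0 with factor 1 and the
    rows m < 0 with factor e^(i pi s). *)
Definition eis_cont (tau s : C) : C :=
  (exp_pi_i s * riemann_int s + (1 + exp_pi_i s) * (hankel s * lambert tau s))%C.

Definition row_value (s tau : C) (m : Z) : C :=
  match m with
  | Z0 => (exp_pi_i s * riemann_int s)%C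
  | Zpos p => row s (RtoC (IZR m) * tau)
  | Zneg p => (exp_pi_i s * row s (RtoC (IZR (- m)) * tau))%C
  end.

Lemma csym_lattice (s z : C) N :
  csym (fun n => pw (z + RtoC (IZR n)) s) N = csum (fun j => pw (z + RtoC (INR j - INR N)) s) (2 * N + 1).
Proof.
  rewrite (csum_symmetric (fun x => pw (z + RtoC x) s)). unfold csym. f_equal.
  apply csum_ext. intros i _. rewrite opp_IZR, <- INR_IZR_INZ. reflexivity.
Qed.

Lemma csym_flip (f : Z -> C) N : csym (fun n => f (- n)%Z) N = csym f N.
Proof.
  unfold csym. f_equal. apply csum_ext. intros. rewrite Z.opp_involutive. ring.
Qed.

Lemma csym_scal c f N : csym (fun n => c * f n)%C N = (c * csym f N)%C.
Proof.
  unfold csym.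
  rewrite (csum_ext _ (fun i => c * (f (Z.of_nat (S i)) + f (- Z.of_nat (S i))%Z))%C) by (intros; ring).
  rewrite csum_scal. ring.
Qed.

Lemma eis_row s tau m : 0 < Im tau -> 1 < Re s ->
  Climit (csym (fun n => eis_term s tau (m, n))) (row_value s tau m).
Proof.
  intros Hy Hs.
  assert (Hpos : forall p, 0 < IZR (Zpos p)) by (intros; apply IZR_lt; lia).
  assert (Hz : forall p, 0 < Im (RtoC (IZR (Zpos p)) * tau)).
  { intros p. rewrite im_scal_l. apply Rmult_lt_0_compat; auto. }
  destruct m as [|p|p]; unfold row_value.
  - apply Climit_ext with (fun N => exp_pi_i s *
      csum (fun i => pw (RtoC (INR (S i))) s + pw (RtoC (- INR (S i))) s) N)%C.
    2:{ apply Climit_scal, riemann_int_right; auto. }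
    intros N. unfold csym. unfold eis_term at 1. simpl (Z.eqb 0 0 && Z.eqb 0 0)%bool. cbn iota.
    rewrite Cplus_0_l, <- csum_scal. apply csum_ext. intros i _. unfold eis_term.
    assert (Hi : 0 < INR (S i)) by (apply lt_0_INR; lia).
    replace (Z.eqb 0 0 && Z.eqb (Z.of_nat (S i)) 0)%bool with false by reflexivity.
    replace (Z.eqb 0 0 && Z.eqb (- Z.of_nat (S i)) 0)%bool with false by reflexivity.
    rewrite opp_IZR, <- INR_IZR_INZ.
    (* Both real points n and -n are written as minus a point of the closed upper half-plane; the
       flip exchanges the two terms of the symmetric sum. *)
    replace (RtoC 0 * tau + RtoC (INR (S i)))%C with (- RtoC (- INR (S i)))%C by (rewrite RtoC_opp; ring).
    replace (RtoC 0 * tau + RtoC (- INR (S i)))%C with (- RtoC (INR (S i)))%C by (rewrite RtoC_opp; ring).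
    rewrite !Cpower_lower; try (apply slit_intro; left; rewrite re_RtoC; lra);
      try (rewrite im_RtoC; lra).
    ring.
  - apply Climit_ext with (fun N => csum (fun j => pw (RtoC (IZR (Z.pos p)) * tau + RtoC (INR j - INR N)) s) (2 * N + 1)).
    2:{ apply row_spec; auto. }
    intros N. rewrite <- csym_lattice. apply csym_ext. intros n. unfold eis_term. simpl andb.
    symmetry. apply Cpower_upper. rewrite im_plus, im_RtoC, Rplus_0_r. auto.
  - set (z := (RtoC (IZR (- Zneg p)) * tau)%C).
    apply Climit_ext with (fun N => exp_pi_i s * csum (fun j => pw (z + RtoC (INR j - INR N)) s) (2 * N + 1))%C.
    2:{ apply Climit_scal. apply row_spec; auto. apply (Hz p). }
    (* For m < 0 one has m tau + n = -(|m| tau - n), so the index is reversed before the terms are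
       compared. *)
    intros N. rewrite <- csym_lattice, <- csym_flip, <- csym_scal. apply csym_ext. intros n.
    unfold eis_term. simpl andb. symmetry.
    replace (RtoC (IZR (Zneg p)) * tau + RtoC (IZR n))%C with (- (z + RtoC (IZR (- n))))%C.
    2:{ unfold z. rewrite !opp_IZR, !RtoC_opp. ring. }
    assert (0 < Im (z + RtoC (IZR (- n)))) by (rewrite im_plus, im_RtoC, Rplus_0_r; apply (Hz p)).
    apply Cpower_lower. apply slit_intro; auto. lra.
Qed.

Lemma eis_cont_usum tau s : 0 < Im tau -> 2 < Re s -> is_usum (eis_term s tau) (eis_cont tau s).
Proof.
  intros Hy Hs. destruct (eis_term_bound s tau Hy ltac:(lra)) as [K [HK HB]].
  destruct (p_series_bounded (Re s / 2) ltac:(lra)) as [U HU].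
  apply (usum_by_rows (eis_term s tau) (row_value s tau)
    (fun i => exp (- (Re s / 2) * ln (INR (S i)))) K U); auto.
  - intros i. apply Rlt_le, exp_pos.
  - intros m. apply eis_row; auto; lra.
  - unfold csym, eis_cont. cbn [row_value]. apply Climit_plus; [apply Climit_const|].
    apply Climit_ext with (fun N => (1 + exp_pi_i s) * csum (fun m => row s (RtoC (INR (S m)) * tau)) N)%C.
    2:{ apply Climit_scal, rows_sum; auto. }
    intros N. rewrite <- csum_scal. apply csum_ext. intros i _.
    assert (E : IZR (Z.pos (Pos.of_succ_nat i)) = INR (S i)).
    { rewrite INR_IZR_INZ. reflexivity. }
    cbn [Z.of_nat Z.opp row_value]. rewrite E. ring.
Qed.

Lemma exp_pi_i_entire : entire exp_pi_i.
Proof. intros s. unfold exp_pi_i. apply Cexd_Cexp, Cexd_mult; [apply Cexd_const|apply Cexd_id]. Qed.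

Lemma eis_cont_entire tau : 0 < Im tau -> entire (eis_cont tau).
Proof.
  intros Hy s. unfold eis_cont. apply Cexd_plus.
  - apply Cexd_mult; [apply exp_pi_i_entire|apply riemann_int_entire].
  - apply Cexd_mult; [apply Cexd_plus; [apply Cexd_const|apply exp_pi_i_entire]|].
    apply Cexd_mult; [apply hankel_entire|apply lambert_entire; auto].
Qed.

Lemma is_usum_unique {I} (dec : forall x y : I, {x = y} + {x <> y}) (a : I -> C) l1 l2 :
  is_usum a l1 -> is_usum a l2 -> l1 = l2.
Proof.
  intros H1 H2. apply Cmod_lt_imp_eq. intros e He.
  destruct (H1 (e/2) ltac:(lra)) as [L1 K1]. destruct (H2 (e/2) ltac:(lra)) as [L2 K2].
  set (L := nodup dec (L1 ++ L2)).
  assert (N : NoDup L) by apply NoDup_nodup.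
  specialize (K1 L N ltac:(intros x Hx; apply nodup_In, in_or_app; auto)).
  specialize (K2 L N ltac:(intros x Hx; apply nodup_In, in_or_app; auto)).
  rewrite Cmod_sub_sym in K1.
  pose proof (Cmod_tri3 l1 (fold_right (fun i acc => a i + acc)%C (RtoC 0) L) l2). lra.
Qed.

(** The function chosen by [epsilon] is some continuation because [eis_cont] is one; both agree for
    Re s > 2 by uniqueness of unordered sums, hence everywhere. *)
Lemma G_eq tau s : 0 < Im tau -> G s tau = eis_cont tau s.
Proof.
  intros Hy. unfold G.
  assert (E : is_eis_continuation tau (epsilon (inhabits (fun _ : C => RtoC 0)) (is_eis_continuation tau))).
  { apply epsilon_spec. exists (eis_cont tau). split. apply eis_cont_entire; auto.
    intros; apply eis_cont_usum; auto. }
  destruct E as [E1 E2].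
  apply (entire_ext_half_plane _ (eis_cont tau) 2); auto. apply eis_cont_entire; auto.
  assert (dec : forall x y : Z * Z, {x = y} + {x <> y}) by (decide equality; apply Z.eq_dec).
  intros z Hz. apply (is_usum_unique dec (eis_term z tau)); auto.
  apply eis_cont_usum; auto.
Qed.

(** * The derivative at negative even integers *)

Lemma locally_Cmod (l : C) (P : C -> Prop) : @locally C_UniformSpace l P ->
  exists e, 0 < e /\ forall z, Cmod (z - l) < e -> P z.
Proof.
  intros [e H]. exists e. split; [apply cond_pos|]. intros z Hz. apply H.
  pose proof (Rmax_Cmod (z - l)%C) as M.
  split; unfold ball; simpl; unfold AbsRing_ball, abs, minus, plus, opp; simpl;
    (eapply Rle_lt_trans; [|exact Hz]); (eapply Rle_trans; [|exact M]).
  apply Rmax_l. apply Rmax_r.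
Qed.

Lemma sum_n_csum (f : nat -> C) n : @sum_n C_NormedModule f n = csum f (S n).
Proof.
  induction n.
  - rewrite sum_O. simpl. ring.
  - rewrite sum_Sn, IHn. reflexivity.
Qed.

Lemma Climit_is_series (f : nat -> C) l : Climit (csum f) l -> @is_series C_AbsRing C_NormedModule f l.
Proof.
  intros H P HP. destruct (locally_Cmod l P HP) as [e [He K]]. destruct (H e He) as [N HN].
  exists N. intros n Hn. rewrite sum_n_csum. apply K, HN. lia.
Qed.

Lemma csum_RtoC (b : nat -> R) n : csum (fun i => RtoC (b i)) n = RtoC (rsum b n).
Proof. induction n; simpl. reflexivity. rewrite IHn, RtoC_plus. reflexivity. Qed.

Lemma sum_n_rsum (b : nat -> R) n : sum_n b n = rsum b (S n).
Proof.
  induction n.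
  - rewrite sum_O. simpl. ring.
  - rewrite sum_Sn, IHn. reflexivity.
Qed.

Lemma Cexp_RtoC x : Cexp (RtoC x) = RtoC (exp x).
Proof.
  unfold Cexp. rewrite re_RtoC, im_RtoC, cos_0, sin_0. unfold RtoC. f_equal; ring.
Qed.

Lemma nat_pow_neg_even k i : nat_pow (S i) (neg_even k) = RtoC (Rpower (INR (S i)) (- INR (2 * k + 1))).
Proof.
  unfold nat_pow, Rpower, neg_even. rewrite plus_INR.
  replace ((- RtoC (INR (2 * k)) - 1) * RtoC (ln (INR (S i))))%C with
    (RtoC (- (INR (2 * k) + INR 1) * ln (INR (S i)))).
  - apply Cexp_RtoC.
  - change (INR 1) with 1. rewrite RtoC_mult, RtoC_opp, RtoC_plus. ring.
Qed.

Lemma zeta_limit k : (1 <= k)%nat ->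
  Climit (csum (fun i => nat_pow (S i) (neg_even k))) (RtoC (zeta (INR (2 * k + 1)))) /\
  1 <= zeta (INR (2 * k + 1)).
Proof.
  intros Hk. set (p := INR (2 * k + 1)).
  assert (Hp : 1 < p). { unfold p. replace 1 with (INR 1) by reflexivity. apply lt_INR. lia. }
  set (b := fun n => Rpower (INR (S n)) (- p)).
  destruct (p_series_bounded p Hp) as [U HU]. fold b in HU.
  assert (Hinc : forall n, rsum b n <= rsum b (S n)).
  { intros n. simpl. unfold b, Rpower. pose proof (exp_pos (- p * ln (INR (S n)))). simpl in *. lra. }
  destruct (ex_finite_lim_seq_incr (rsum b) U Hinc HU) as [l Hl].
  assert (E : zeta p = l).
  { assert (L : is_lim_seq (sum_n b) l).
    { apply (is_lim_seq_ext (fun n => rsum b (S n))).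
      intros n. rewrite sum_n_rsum. reflexivity. apply (is_lim_seq_incr_1 (rsum b)). exact Hl. }
    unfold zeta. apply is_series_unique. exact L. }
  rewrite E. split.
  - apply Climit_ext with (fun n => RtoC (rsum b n)).
    + intros n. rewrite <- csum_RtoC. apply csum_ext. intros i _. rewrite nat_pow_neg_even. reflexivity.
    + intros e He. apply is_lim_seq_spec in Hl. destruct (Hl (mkposreal e He)) as [N HN].
      exists N. intros n Hn. rewrite <- RtoC_minus, Cmod_R. apply (HN n Hn).
  - pose proof (is_lim_seq_incr_compare (rsum b) l Hl Hinc 1%nat) as C1.
    simpl in C1. unfold b, Rpower in C1. simpl in C1. rewrite ln_1, Rmult_0_r, exp_0 in C1. lra.
Qed.

Lemma exp_pi_i_neg_even k : exp_pi_i (neg_even k) = 1%C.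
Proof.
  unfold exp_pi_i. replace (PI * Ci * neg_even k)%C with (2 * PI * Ci * (- INR k))%C.
  - change (nome (- INR k) = 1%C). rewrite nome_opp, nome_INR. field.
  - unfold neg_even. rewrite mult_INR, RtoC_mult. change (INR 2) with 2. ring.
Qed.

(** [riemann_int] and [hankel] both vanish at -2k, so the product rule keeps only the terms with
    their derivatives, and the derivatives of [exp_pi_i] and [lambert] drop out. *)
Lemma Cder_eis_cont tau k : 0 < Im tau -> (1 <= k)%nat ->
  Cder (eis_cont tau) (neg_even k)
    (RtoC (dG_coef k) * (RtoC (zeta (INR (2 * k + 1))) + 2 * lambert tau (neg_even k)))%C.
Proof.
  intros Hy Hk. destruct (Cder_riemann_int_neg_even k Hk) as [Z0 [d [Hd Ld]]].
  destruct (zeta_limit k Hk) as [Lz _].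
  assert (E : d = (RtoC (dG_coef k) * RtoC (zeta (INR (2 * k + 1))))%C).
  { apply (Climit_unique _ _ _ Ld). eapply Climit_ext; [|apply Climit_scal; exact Lz].
    intros n. cbv beta. rewrite <- csum_scal. apply csum_ext. intros; ring. }
  destruct (exp_pi_i_entire (neg_even k)) as [d1 H1].
  destruct (lambert_entire tau Hy (neg_even k)) as [d2 H2].
  pose proof (Cder_plus _ _ _ _ _ (Cder_mult _ _ _ _ _ H1 Hd)
    (Cder_mult _ _ _ _ _ (Cder_plus _ _ _ _ _ (Cder_const (RtoC 1) (neg_even k)) H1)
      (Cder_mult _ _ _ _ _ (Cder_hankel_neg_even k) H2))) as H.
  eapply Cder_eq; [exact H|]. cbv beta. rewrite Z0, hankel_neg_even, exp_pi_i_neg_even, E.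
  match goal with |- @eq _ ?a ?b => change (@eq C a b) end. ring.
Qed.

Lemma IZR_neg_even k : RtoC (IZR (- 2 * Z.of_nat k)) = neg_even k.
Proof.
  unfold neg_even. rewrite mult_IZR, <- INR_IZR_INZ, mult_INR, <- RtoC_opp. f_equal. simpl. ring.
Qed.

Lemma dG_value tau k : 0 < Im tau -> (1 <= k)%nat ->
  dG (- 2 * Z.of_nat k) tau =
  (RtoC (dG_coef k) * (RtoC (zeta (INR (2 * k + 1))) + 2 * lambert tau (neg_even k)))%C.
Proof.
  intros Hy Hk. unfold dG. rewrite IZR_neg_even. apply is_C_derive_unique.
  eapply is_derive_ext; [|apply Cder_eis_cont; auto].
  intros s. symmetry. apply G_eq; auto.
Qed.

Lemma nat_pow_powerRZ k i :
  nat_pow (S i) (neg_even k) = RtoC (powerRZ (INR (S i)) (- 2 * Z.of_nat k - 1)).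
Proof.
  rewrite nat_pow_neg_even, powerRZ_Rpower by (apply lt_0_INR; lia). do 2 f_equal.
  rewrite minus_IZR, mult_IZR, <- INR_IZR_INZ, plus_INR, mult_INR. simpl. ring.
Qed.

(** 1 / (1 - q^n) = 1 + q^n / (1 - q^n) splits the series into zeta and the Lambert series. *)
Lemma one_sub_series tau k : 0 < Im tau -> (1 <= k)%nat ->
  Climit (csum (fun n => RtoC (powerRZ (INR (S n)) (- 2 * Z.of_nat k - 1)) / (1 - Cpow (nome tau) (S n)))%C)
    (RtoC (zeta (INR (2 * k + 1))) + lambert tau (neg_even k))%C.
Proof.
  intros Hy Hk. destruct (zeta_limit k Hk) as [Lz _].
  eapply Climit_ext; [|apply Climit_plus; [exact Lz|apply (lambert_spec tau (neg_even k) Hy)]].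
  intros n. cbv beta. rewrite <- csum_plus. apply csum_ext. intros i _. unfold lambert_term.
  rewrite nat_pow_powerRZ. field. apply one_sub_nome_pow_nz; auto.
Qed.

Definition div_ind (n d : nat) : bool := Nat.eqb (Nat.modulo n d) 0.

Lemma fold_right_Rplus_snoc l x : fold_right Rplus 0 (l ++ x :: nil) = fold_right Rplus 0 l + x.
Proof. induction l; simpl. ring. rewrite IHl. ring. Qed.

Lemma fold_filter_rsum (f : nat -> R) (p : nat -> bool) n :
  fold_right Rplus 0 (map f (filter p (seq 1 n))) = rsum (fun i => if p (S i) then f (S i) else 0) n.
Proof.
  induction n. reflexivity.
  rewrite seq_S, filter_app, map_app. cbn [rsum filter]. simpl (1 + n)%nat.
  destruct (p (S n)).
  - cbn [map]. rewrite fold_right_Rplus_snoc, IHn. reflexivity.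
  - cbn [map]. rewrite app_nil_r, IHn. ring.
Qed.

Lemma sigma_rsum a n N : (1 <= n <= N)%nat ->
  sigma a n = rsum (fun i => if div_ind n (S i) then powerRZ (INR (S i)) a else 0) N.
Proof.
  intros Hn. unfold sigma. rewrite (fold_filter_rsum (fun d => powerRZ (INR d) a) (div_ind n)).
  replace N with (n + (N - n))%nat by lia. induction (N - n)%nat as [|j IH].
  - rewrite Nat.add_0_r. reflexivity.
  - rewrite Nat.add_succ_r. cbn [rsum]. rewrite <- IH.
    unfold div_ind at 3. rewrite Nat.mod_small by lia.
    destruct (Nat.eqb n 0) eqn:E; [apply Nat.eqb_eq in E; lia|]. ring.
Qed.

Lemma multiples_sum (q : C) r N : (1 <= r)%nat -> Cpow q r <> 1%C ->
  csum (fun n => if div_ind (S n) r then Cpow q (S n) else 0%C) N =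
  ((Cpow q r - Cpow q (r * (N / r + 1))) / (1 - Cpow q r))%C.
Proof.
  intros Hr Hq. assert (D : (1 - Cpow q r)%C <> 0%C) by (apply Cminus_eq_contra; auto).
  induction N.
  - rewrite Nat.div_0_l by lia. cbn [csum]. rewrite Nat.add_0_l, Nat.mul_1_r. field. auto.
  - cbn [csum]. rewrite IHN. unfold div_ind.
    pose proof (Nat.div_mod (S N) r ltac:(lia)) as E. pose proof (Nat.mod_upper_bound (S N) r ltac:(lia)) as B.
    set (c := (S N / r)%nat) in *. set (m := (S N mod r)%nat) in *.
    destruct (Nat.eqb m 0) eqn:Em.
    + apply Nat.eqb_eq in Em. rewrite Em in E.
      assert (Hc : (1 <= c)%nat) by (destruct c; lia).
      assert (Q : (N / r)%nat = (c - 1)%nat).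
      { symmetry. apply (Nat.div_unique N r (c - 1) (r - 1)); [lia|]. nia. }
      rewrite Q. replace (c - 1 + 1)%nat with c by lia.
      replace (S N) with (r * c)%nat by lia.
      replace (r * (c + 1))%nat with (r + r * c)%nat by lia. rewrite (Cpow_add_r q r). field. auto.
    + apply Nat.eqb_neq in Em.
      assert (Q : (N / r)%nat = c).
      { symmetry. apply (Nat.div_unique N r c (m - 1)); lia. }
      rewrite Q. ring.
Qed.

Lemma nat_pow_neg_even_le1 k i : Cmod (nat_pow (S i) (neg_even k)) <= 1.
Proof.
  rewrite Cmod_nat_pow. apply Rle_trans with (exp 0); [apply exp_le|rewrite exp_0; lra]. pose proof (ln_INR_ge0 i).
  unfold neg_even. rewrite re_opp, re_RtoC. pose proof (pos_INR (2 * k)).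
  assert (0 <= (1 + INR (2 * k)) * ln (INR (S i))) by (apply Rmult_le_pos; lra). lra.
Qed.

Lemma n_geom_lim (r : R) : 0 < r < 1 -> is_lim_seq (fun n => INR n * r ^ n) 0.
Proof.
  intros Hr. set (d := - ln r / 2).
  assert (Hd : 0 < d). { unfold d. pose proof (ln_increasing r 1 ltac:(lra) ltac:(lra)). rewrite ln_1 in H. lra. }
  apply (is_lim_seq_le_le (fun _ => 0) _ (fun n => / d * exp (- d) ^ n)).
  - intros n. pose proof (pos_INR n). assert (0 < r ^ n) by (apply pow_lt; lra). split. nra.
    assert (E : r ^ n = exp (- (INR n * d)) * exp (- (INR n * d))).
    { rewrite <- exp_plus. rewrite <- (exp_ln r) at 1 by lra. rewrite exp_pow_INR. f_equal. unfold d. field. }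
    rewrite E, exp_pow_INR. replace (INR n * - d) with (- (INR n * d)) by ring.
    set (x := INR n * d) in *. assert (X : x <= exp x).
    { pose proof (exp_ineq1_le x). lra. }
    pose proof (exp_pos (- x)) as P.
    assert (Y : x * exp (- x) <= 1).
    { apply Rle_trans with (exp x * exp (- x)). apply Rmult_le_compat_r; lra.
      rewrite <- exp_plus, Rplus_opp_r, exp_0. lra. }
    replace (INR n) with (/ d * x) by (unfold x; field; lra).
    assert (0 < / d) by (apply Rinv_0_lt_compat; auto).
    replace (/ d * x * (exp (- x) * exp (- x))) with (/ d * (x * exp (- x)) * exp (- x)) by ring.
    apply Rmult_le_compat_r; [lra|]. nra.
  - apply is_lim_seq_const.
  - apply is_lim_seq_scal_0, is_lim_seq_geom. rewrite Rabs_pos_eq by (apply Rlt_le, exp_pos).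
    rewrite <- exp_0. apply exp_increasing. lra.
Qed.

Lemma rsum_const c n : rsum (fun _ => c) n = INR n * c.
Proof. induction n. simpl. ring. cbn [rsum]. rewrite IHn, S_INR. ring. Qed.

(** Truncate at n <= N and sum first over the multiples of each r <= N. Every inner sum misses its
    Lambert term by at most rho^N / (1 - rho), and N such errors tend to 0. *)
Lemma sigma_series tau k : 0 < Im tau ->
  Climit (csum (fun n => RtoC (sigma (- 2 * Z.of_nat k - 1) (S n)) * Cpow (nome tau) (S n))%C)
    (lambert tau (neg_even k)).
Proof.
  intros Hy. set (q := nome tau). set (a := (- 2 * Z.of_nat k - 1)%Z).
  pose proof (rho_bounds tau Hy) as Hr.
  apply (Climit_squeeze _ (csum (lambert_term tau (neg_even k))) _ (fun N => / (1 - rho tau) * (INR N * rho tau ^ N)));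
    [|apply is_lim_seq_scal_0, n_geom_lim; auto
     |apply lambert_spec; auto].
  intros N.
  assert (E : csum (fun n => RtoC (sigma a (S n)) * Cpow q (S n))%C N =
    csum (fun i => nat_pow (S i) (neg_even k) *
      csum (fun n => if div_ind (S n) (S i) then Cpow q (S n) else 0%C) N)%C N).
  { transitivity (csum (fun n => csum (fun i => nat_pow (S i) (neg_even k) *
      (if div_ind (S n) (S i) then Cpow q (S n) else 0%C))%C N) N).
    - apply csum_ext. intros n Hn. rewrite (sigma_rsum a (S n) N) by lia.
      rewrite <- csum_RtoC, Cmult_comm, <- csum_scal. apply csum_ext. intros i _.
      rewrite nat_pow_powerRZ. fold a. destruct (div_ind (S n) (S i)); ring.
    - rewrite csum_exchange. apply csum_ext. intros i _. rewrite csum_scal. reflexivity. }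
  rewrite E, <- csum_minus.
  pose proof (csum_tail (fun i => nat_pow (S i) (neg_even k) *
      csum (fun n => if div_ind (S n) (S i) then Cpow q (S n) else 0%C) N - lambert_term tau (neg_even k) i)%C
      (fun _ => / (1 - rho tau) * rho tau ^ N) 0 N) as T.
  simpl csum at 2 in T. simpl rsum at 2 in T. rewrite rsum_const in T.
  match goal with |- Cmod ?e <= _ => replace e with (e - 0)%C by ring end.
  eapply Rle_trans; [apply T; [|lia]|right; ring].
  intros i. assert (Hq : Cpow q (S i) <> 1%C).
  { intros X. apply (one_sub_nome_pow_nz tau i Hy). fold q. rewrite X. ring. }
  assert (D : (1 - Cpow q (S i))%C <> 0%C) by (apply one_sub_nome_pow_nz; auto).
  rewrite multiples_sum by (auto; lia). unfold lambert_term. fold q.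
  (* The first multiple of [S i] beyond N, where the missing geometric tail starts. *)
  set (e := (S i * (N / S i + 1))%nat).
  assert (He : (N <= e)%nat).
  { unfold e. pose proof (Nat.div_mod N (S i) ltac:(lia)). pose proof (Nat.mod_upper_bound N (S i) ltac:(lia)). lia. }
  replace (nat_pow (S i) (neg_even k) * ((Cpow q (S i) - Cpow q e) / (1 - Cpow q (S i)))
    - nat_pow (S i) (neg_even k) * (Cpow q (S i) / (1 - Cpow q (S i))))%C with
    (- (nat_pow (S i) (neg_even k) * (Cpow q e / (1 - Cpow q (S i)))))%C by (field; auto).
  rewrite Cmod_opp, Cmod_mult, Cmod_div by auto. unfold q. rewrite nome_pow_mod.
  pose proof (one_sub_nome_pow tau i Hy). pose proof (nat_pow_neg_even_le1 k i).
  assert (rho tau ^ e <= rho tau ^ N).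
  { replace e with (N + (e - N))%nat by lia. rewrite pow_add.
    assert (rho tau ^ (e - N) <= 1) by (rewrite <- (pow1 (e - N)); apply pow_incr; lra).
    assert (0 < rho tau ^ N) by (apply pow_lt; lra). nra. }
  assert (0 < rho tau ^ e) by (apply pow_lt; lra).
  replace (/ (1 - rho tau) * rho tau ^ N) with (1 * (rho tau ^ N * / (1 - rho tau))) by ring.
  apply Rmult_le_compat; auto. apply Cmod_ge_0.
  { apply Rmult_le_pos; [lra|]. apply Rlt_le, Rinv_0_lt_compat. lra. }
  apply Rmult_le_compat; try lra. apply Rlt_le, Rinv_0_lt_compat; lra.
  apply Rinv_le_contravar; lra.
Qed.

(** For rho <= 1/2 the factor 1 / (1 - rho) <= 2 occurs twice, once from the Lambert denominators
    and once from the geometric series. *)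
Lemma lambert_small tau k : 0 < Im tau -> rho tau <= 1/2 -> Cmod (lambert tau (neg_even k)) <= 4 * rho tau.
Proof.
  intros Hy H. pose proof (rho_bounds tau Hy) as Hr.
  apply (Climit_le (csum (lambert_term tau (neg_even k)))); [|apply lambert_spec; auto].
  intros n.
  pose proof (csum_tail (lambert_term tau (neg_even k)) (fun i => / (1 - rho tau) * rho tau ^ S i) 0 n) as T.
  simpl csum at 2 in T. simpl rsum at 2 in T. rewrite rsum_scal in T.
  replace (csum (lambert_term tau (neg_even k)) n) with (csum (lambert_term tau (neg_even k)) n - 0)%C by ring.
  eapply Rle_trans; [apply T; [|lia]|].
  - intros i. unfold lambert_term. rewrite Cmod_mult.
    pose proof (nat_pow_neg_even_le1 k i). pose proof (lambert_factor_bound tau i Hy).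
    replace (/ (1 - rho tau) * rho tau ^ S i) with (1 * (rho tau ^ S i / (1 - rho tau))) by (unfold Rdiv; ring).
    apply Rmult_le_compat; auto; apply Cmod_ge_0.
  - rewrite Rminus_0_r. pose proof (geom_rsum_bounded (rho tau) Hr n) as B.
    assert (I2 : / (1 - rho tau) <= 2).
    { replace 2 with (/ (1/2)) by field. apply Rinv_le_contravar; lra. }
    assert (I0 : 0 < / (1 - rho tau)) by (apply Rinv_0_lt_compat; lra).
    assert (B2 : rsum (fun i => rho tau ^ S i) n <= 2 * rho tau).
    { eapply Rle_trans; [exact B|]. unfold Rdiv. nra. }
    apply Rle_trans with (/ (1 - rho tau) * (2 * rho tau)); [apply Rmult_le_compat_l; lra|]. nra.
Qed.

Lemma dG_coef_nz k : dG_coef k <> 0.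
Proof.
  unfold dG_coef. pose proof PI_RGT_0. apply Rmult_integral_contrapositive_currified.
  - apply Rmult_integral_contrapositive_currified. apply pow_nonzero; lra. apply INR_fact_neq_0.
  - apply Rinv_neq_0_compat, pow_nonzero. lra.
Qed.

Lemma dG_limit k : (1 <= k)%nat ->
  filterlim (dG (- 2 * Z.of_nat k)) at_i_infty
    (locally (RtoC (dG_coef k * zeta (INR (2 * k + 1))))).
Proof.
  intros Hk P HP. destruct (locally_Cmod _ P HP) as [e [He K]].
  set (A := Rabs (dG_coef k)). assert (HA : 0 <= A) by apply Rabs_pos.
  (* The difference from the limit is at most A times 2 times 4 rho; rho < d makes this less than
     [e], and 1/2 is the range of [lambert_small]. *)
  set (d := Rmin (1/2) (e / (8 * (A + 1)))).
  assert (Hd : 0 < d) by (apply Rmin_pos; [lra|]; apply Rdiv_lt_0_compat; lra).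
  assert (d <= 1/2) by apply Rmin_l.
  assert (Hd2 : d * (8 * (A + 1)) <= e).
  { apply Rle_trans with (e / (8 * (A + 1)) * (8 * (A + 1))). apply Rmult_le_compat_r; [lra|apply Rmin_r].
    right; field; lra. }
  exists (Rmax 0 (- ln d)). intros tau Ht.
  pose proof (Rmax_l 0 (- ln d)). pose proof (Rmax_r 0 (- ln d)).
  assert (Hy : 0 < Im tau) by lra. apply K. rewrite dG_value by auto.
  rewrite RtoC_mult.
  match goal with |- Cmod ?x < _ =>
    replace x with (RtoC (dG_coef k) * (2 * lambert tau (neg_even k)))%C by ring end.
  rewrite !Cmod_mult, !Cmod_R, (Rabs_pos_eq 2) by lra. fold A.
  assert (Hr : rho tau < d).
  { unfold rho. rewrite <- (exp_ln d Hd). apply exp_increasing. pose proof PI_ge_2. nra. }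
  pose proof (lambert_small tau k Hy ltac:(lra)) as B. pose proof (rho_bounds tau Hy).
  pose proof (Cmod_ge_0 (lambert tau (neg_even k))). nra.
Qed.

Theorem theorem6p21 :
  forall k : nat, (1 <= k)%nat ->
    (forall tau : C, 0 < Im tau ->
       exists S1 S2 : C,
         @is_series C_AbsRing C_NormedModule
           (fun n : nat =>
              (RtoC (powerRZ (INR (S n)) (- 2 * Z.of_nat k - 1))
                 / (1 - Cpow (nome tau) (S n)))%C) S1 /\
         @is_series C_AbsRing C_NormedModule
           (fun n : nat =>
              (RtoC (sigma (- 2 * Z.of_nat k - 1) (S n))
                 * Cpow (nome tau) (S n))%C) S2 /\
         dG (- 2 * Z.of_nat k) tau
           = (RtoC (dG_coef k) * (2 * S1 - RtoC (zeta (INR (2 * k + 1)))))%C /\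
         dG (- 2 * Z.of_nat k) tau
           = (RtoC (dG_coef k) * (RtoC (zeta (INR (2 * k + 1))) + 2 * S2))%C) /\
    filterlim (dG (- 2 * Z.of_nat k)) at_i_infty
      (locally (RtoC (dG_coef k * zeta (INR (2 * k + 1))))) /\
    dG_coef k * zeta (INR (2 * k + 1)) <> 0.
Proof.
  intros k Hk. split; [|split].
  - intros tau Hy.
    (* With S1 = zeta + S2 both expressions reduce to zeta + 2 S2, the form of [dG_value]. *)
    exists (RtoC (zeta (INR (2 * k + 1))) + lambert tau (neg_even k))%C, (lambert tau (neg_even k)).
    split; [apply Climit_is_series, one_sub_series; auto|].
    split; [apply Climit_is_series, sigma_series; auto|].
    split; rewrite dG_value by auto; ring.
  - apply dG_limit; auto.
  - apply Rmult_integral_contrapositive_currified; [apply dG_coef_nz|].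
    destruct (zeta_limit k Hk). lra.
Qed.
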